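(* Let $\alpha\in(0,1)$, $m,\ell\in\mathbb{N}_0$, and $p,n\in\mathbb{N}$ with $p\ge2$ and $(m,\ell)\neq(0,0)$. Let $A\in\mathbb{C}^{n\times n}$ be Hermitian positive definite with eigenvalues in $[\alpha^p,1]$. Then the coupled iteration $$Y_{k+1}=Y_k\,h_{\ell,m,p}(Z_kY_k,\alpha_k)^{p-1},\quad Y_0=A,$$ $$Z_{k+1}=h_{\ell,m,p}(Z_kY_k,\alpha_k)\,Z_k,\quad Z_0=I,$$ $$\alpha_{k+1}=\alpha_k\,h_{\ell,m,p}(\alpha_k^p,\alpha_k),\quad\alpha_0=\alpha,$$ generates sequences $\widetilde Y_k=(1+\alpha_k)^{p-1}Y_k/(2\alpha_k)^{p-1}$ and $\widetilde Z_k=(1+\alpha_k)Z_k/(2\alpha_k)$ that converge to $A^{1/p}$ and $A^{-1/p}$, respectively, with order $m+\ell+1$. In particular, $$\|\widetilde Y_kA^{-1/p}-I\|_2\le\frac{(1+\varepsilon_k)^{p-1}-1}{(1-\varepsilon_k)^{p-1}},\qquad\|\widetilde Z_kA^{1/p}-I\|_2\le\frac{\varepsilon_k}{1-\varepsilon_k},$$ for every $k\ge0$, where $\varepsilon_k$ obeys the recursion $$\varepsilon_{k+1}=E_{m,\ell}\left(\sqrt[p]{\cdot},\left[\left(\frac{1-\varepsilon_k}{1+\varepsilon_k}\right)^p,1\right]\right)=C(m,\ell,p)\,\varepsilon_k^{m+\ell+1}+o(\varepsilon_k^{m+\ell+1}),\quad\varepsilon_0=\frac{1-\alpha}{1+\alpha},$$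 with $$C(m,\ell,p)=\frac{p^{m+\ell+1}\,m!\,\ell!\,(1/p)_{\ell+1}(1-1/p)_m}{2^{m+\ell}(m+\ell+1)!\,(m+\ell)!}.$$
   Context: $(\beta)_m=\beta(\beta+1)\cdots(\beta+m-1)$ is the rising factorial (with $(\beta)_0=1$). $A^{1/p}$ is the principal $p$th root. $\mathcal{R}_{m,\ell}$ is the set of ratios of (real) polynomials of degree $\le m$ to polynomials of degree $\le\ell$. For $\alpha\in(0,1)$, $$r_{m,\ell}(\cdot,\alpha,\sqrt[p]{\cdot})=\operatorname{arg\,min}_{r\in\mathcal{R}_{m,\ell}}\max_{z\in[\alpha^p,1]}\left|\frac{r(z)-z^{1/p}}{z^{1/p}}\right|$$ is the (unique) best approximant, and $\hat r_{m,\ell}(\cdot,\alpha,\sqrt[p]{\cdot})$ is the unique scalar multiple of it satisfying $\min_{z\in[\alpha^p,1]}\frac{\hat r_{m,\ell}(z,\alpha,\sqrt[p]{\cdot})-z^{1/p}}{z^{1/p}}=0$. Set $h_{\ell,m,p}(z,\alpha)=\hat r_{m,\ell}(z,\alpha,\sqrt[p]{\cdot})^{-1}$, a rational function of $z$ of type $(\ell,m)$. Rational functions are evaluated at matrices in the usual sense of matrix functions. $E_{m,\ell}(f,S)=\min_{r\in\mathcal{R}_{m,\ell}}\max_{z\in S}\left|\frac{r(z)-f(z)}{f(z)}\right|$. Convergence with order $q$ is meant in the sense quantified by the displayed bounds, which are controlled by a sequence $\varepsilon_k\to0$ with $\varepsilon_{k+1}=O(\varepsilon_k^q)$. The $o(\cdot)$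 is as $k\to\infty$. *)

(* Defs.v *)
From HB Require Import structures.
From mathcomp Require Import all_boot all_order all_algebra.
From mathcomp Require Import sesquilinear spectral complex.
From mathcomp Require Import all_classical all_reals all_analysis.
Set Implicit Arguments.
Unset Strict Implicit.
Unset Printing Implicit Defensive.

Import Order.TTheory GRing.Theory Num.Theory.
Import numFieldNormedType.Exports.
Local Open Scope classical_set_scope.
Local Open Scope ring_scope.
Local Open Scope complex_scope.
Local Open Scope sesquilinear_scope.

Section RationalFunctions.
Context {R : realType}.

(* A rational function is a pair (numerator, denominator).  The pairs that
   matter below are in lowest terms, so that the poles are exactly the roots of
   the denominator, for scalar and for matrix arguments alike. *)
Definition ratfun : Type := ({poly R} * {poly R})%type.

Definition rat_eval (r : ratfun) (z : R) : R := r.1.[z] / r.2.[z].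

Definition rat_scale (c : R) (r : ratfun) : ratfun := (c *: r.1, r.2).

Definition rat_inv (r : ratfun) : ratfun := (r.2, r.1).

Definition poly_eval_mx n (q : {poly R}) (A : 'M[R[i]]_n.+1) : 'M[R[i]]_n.+1 :=
  horner_mx A (map_poly (real_complex R) q).

Definition rat_eval_mx n (r : ratfun) (A : 'M[R[i]]_n.+1) : 'M[R[i]]_n.+1 :=
  poly_eval_mx r.1 A / poly_eval_mx r.2 A.

(* Reduced fractions with monic denominator: each rational function of type
   (m, l) has exactly one such representation (cancelling common factors does
   not raise the degrees). *)
Definition rat_type (m l : nat) : set ratfun :=
  [set r : ratfun | [/\ (size r.1 <= m.+1)%N, (size r.2 <= l.+1)%N,
               coprimep r.1 r.2 & r.2 \is monic]].

Definition rel_err (r : ratfun) (f : R -> R) (z : R) : R :=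
  (rat_eval r z - f z) / f z.

(* Extended-real valued, since r may have poles on S; the value at a pole has to
   be set to +oo explicitly because x / 0 = 0 in the library. *)
Definition max_rel_err (r : ratfun) (f : R -> R) (S : set R) : \bar R :=
  ereal_sup [set (if root r.2 z then +oo%E else `|rel_err r f z|%:E) | z in S].

(* The infimum is attained for f continuous and nonvanishing on a compact
   interval S; it is finite because constant functions have finite error. *)
Definition best_err (m l : nat) (f : R -> R) (S : set R) : R :=
  fine (ereal_inf [set max_rel_err r f S | r in rat_type m l]).

Definition is_best_approx (m l : nat) (f : R -> R) (S : set R) (r : ratfun) :=
  rat_type m l r /\
  forall s, rat_type m l s -> (max_rel_err r f S <= max_rel_err s f S)%E.

Definition best_approx (m l : nat) (f : R -> R) (S : set R) : ratfun :=
  xget (0, 1) (is_best_approx m l f S).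

Definition is_minimum (V : set R) (v : R) := V v /\ lbound V v.

Definition proot (p : nat) (z : R) : R := z `^ (p%:R^-1).

(* On [alpha ^+ p, 1] the minimality condition determines the scalar c. *)
Definition rhat (m l p : nat) (alpha : R) : ratfun :=
  let S := `[alpha ^+ p, 1]%classic in
  let r := best_approx m l (proot p) S in
  xget (0, 1) [set s | (exists c, s = rat_scale c r) /\
                       is_minimum [set rel_err s (proot p) z | z in S] 0].

(* Type (l, m): numerator and denominator of rhat are exchanged. *)
Definition hfun (l m p : nat) (alpha : R) : ratfun := rat_inv (rhat m l p alpha).

Definition rising (b : R) (k : nat) : R := \prod_(i < k) (b + i%:R).

Definition rate_const (m l p : nat) : R :=
  (p%:R ^+ (m + l + 1) * m`!%:R * l`!%:R
     * rising (p%:R^-1) l.+1 * rising (1 - p%:R^-1) m)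
  / (2 ^+ (m + l) * (m + l + 1)`!%:R * (m + l)`!%:R).

End RationalFunctions.

Section Matrices.
Context {R : realType}.

Definition posdefmx n (A : 'M[R[i]]_n) : Prop :=
  A \is hermsymmx /\
  forall x : 'cV[R[i]]_n, x != 0 -> 0 < (x^t* *m A *m x) 0 0.

Definition l2norm n (x : 'cV[R[i]]_n) : R :=
  Num.sqrt (\sum_i Normc.normc (x i 0) ^+ 2).

Definition opnorm2 n (A : 'M[R[i]]_n) : R :=
  sup [set l2norm (A *m x) | x in [set x : 'cV[R[i]]_n | l2norm x = 1]].

(* All eigenvalues lie in the open sector |arg| < pi / p. *)
Definition is_principal_root n (p : nat) (A X : 'M[R[i]]_n.+1) : Prop :=
  X ^+ p = A /\
  forall a : R[i], eigenvalue X a ->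
    exists rho theta : R, [/\ 0 < rho, `|theta| < pi / p%:R &
      a = (rho * cos theta) +i* (rho * sin theta)].

Definition mxroot n (p : nat) (A : 'M[R[i]]_n.+1) : 'M[R[i]]_n.+1 :=
  xget 0 (is_principal_root p A).

End Matrices.

(* Main.v *)
Require Import Defs.
From HB Require Import structures.
From mathcomp Require Import all_boot all_order all_algebra.
From mathcomp Require Import sesquilinear spectral complex.
From mathcomp Require Import all_classical all_reals all_analysis.
From mathcomp Require Import zify ring lra polyrcf.
Import Order.TTheory GRing.Theory Num.Theory.
Import numFieldNormedType.Exports.
Set Implicit Arguments.
Unset Strict Implicit.
Unset Printing Implicit Defensive.
Local Open Scope classical_set_scope.
Local Open Scope ring_scope.

(** In the variable [t = z^(1/p)] a pair [P / Q] approximates [z^(1/p)] with relative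
error [P(t^p) / (t Q(t^p)) - 1] on [[alpha, 1]].  The zeros of its derivative are the
[p]-th roots of the zeros of [D = P Q - p z (P' Q - P Q')], whose degree is at most
[m + l].  So a best approximant has at most [m + l] critical points inside the
interval, hence at most [m + l + 2] points where the error reaches its maximum [E],
endpoints included.  The usual perturbation argument ([no_separation], [ext_full])
shows that it needs at least that many.  So the degrees are full, both endpoints and
all critical points are extremal, and the error alternates between [E] and [- E].

The defect [P(t^p) - t Q(t^p)] is a combination of [m + l + 2] distinct powers of [t]
with the maximal number [m + l + 1] of positive zeros.  Removing all powers but two by
Rolle's theorem ([two_terms]) compares its coefficients with the weights of the
divided difference at the exponents.  This determines their signs, and the sign of
[D(0) = P(0) Q(0)] shows that the error at the left endpoint is [+ E]
([best_approx_equioscillates]).  After the scaling which defines [h], the function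
[t h(t^p)] therefore maps [[alpha, 1]] into [[(1 - E) / (1 + E), 1]] and [alpha] to the
left endpoint ([hfunP]).  Hence [alpha_k = (1 - eps_k) / (1 + eps_k)] for all [k]
([alE]), and [eps] decreases to 0, as its recursion has no positive fixed point and the
best error is semicontinuous ([eps_cvg0]).

As [alpha] tends to 1, the same comparison gives the coefficients of the best
approximant up to a common factor and a relative error [O(1 - alpha)].  By the
remainder formula of interpolation, the relative error is then a nearly constant
multiple of the monic polynomial [w] vanishing at the zeros of the defect
([error_representation]).  The limit of the reciprocal of the multiple is, up to the
factor [(m + l + 1)!], a sum of divided difference weights, which iterated differences
evaluate ([sum_lweight_expo]).  Since the error equioscillates, the maximum of [|w|] is
asymptotically that of the monic Chebyshev polynomial of the interval
([best_err_bounds]), which gives [C(m, l, p)] ([best_err_asymptotic]).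

The matrix part reduces to these scalar facts in a unitary eigenbasis of [A]
([iterates_spec]): the eigenvalues of [A^(1/p) Z_k] obey the recursion of [alpha] and
stay in [[alpha_k, 1]], which yields the two bounds in operator norm.  The principal
[p]-th root of [A] is its positive root because a principal root is unique
([principal_root_unique]). *)

(** * Interlacing, the mean value theorem for quotients, Lagrange interpolation *)

(** If any two points related by [E] have a point of [Z] strictly between them,
then an [E]-chain of [k + 1] points yields [k] increasing points of [Z]. *)
Lemma interlace (R : realDomainType) (E : rel R) (Z : R -> Prop) :
  (forall x y, E x y -> exists2 c, x < c < y & Z c) ->
  forall x s, path E x s -> exists s',
    [/\ path <%R x s', size s' = size s, (forall c, c \in s' -> Z c)
      & forall c, c \in s' -> c < last x s].
Proof.
move=> EZ x s; elim: s x => [|y s IHs] x /=; first by exists [::].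
move=> /andP[Exy /IHs[s' [ps' ss' Zs' ls']]].
have [c /andP[xc cy] Zc] := EZ _ _ Exy.
have yl : y <= last y s.
  case: s' ps' ss' ls' {Zs'} => [|d s'] /=.
    by move=> _ /esym/size0nil->.
  by case/andP=> yd _ _ /(_ d); rewrite mem_head => /(_ isT)/(lt_trans yd)/ltW.
exists (c :: s'); split => /=.
- rewrite xc /=; case: s' ps' {ss' Zs' ls'} => //= d s' /andP[yd ->].
  by rewrite (lt_trans cy yd).
- by rewrite ss'.
- by move=> d; rewrite inE => /predU1P[->|/Zs'].
- move=> d; rewrite inE => /predU1P[->|/ls'//].
  exact: lt_le_trans yl.
Qed.

Lemma rat_MVT (R : realType) (P Q : {poly R}) (x y : R) : x < y ->
  (forall t, x <= t <= y -> Q.[t] != 0) ->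
  exists2 c, x < c < y & P.[y] / Q.[y] - P.[x] / Q.[x] =
    (P^`() * Q - P * Q^`()).[c] / Q.[c] ^+ 2 * (y - x).
Proof.
move=> xy Q0.
have := @MVT R (fun t => P.[t] / Q.[t])
  (fun c => (P^`() * Q - P * Q^`()).[c] / Q.[c] ^+ 2) _ _ xy.
case.
- move=> t; rewrite in_itv /= => /andP[xt ty].
  have Qt0 : Q.[t] != 0 by rewrite Q0 // !ltW.
  have dV := @is_deriveV R (horner Q) t Q^`().[t] 1 Qt0 (is_derive_poly Q t).
  have dM := is_deriveM (is_derive_poly P t) dV.
  apply: is_derive_eq dM _.
  have quotE (u v u' v' : R) : v != 0 ->
      u * (- v ^- 2 * v') + v^-1 * u' = (u' * v - u * v') / v ^+ 2.
    by move=> v0; field.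
  rewrite hornerD hornerN !hornerM; exact: quotE.
- apply: continuous_in_subspaceT => t; rewrite inE /= in_itv /= => /Q0 Qt0.
  by apply: cvgM; [exact: continuous_horner | apply: cvgV => //; exact: continuous_horner].
- by move=> c; rewrite in_itv /= => cxy ->; exists c.
Qed.

Section Lagrange.
Variables (F : fieldType) (I : finType) (x : I -> F).

(** The weights [1 / \prod_(j != i) (x i - x j)] of the divided difference at the
nodes [x]. *)
Definition lweight i : F := \prod_(j | j != i) (x i - x j)^-1.

Hypothesis x_inj : injective x.

Lemma lweight_neq0 i : lweight i != 0.
Proof.
apply/prodf_neq0 => j ji; rewrite invr_eq0 subr_eq0.
by apply: contra ji => /eqP/x_inj->.
Qed.

(** The nodal polynomial with the factor of the [i]-th node left out, not
normalised; [lweight i *: lbasis i] is the Lagrange basis polynomial. *)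
Definition lbasis i : {poly F} := \prod_(j | j != i) ('X - (x j)%:P).

Lemma size_lbasis i : size (lbasis i) = #|I|.
Proof.
rewrite /lbasis -big_filter size_prod_XsubC; have [e _ _ [_ ->]] := big_enumP.
rewrite [RHS](cardD1 i) inE /= add1n; congr _.+1.
by apply: eq_card => j; rewrite !inE andbT.
Qed.

Lemma lbasis_monic i : lbasis i \is monic.
Proof. exact: monic_prod_XsubC. Qed.

Lemma horner_lbasis i j : (lbasis i).[x j] * lweight i = (i == j)%:R.
Proof.
rewrite horner_prod /lweight -big_split /=; have [->|ij] := eqVneq i j.
  apply: big1 => k kj; rewrite !hornerE divff // subr_eq0.
  by apply: contra kj => /eqP/x_inj->.
by rewrite (bigD1 j) 1?eq_sym //= !hornerE subrr !mul0r.
Qed.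

Lemma lagrange_exists (v : I -> F) :
  exists2 W : {poly F}, (size W <= #|I|)%N & forall i, W.[x i] = v i.
Proof.
exists (\sum_i (v i * lweight i) *: lbasis i) => [|j].
  apply: (leq_trans (size_sum _ _ _)); apply/bigmax_leqP => i _.
  by rewrite (leq_trans (size_scale_leq _ _)) ?size_lbasis.
rewrite horner_sum (bigD1 j) //= big1 => [|i ij].
  by rewrite hornerZ mulrAC -mulrA horner_lbasis eqxx mulr1 addr0.
by rewrite hornerZ mulrAC -mulrA horner_lbasis (negbTE ij) mulr0.
Qed.

Lemma poly_eq_nodes (g h : {poly F}) : (size g <= #|I|)%N -> (size h <= #|I|)%N ->
  (forall i, g.[x i] = h.[x i]) -> g = h.
Proof.
move=> sg sh gh; apply/eqP; rewrite -subr_eq0; apply/eqP.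
apply: (@roots_geq_poly_eq0 _ _ (map x (enum I))).
- by apply/allP => _ /mapP[i _ ->]; rewrite rootE !hornerE gh subrr.
- by rewrite map_inj_uniq // enum_uniq.
- rewrite size_map -cardE (leq_trans (size_polyD _ _)) // geq_max sg.
  by rewrite size_polyN.
Qed.

(** The divided difference of a polynomial at [k] nodes is its coefficient of
degree [k - 1]. *)
Lemma lagrange_lead (g : {poly F}) : (size g <= #|I|)%N ->
  \sum_i g.[x i] * lweight i = g`_(#|I|.-1).
Proof.
move=> sg.
have -> : g = \sum_i (g.[x i] * lweight i) *: lbasis i.
  apply: poly_eq_nodes => //.
    apply: (leq_trans (size_sum _ _ _)); apply/bigmax_leqP => i _.
    by rewrite (leq_trans (size_scale_leq _ _)) ?size_lbasis.
  move=> j; rewrite horner_sum (bigD1 j) //= big1 => [|i ij].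
    by rewrite hornerZ mulrAC -mulrA horner_lbasis eqxx mulr1 addr0.
  by rewrite hornerZ mulrAC -mulrA horner_lbasis (negbTE ij) mulr0.
set h := (X in X`_ _); rewrite /h coef_sum; apply: eq_bigr => i _.
have := lbasis_monic i; rewrite monicE /lead_coef size_lbasis coefZ => /eqP->.
rewrite mulr1; congr (_ * _).
rewrite horner_sum (bigD1 i) //= big1 => [|k ki].
  by rewrite hornerZ mulrAC -mulrA horner_lbasis eqxx mulr1 addr0.
by rewrite hornerZ mulrAC -mulrA horner_lbasis (negbTE ki) mulr0.
Qed.

End Lagrange.

(** * Relative error in the variable t = z^(1/p) *)

Section RootApprox.
Context {R : realType}.
Implicit Types (P Q : {poly R}) (r : @ratfun R) (a e t : R).

(** [P / Q] approximates [z^(1/p)] on [[a ^+ p, 1]] with relative error at most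
[e].  The inequality is written in [t = z^(1/p)] and multiplied out, which makes
it meaningful for pairs that are not in lowest terms, or whose denominator has
zeros. *)
Definition within (p : nat) a e P Q := forall t, a <= t <= 1 ->
  `|P.[t ^+ p] - t * Q.[t ^+ p]| <= e * (t * `|Q.[t ^+ p]|).

Lemma proot_exp p t : (0 < p)%N -> 0 <= t -> @proot R p (t ^+ p) = t.
Proof.
move=> p0 t0; rewrite /proot -powR_mulrn // -powRrM divff ?powRr1 //.
by rewrite pnatr_eq0 -lt0n.
Qed.

Lemma exp_proot p z : (0 < p)%N -> 0 <= z -> @proot R p z ^+ p = z.
Proof.
move=> p0 z0; rewrite /proot -powR_mulrn ?powR_ge0 // -powRrM mulVf ?powRr1 //.
by rewrite pnatr_eq0 -lt0n.
Qed.

(** The interval of approximation in the variable [z]. *)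
Definition zitv (p : nat) a : set R := `[a ^+ p, 1]%classic.

Lemma image_itv_exp p a : (0 < p)%N -> 0 < a ->
  zitv p a = [set t ^+ p | t in (`[a, 1]%classic : set R)].
Proof.
move=> p0 a0; apply/seteqP; split => [z|_ [t + <-]];
  rewrite /zitv /= !in_itv /=.
  move=> /andP[az z1]; have z0 : 0 <= z by rewrite (le_trans _ az) // exprn_ge0 ?ltW.
  exists (proot p z); last exact: exp_proot.
  have r0 : 0 <= proot p z by rewrite powR_ge0.
  rewrite in_itv /= -(ler_pXn2r p0) ?nnegrE ?(ltW a0) //.
  rewrite -[X in _ && X](ler_pXn2r p0) ?nnegrE ?ler01 // expr1n exp_proot //.
  by rewrite az.
move=> /andP[at1 t1]; have t0 := le_trans (ltW a0) at1.
by rewrite exprn_ile1 // andbT ler_pXn2r ?nnegrE // ltW.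
Qed.

Lemma max_rel_errP p a e r : (0 < p)%N -> 0 < a ->
  (max_rel_err r (proot p) (zitv p a) <= e%:E)%E <->
  (forall t, a <= t <= 1 -> r.2.[t ^+ p] != 0) /\ within p a e r.1 r.2.
Proof.
move=> p0 a0; rewrite /max_rel_err image_itv_exp //.
have key t : a <= t <= 1 -> r.2.[t ^+ p] != 0 ->
    (`|rel_err r (proot p) (t ^+ p)| <= e) =
    (`|r.1.[t ^+ p] - t * r.2.[t ^+ p]| <= e * (t * `|r.2.[t ^+ p]|)).
  move=> /andP[at1 t1] q0; have t0 : 0 < t by apply: lt_le_trans at1.
  rewrite /rel_err proot_exp ?(ltW t0) // /rat_eval.
  have -> : (r.1.[t ^+ p] / r.2.[t ^+ p] - t) / t =
     (r.1.[t ^+ p] - t * r.2.[t ^+ p]) / (t * r.2.[t ^+ p]).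
    by field; rewrite q0 gt_eqF.
  have tq : 0 < t * `|r.2.[t ^+ p]| by rewrite mulr_gt0 ?normr_gt0.
  by rewrite normrM normfV normrM (gtr0_norm t0) ler_pdivrMr.
split.
  move/ereal_supP => H.
  have H' t : a <= t <= 1 -> r.2.[t ^+ p] != 0 /\ `|rel_err r (proot p) (t ^+ p)| <= e.
    move=> t1; have /H : [set (if root r.2 z then +oo%E else `|rel_err r (proot p) z|%:E)
       | z in [set t ^+ p | t in (`[a, 1]%classic : set R)]] (if root r.2 (t ^+ p) then +oo%E
         else `|rel_err r (proot p) (t ^+ p)|%:E).
      by exists (t ^+ p) => //; exists t => //=; rewrite in_itv.
    by rewrite rootE; case: ifPn => // q0; rewrite lee_fin.
  split=> t t1; have [q0 qe] := H' _ t1; first exact: q0.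
  by rewrite -key.
move=> [Q0 W]; apply/ereal_supP => _ [_ [t + <-] <-].
rewrite /= in_itv /= => t1; rewrite rootE (negbTE (Q0 _ t1)) lee_fin key ?Q0 //.
exact: W.
Qed.

Lemma poly_itv_eq0 (g : {poly R}) (u v : R) : u < v ->
  (forall t, u < t < v -> g.[t] = 0) -> g = 0.
Proof.
move=> uv g0; set n := size g.
pose x (i : 'I_n) : R := u + (v - u) * (i.+1%:R / n.+1%:R).
have n0 : 0 < n.+1%:R :> R by rewrite ltr0n.
apply: (@poly_eq_nodes _ _ x) => [i j|||i]; rewrite ?card_ord ?size_poly0 //.
  have uv0 : v - u != 0 by rewrite subr_eq0 gt_eqF.
  have ni0 : (n.+1%:R : R)^-1 != 0 by rewrite invr_eq0 gt_eqF.
  move/addrI/(mulfI uv0)/(mulIf ni0)/eqP; rewrite eqr_nat eqSS => /eqP.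
  exact: val_inj.
rewrite horner0 g0 // /x ltrDl mulr_gt0 ?subr_gt0 ?divr_gt0 ?ltr0n //=.
rewrite -ltrBrDl gtr_pMr ?subr_gt0 // ltr_pdivrMr // mul1r ltr_nat ltnS.
exact: ltn_ord.
Qed.

(** An inequality between polynomials extends by continuity to the zeros of a
third polynomial. *)
Lemma poly_le_dense (g h : {poly R}) (a e : R) (G : {poly R}) : G != 0 -> a < 1 ->
  (forall t, a <= t <= 1 -> G.[t] != 0 -> `|g.[t]| <= e * `|h.[t]|) ->
  forall t, a <= t <= 1 -> `|g.[t]| <= e * `|h.[t]|.
Proof.
move=> G0 a1 H t /andP[at_ t1]; apply: contrapT => /negP; rewrite -ltNge => lt.
pose f x := `|g.[x]| - e * `|h.[x]|.
have fc : {for t, continuous f}.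
  apply: cvgB.
    by apply: (@cvg_comp _ _ _ _ _ _ (nbhs g.[t]));
      [exact: continuous_horner | exact: norm_continuous].
  apply: cvgM; first exact: cvg_cst.
  by apply: (@cvg_comp _ _ _ _ _ _ (nbhs h.[t]));
      [exact: continuous_horner | exact: norm_continuous].
have f0 : 0 < f t by rewrite subr_gt0.
have /nbhs_ballP[d /= d0 dP] : \forall x \near t, 0 < f x.
  exact: (fc _ (lt_nbhsr f0)).
suff [u [v [uv H1]]] : exists u v, u < v /\ forall x, u < x < v -> a <= x <= 1 /\ `|t - x| < d.
  move/eqP: G0; apply; apply: (poly_itv_eq0 uv) => x /H1[x1 xd].
  apply/eqP; apply: contraT => Gx; have := dP _ xd; rewrite /= /f subr_gt0.
  by rewrite ltNge H.
have [tl|tl] := ltP t 1.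
  exists t, (Num.min 1 (t + d)); split; first by rewrite lt_min tl ltrDl.
  move=> x /andP[tx]; rewrite lt_min => /andP[x1 xd].
  rewrite (le_trans at_ (ltW tx)) (ltW x1); split=> //.
  by rewrite distrC gtr0_norm ?subr_gt0 // ltrBlDl.
have te : t = 1 by apply/eqP; rewrite eq_le t1.
exists (Num.max a (t - d)), t; split; first by rewrite gt_max te a1 gtrBl d0.
move=> x /andP[]; rewrite gt_max => /andP[ax xd] xt.
rewrite (ltW ax) (ltW (lt_le_trans xt t1)); split=> //.
by rewrite gtr0_norm ?subr_gt0 // ltrBlDr -ltrBlDl.
Qed.

Lemma horner_comp_exp P p t : (P \Po 'X^p).[t] = P.[t ^+ p].
Proof. by rewrite horner_comp hornerXn. Qed.

(** Cancelling common factors turns a pair within the error [e] into a rational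
function without poles on the interval, and with the same error: a pole would be
a common zero of numerator and denominator. *)
Lemma within_rat_type m l p a e P Q : (0 < p)%N -> 0 < a < 1 ->
  (size P <= m.+1)%N -> (size Q <= l.+1)%N -> Q != 0 -> within p a e P Q ->
  exists2 r, rat_type m l r & (max_rel_err r (proot p) (zitv p a) <= e%:E)%E.
Proof.
move=> p0 /andP[a0 a1] sP sQ Q0 W.
set G := gcdp P Q; have G0 : G != 0 by rewrite gcdp_eq0 negb_and Q0 orbT.
set P1 := P %/ G; set Q1 := Q %/ G.
have PE : P = P1 * G by rewrite divpK ?dvdp_gcdl.
have QE : Q = Q1 * G by rewrite divpK ?dvdp_gcdr.
have Q10 : Q1 != 0 by apply: contraNneq Q0 => Q10; rewrite QE Q10 mul0r.
have cop : coprimep P1 Q1 by rewrite coprimep_div_gcd // Q0 orbT.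
have sdiv (q : {poly R}) : (size (q %/ G)%R <= size q)%N by rewrite size_divp // leq_subr.
set c := (lead_coef Q1)^-1; have c0 : c != 0 by rewrite invr_eq0 lead_coef_eq0.
have W1 : within p a e P1 Q1.
  pose g := (P1 \Po 'X^p) - 'X * (Q1 \Po 'X^p); pose h := 'X * (Q1 \Po 'X^p).
  have Gp0 : G \Po 'X^p != 0.
    by rewrite comp_poly_eq0 // size_polyXn ltnS.
  have gh : forall s, a <= s <= 1 -> `|g.[s]| <= e * `|h.[s]|.
    apply: (poly_le_dense Gp0 a1) => s /andP[as1 s1].
    have s0 : 0 < s by exact: lt_le_trans as1.
    rewrite /g /h !hornerE !horner_comp_exp => Gs.
    have := W s; rewrite as1 s1 => /(_ isT); rewrite PE QE !hornerM.
    rewrite [s * (_ * _)]mulrA -mulrBl !normrM !mulrA ler_pM2r ?normr_gt0 //.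
    by rewrite (gtr0_norm s0).
  move=> t t1; have t0 : 0 < t by case/andP: t1 => + _; exact: lt_le_trans.
  have := gh _ t1; rewrite /g /h hornerD hornerN !hornerM !hornerX.
  by rewrite !horner_comp_exp [`|t * _|]normrM (gtr0_norm t0).
exists (c *: P1, c *: Q1).
  split => /=.
  - by rewrite (leq_trans (size_scale_leq _ _)) // (leq_trans (sdiv _)).
  - by rewrite (leq_trans (size_scale_leq _ _)) // (leq_trans (sdiv _)).
  - by rewrite coprimepZl // coprimepZr.
  - by rewrite monicE lead_coefZ mulVf // lead_coef_eq0.
apply/max_rel_errP => //; split=> [t t1 | t t1] /=; last first.
  rewrite !hornerZ mulrCA -mulrBr normrM [`|c * _|]normrM.
  by rewrite [t * _]mulrCA [e * _]mulrCA ler_wpM2l // W1.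
rewrite hornerZ mulf_neq0 //; apply/eqP => Q1t.
have := W1 _ t1; rewrite Q1t normr0 !mulr0 subr0 normr_le0 => P1t.
by have := coprimep_root cop P1t; rewrite Q1t eqxx.
Qed.
End RootApprox.

(** * Existence of best approximants *)

Section Existence.
Context {R : realType}.
Implicit Types (P Q : {poly R}) (r : @ratfun R) (a e t : R).

(** Numerator and denominator read off a vector of [m + 1 + (l + 1)] coefficients. *)
Definition vnum m l (c : 'rV[R]_(m.+1 + l.+1)) : {poly R} := rVpoly (lsubmx c).
Definition vden m l (c : 'rV[R]_(m.+1 + l.+1)) : {poly R} := rVpoly (rsubmx c).

Lemma continuousMr (T : topologicalType) (f g : T -> R) :
  continuous f -> continuous g -> continuous (fun x => f x * g x).
Proof. by move=> fc gc x; apply: cvgM; [exact: fc | exact: gc]. Qed.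

Lemma continuousBr (T : topologicalType) (f g : T -> R) :
  continuous f -> continuous g -> continuous (fun x => f x - g x).
Proof. by move=> fc gc x; apply: cvgB; [exact: fc | exact: gc]. Qed.

Lemma continuous_normr (T : topologicalType) (f : T -> R) :
  continuous f -> continuous (fun x => `|f x|).
Proof.
move=> fc x; apply: (@cvg_comp _ _ _ _ _ _ (nbhs (f x))); first exact: fc.
exact: norm_continuous.
Qed.

Lemma continuous_sumr (T : topologicalType) (I : finType) (F : I -> T -> R) :
  (forall i, continuous (F i)) -> continuous (fun x => \sum_i F i x).
Proof.
move=> Fc; apply: (@continuous_big R I +%R 0 predT _ T) => //.
exact: add_continuous.
Qed.

Lemma continuous_vnum m l (x : R) : continuous (fun c => (@vnum m l c).[x]).
Proof.
rewrite (_ : (fun _ => _) = fun c : 'rV[R]_(m.+1 + l.+1) =>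
    \sum_(i < m.+1) c 0 (lshift _ i) * x ^+ i).
  apply: continuous_sumr => i; apply: continuousMr; last exact: cst_continuous.
  exact: coord_continuous.
apply/funext => c; rewrite (@horner_coef_wide _ m.+1) ?size_poly //.
by apply: eq_bigr => i _; rewrite coef_rVpoly_ord mxE.
Qed.

Lemma continuous_vden m l (x : R) : continuous (fun c => (@vden m l c).[x]).
Proof.
rewrite (_ : (fun _ => _) = fun c : 'rV[R]_(m.+1 + l.+1) =>
    \sum_(i < l.+1) c 0 (rshift _ i) * x ^+ i).
  apply: continuous_sumr => i; apply: continuousMr; last exact: cst_continuous.
  exact: coord_continuous.
apply/funext => c; rewrite (@horner_coef_wide _ l.+1) ?size_poly //.
by apply: eq_bigr => i _; rewrite coef_rVpoly_ord mxE.
Qed.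

Lemma closed_within m l p a e :
  closed [set c | within p a e (@vnum m l c) (vden c)].
Proof.
rewrite (_ : [set _ | _] = \bigcap_(t in [set t | a <= t <= 1])
   ((fun c : 'rV[R]_(m.+1 + l.+1) =>
     e * (t * `|(vden c).[t ^+ p]|) - `|(vnum c).[t ^+ p] - t * (vden c).[t ^+ p]|)
     @^-1` [set x | 0 <= x])); last first.
  by apply/seteqP; split => c H t t1 /=; have := H _ t1; rewrite /= subr_ge0.
apply: closed_bigI => t t1; apply: preimage_closed; last exact: closed_ge.
move=> + _; apply: continuousBr.
  do 2 (apply: continuousMr; first exact: cst_continuous).
  exact/continuous_normr/continuous_vden.
apply: continuous_normr; apply: continuousBr; first exact: continuous_vnum.
apply: continuousMr; first exact: cst_continuous.
exact: continuous_vden.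
Qed.

Lemma within_scale p a e P Q (k : R) : within p a e P Q -> within p a e (k *: P) (k *: Q).
Proof.
move=> W t t1; rewrite !hornerZ mulrCA -mulrBr normrM [`|k * _|]normrM.
by rewrite [t * _]mulrCA [e * _]mulrCA ler_wpM2l // W.
Qed.

Lemma compact_sphere n : compact [set c : 'rV[R]_n | `|c| = 1].
Proof.
apply: bounded_closed_compact.
  by exists 1; split=> // x x1 c /= ->; exact: ltW.
rewrite (_ : [set _ | _] = (fun c : 'rV[R]_n => `|c|) @^-1` [set x | x = 1]); last by [].
by apply: preimage_closed; [move=> ? _; exact: norm_continuous | exact: closed_eq].
Qed.

(** The infimum of the achievable errors is attained: coefficient vectors of norm 1
with errors decreasing to [E] have a cluster point, and being within a given
error is a closed condition. *)
Lemma within_inf_attained m l p a (E : R) : (0 < p)%N -> 0 < a < 1 ->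
  (forall e, E < e -> exists P Q, [/\ (size P <= m.+1)%N, (size Q <= l.+1)%N,
      Q != 0 & within p a e P Q]) ->
  exists P Q, [/\ (size P <= m.+1)%N, (size Q <= l.+1)%N, Q != 0 & within p a E P Q].
Proof.
move=> p0 /andP[a0 a1] H.
have Hn (n : nat) : exists c : 'rV[R]_(m.+1 + l.+1),
    `|c| = 1 /\ within p a (E + n.+1%:R^-1) (vnum c) (vden c).
  have [|P [Q [sP sQ Q0 W]]] := H (E + n.+1%:R^-1).
    by rewrite ltrDl invr_gt0 ltr0n.
  pose c : 'rV[R]_(m.+1 + l.+1) := row_mx (poly_rV P) (poly_rV Q).
  have Pc : vnum c = P by rewrite /vnum row_mxKl poly_rV_K.
  have Qc : vden c = Q by rewrite /vden row_mxKr poly_rV_K.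
  have c0 : c != 0.
    by apply: contraNneq Q0 => c0; rewrite -Qc c0 /vden linear0 raddf0.
  exists (`|c|^-1 *: c); split.
    by rewrite normrZ ger0_norm ?invr_ge0 // mulVf // normr_eq0.
  by rewrite /vnum /vden !linearZ /=; apply: within_scale; rewrite -/(vnum _) -/(vden _) Pc Qc.
have [c Hc] := choice Hn.
have Fc : (c @ \oo) [set c : 'rV[R]_(m.+1 + l.+1) | `|c| = 1].
  by exists 0%N => // n _; exact: (Hc n).1.
have [c1 [Sc1 cl]] := @compact_sphere (m.+1 + l.+1) (c @ \oo) _ Fc.
have W1 e : E < e -> within p a e (vnum c1) (vden c1).
  move=> Ee; suff : closure [set c | within p a e (@vnum m l c) (vden c)] c1.
    by rewrite -(closure_id _).1; [| exact: closed_within].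
  move=> B /cl; apply.
  have [N _ HN] : \forall n \near \oo, n.+1%:R^-1 < e - E.
    have eE : 0 < e - E by rewrite subr_gt0.
  exact: (near_infty_natSinv_lt (PosNum eE)).
  exists N => // n /HN /ltW; rewrite lerBrDl => En t t1.
  apply: (le_trans ((Hc n).2 _ t1)); apply: ler_wpM2r => //.
  by rewrite mulr_ge0 // (le_trans (ltW a0)) //; case/andP: t1.
have W : within p a E (vnum c1) (vden c1).
  move=> t t1; have t0 : 0 <= t by rewrite (le_trans (ltW a0)) //; case/andP: t1.
  set x := t * `|_|; have x0 : 0 <= x by rewrite mulr_ge0.
  apply/ler_addgt0Pr => e e0.
  have := W1 (E + e / (x + 1)); rewrite ltrDl divr_gt0 ?ltr_wpDl // => /(_ isT _ t1).
  rewrite -/x mulrDl => /le_trans; apply; rewrite lerD2l mulrAC -mulrA ger_pMr //.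
  by rewrite ler_pdivrMr ?ltr_wpDl // mul1r lerDl.
exists (vnum c1), (vden c1); rewrite !size_poly; split => //.
(* A zero limit denominator would force a zero limit numerator, hence a zero
   vector on the unit sphere. *)
apply: contra_eq_neq Sc1 => Qc1.
have : vnum c1 = 0.
  have : vnum c1 \Po 'X^p = 0.
    apply: (poly_itv_eq0 a1) => t /andP[/ltW at_ /ltW t1].
    have := W t; rewrite at_ t1 Qc1 horner0 normr0 !mulr0 subr0 => /(_ isT).
    by rewrite normr_le0 horner_comp_exp => /eqP.
  by move/eqP; rewrite comp_poly_eq0 ?size_polyXn // => /eqP.
move=> Pc1; have -> : c1 = 0.
  rewrite -[c1]hsubmxK -[lsubmx c1]rVpolyK -[rsubmx c1]rVpolyK.
  by rewrite -/(vnum _) -/(vden _) Pc1 Qc1 !linear0 row_mx0.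
by rewrite normr0 eq_sym oner_neq0.
Qed.
End Existence.

(** * The best error *)

Section BestError.
Context {R : realType}.
Implicit Types (P Q : {poly R}) (r : @ratfun R) (a e t : R).
Variables (m l p : nat) (a : R).
Hypotheses (p0 : (0 < p)%N) (a01 : 0 < a < 1).

Let a0 : 0 < a. Proof. by case/andP: a01. Qed.
Let a1 : a < 1. Proof. by case/andP: a01. Qed.

Local Notation E := (best_err m l (proot p) (zitv p a)).
Local Notation V := [set max_rel_err r (proot p) (zitv p a) | r in rat_type m l].

(** The constant [2 a / (1 + a)], the harmonic mean of [a] and [1], has the relative
errors [(1 - a) / (1 + a)] and its opposite at the two endpoints. *)
Lemma within_const : within p a ((1 - a) / (1 + a)) (2 * a / (1 + a))%:P 1.
Proof.
move=> t /andP[at_ t1]; rewrite !hornerC normr1 !mulr1.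
have a10 : 0 < 1 + a by rewrite addr_gt0.
have -> : 2 * a / (1 + a) - t = (2 * a - t * (1 + a)) / (1 + a).
  by field; rewrite gt_eqF.
rewrite normrM normfV (gtr0_norm a10) mulrAC ler_wpM2r ?invr_ge0 ?(ltW a10) //.
have at0 : 0 <= a * (1 - t) by rewrite mulr_ge0 ?subr_ge0 ?(ltW a0).
by rewrite ler_norml; apply/andP; split; lra.
Qed.

Lemma best_err_ereal : ereal_inf V = E%:E.
Proof.
rewrite /best_err fineK // fin_numElt; apply/andP; split.
  apply: (@lt_le_trans _ _ 0%E); first exact: ltNyr.
  apply: le_ereal_inf_tmp => _ [r _ <-]; apply: le_ereal_sup_tmp.
  exists (if root r.2 1 then +oo%E else `|rel_err r (proot p) 1|%:E).
    by exists 1 => //; rewrite /zitv /= in_itv /= lexx exprn_ile1 // ltW.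
  by case: ifP => // _; rewrite lee_fin.
have sP : (size (2 * a / (1 + a))%:P <= m.+1)%N.
  exact: leq_trans (size_polyC_leq1 _) _.
have sQ : (size (1%R : {poly R}) <= l.+1)%N by rewrite size_poly1.
have [r rt re] := within_rat_type p0 a01 sP sQ (oner_neq0 _) within_const.
apply: (@le_lt_trans _ _ ((1 - a) / (1 + a))%:E); last exact: ltry.
by apply: ge_ereal_inf; exists (max_rel_err r (proot p) (zitv p a)) => //; exists r.
Qed.

Lemma best_err_ge0 : 0 <= E.
Proof.
rewrite -lee_fin -best_err_ereal.
apply: le_ereal_inf_tmp => _ [r _ <-]; apply: le_ereal_sup_tmp.
exists (if root r.2 1 then +oo%E else `|rel_err r (proot p) 1|%:E).
  by exists 1 => //; rewrite /zitv /= in_itv /= lexx exprn_ile1 // ltW.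
by case: ifP => _; rewrite ?leey ?lee_fin.
Qed.

Lemma best_err_le e P Q : (size P <= m.+1)%N -> (size Q <= l.+1)%N -> Q != 0 ->
  within p a e P Q -> E <= e.
Proof.
move=> sP sQ Q0 W; have [r rt re] := within_rat_type p0 a01 sP sQ Q0 W.
rewrite -lee_fin -best_err_ereal.
by apply: ge_ereal_inf; exists (max_rel_err r (proot p) (zitv p a)) => //; exists r.
Qed.

Lemma best_err_le_const : E <= (1 - a) / (1 + a).
Proof.
apply: (best_err_le _ _ _ within_const); rewrite ?size_poly1 ?oner_neq0 //.
exact: leq_trans (size_polyC_leq1 _) _.
Qed.

Lemma best_err_lt1 : E < 1.
Proof.
apply: (le_lt_trans best_err_le_const).
by rewrite ltr_pdivrMr ?addr_gt0 // mul1r ltrD2l gtrN.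
Qed.

Lemma best_approx_exists : exists r, is_best_approx m l (proot p) (zitv p a) r.
Proof.
have [e Ee|P [Q [sP sQ Q0 W]]] := @within_inf_attained _ m l p a E p0 a01.
  have : (ereal_inf V < e%:E)%E by rewrite best_err_ereal lte_fin.
  move=> /ereal_inf_ltP[_ [r rt <-] /ltW/(max_rel_errP _ _ p0 a0)[_ W]].
  case: rt => s1 s2 _ mon; exists r.1, r.2; split=> //.
  exact: monic_neq0.
have [r rt re] := within_rat_type p0 a01 sP sQ Q0 W.
exists r; split=> // s st; apply: (le_trans re); rewrite -best_err_ereal.
by apply: ge_ereal_inf; exists (max_rel_err s (proot p) (zitv p a)) => //; exists s.
Qed.

Lemma best_approxP r : is_best_approx m l (proot p) (zitv p a) r ->
  [/\ rat_type m l r, forall t, a <= t <= 1 -> r.2.[t ^+ p] != 0 &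
      within p a E r.1 r.2].
Proof.
move=> [rt best]; suff /(max_rel_errP _ _ p0 a0)[q0 W] :
  (max_rel_err r (proot p) (zitv p a) <= E%:E)%E by [].
by rewrite -best_err_ereal; apply: le_ereal_inf_tmp => _ [s st <-]; exact: best.
Qed.

End BestError.

(** * Perturbation of nonnegative polynomials *)

Section Perturbation.
Context {R : realType}.
Implicit Types (f g h P Q W : {poly R}) (a e t x y : R).

Lemma poly_bound g a : exists2 M, 0 < M & forall t, a <= t <= 1 -> `|g.[t]| <= M.
Proof.
have [ub ubP] := @poly_itv_bound _ g a 1; exists (1 + `|ub|).
  by rewrite ltr_pwDl.
move=> t t1; have ti : t \in `[a, 1] by rewrite in_itv.
apply: (le_trans (ubP t ti)).
by rewrite (le_trans (ler_norm _)) // lerDr.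
Qed.

Lemma cont_pos_min (f : R -> R) a : a < 1 -> continuous f ->
  (forall t, a <= t <= 1 -> 0 < f t) ->
  exists2 mu, 0 < mu & forall t, a <= t <= 1 -> mu <= f t.
Proof.
move=> a1 fc f0; have [|c c1 cmin] := @EVT_min R f a 1 (ltW a1).
  exact: continuous_subspaceT.
exists (f c); first by apply: f0; move: c1; rewrite in_itv.
by move=> t t1; apply: cmin; rewrite in_itv.
Qed.

(** If [h] is positive at the zeros of a nonnegative [g], then [g + x h] is positive
on the whole interval for small [x > 0]. *)
Lemma poly_perturb_gt0 g h a : a < 1 -> (forall t, a <= t <= 1 -> 0 <= g.[t]) ->
  (forall t, a <= t <= 1 -> g.[t] = 0 -> 0 < h.[t]) ->
  exists2 x0, 0 < x0 & forall x, 0 < x <= x0 -> forall t, a <= t <= 1 ->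
    0 < (g + x *: h).[t].
Proof.
move=> a1 g0 h0.
pose f t := Num.max g.[t] h.[t].
have fc : continuous f.
  move=> t; apply: (@continuous_max _ _ (horner g) (horner h));
  exact: continuous_horner.
have f0 t : a <= t <= 1 -> 0 < f t.
  move=> t1; have := g0 _ t1; rewrite /f lt_max le_eqVlt => /orP[/eqP/esym gt|->//].
  by rewrite h0 ?orbT.
have [mu mu0 muP] := cont_pos_min a1 fc f0.
have [M M0 MP] := poly_bound h a.
exists (mu / (2 * M)); first by rewrite divr_gt0 // mulr_gt0.
move=> x /andP[x0 xM] t t1; rewrite hornerD hornerZ.
have [hp|hn] := ltP 0 h.[t]; first by rewrite ltr_wpDl ?g0 // mulr_gt0.
have gmu : mu <= g.[t].
  by have := muP _ t1; rewrite /f le_max => /orP[//|/le_trans/(_ hn)]; rewrite leNgt mu0.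
have : `|h.[t]| <= M by exact: MP.
rewrite ler0_norm // => hM.
have xM2 : x * M <= mu / 2.
  move: xM; rewrite invfM mulrA ler_pdivlMr //.
nra.
Qed.

(** A Bezout relation with control of the degrees. *)
Lemma coprime_repr P Q W l : coprimep P Q -> P != 0 -> (size Q <= l.+1)%N ->
  (size W <= size P + l)%N ->
  exists A B : {poly R}, [/\ W = P * A + Q * B, (size A <= l.+1)%N & (size B < size P)%N].
Proof.
move=> /Bezout_coprimepP[[u v] /= uv] P0 sQ sW.
have [c c0 ec] : exists2 c : R, c != 0 & u * P + v * Q = c%:P.
  move: uv; rewrite -size_poly_eq1 => /size_poly1P[c c0 ->]; by exists c.
pose B := (c^-1 *: (W * v)) %% P.
have sB : (size B < size P)%N by rewrite ltn_modp.
have dP : P %| W - Q * B.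
  have -> : W - Q * B = (c^-1 *: (W * u)) * P + Q * ((c^-1 *: (W * v)) %/ P) * P.
    have E : c^-1 *: (W * v) = (c^-1 *: (W * v)) %/ P * P + B by exact: divp_eq.
    have E2 : W = c^-1 *: (W * u) * P + Q * (c^-1 *: (W * v)).
      rewrite -!mul_polyC.
      rewrite (_ : _ + _ = (c^-1)%:P * W * (u * P + v * Q)); last by ring.
      by rewrite ec mulrAC -polyCM mulVf // mul1r.
    have alg (w u' p' q' v' q b : {poly R}) : w = u' * p' + q' * v' ->
        v' = q * p' + b -> w - q' * b = u' * p' + q' * q * p'.
      by move=> -> ->; ring.
    exact: alg E2 E.
  by rewrite dvdp_add ?dvdp_mull ?dvdpp.
exists ((W - Q * B) %/ P), B; split=> //.
  by rewrite mulrC divpK // subrK.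
have sWB : (size (W - Q * B)%R <= size P + l)%N.
  rewrite (leq_trans (size_polyD _ _)) // size_polyN geq_max sW /=.
  have arith (q b k : nat) : (q <= l.+1)%N -> (b < k)%N -> ((q + b).-1 <= k + l)%N.
    by lia.
  by apply: (leq_trans (size_polyMleq _ _)); exact: arith.
have arith (w k : nat) : (w <= k + l)%N -> (0 < k)%N -> (w - k.-1 <= l.+1)%N by lia.
by rewrite size_divp //; apply: arith; rewrite ?size_poly_gt0.
Qed.

End Perturbation.

(** * Extremal points of a best approximant *)

(** [P / Q] is a best approximant in lowest terms, [E] is its error, and [Q] is
positive on the interval.  In the variable [t], [Pt] and [Qt] stand for [P(t^p)]
and [t Q(t^p)]; [U] and [L] are the nonnegative polynomials whose zeros are the
points where the relative error [Pt / Qt - 1] equals [E] and [- E]; [Wr] is the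
numerator of the derivative of [Pt / Qt]. *)
Section Extremal.
Context {R : realType}.
Implicit Types (f g h W : {poly R}) (a e t x y : R).
Variables (m l p : nat) (a E : R) (P Q : {poly R}).
Hypotheses (p2 : (1 < p)%N) (a01 : 0 < a < 1).
Hypotheses (sP : (size P <= m.+1)%N) (sQ : (size Q <= l.+1)%N)
  (cop : coprimep P Q) (E01 : 0 <= E < 1)
  (Qpos : forall t, a <= t <= 1 -> 0 < Q.[t ^+ p])
  (PQE : within p a E P Q)
  (Emin : forall (P' Q' : {poly R}) e, (size P' <= m.+1)%N -> (size Q' <= l.+1)%N -> Q' != 0 ->
     within p a e P' Q' -> E <= e).

Let a0 : 0 < a. Proof. by case/andP: a01. Qed.
Let a1 : a < 1. Proof. by case/andP: a01. Qed.
Let p0 : (0 < p)%N. Proof. exact: ltnW. Qed.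

Local Notation Pt := (P \Po 'X^p).
Local Notation Qt := ('X * (Q \Po 'X^p)).
Let U := (1 + E) *: Qt - Pt.
Let L := Pt - (1 - E) *: Qt.
Let Wr := Pt^`() * Qt - Pt * Qt^`().
Let D := P * Q - p%:R *: ('X * (P^`() * Q - P * Q^`())).

Let tpos t : a <= t <= 1 -> 0 < t.
Proof. by case/andP => + _; exact: lt_le_trans. Qed.

Lemma horner_Qt t : Qt.[t] = t * Q.[t ^+ p].
Proof. by rewrite hornerM hornerX horner_comp_exp. Qed.

Lemma Qt_gt0 t : a <= t <= 1 -> 0 < Qt.[t].
Proof. by move=> t1; rewrite horner_Qt mulr_gt0 ?Qpos ?tpos. Qed.

Lemma UL_ge0 t : a <= t <= 1 -> 0 <= U.[t] /\ 0 <= L.[t].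
Proof.
move=> t1; have := PQE t1; rewrite (gtr0_norm (Qpos t1)) ler_norml.
rewrite /U /L !(hornerD, hornerN, hornerZ) horner_Qt horner_comp_exp.
by move=> /andP[]; split; lra.
Qed.

Lemma Pt_gt0 t : a <= t <= 1 -> 0 < Pt.[t].
Proof.
move=> t1; have [_] := UL_ge0 t1; rewrite /L hornerD hornerN hornerZ subr_ge0.
move=> H; apply: lt_le_trans H; rewrite mulr_gt0 ?Qt_gt0 //.
by case/andP: E01; rewrite subr_gt0.
Qed.

Let one1 : a <= (1 : R) <= 1. Proof. by rewrite lexx (ltW a1). Qed.

Lemma P_neq0 : P != 0.
Proof.
apply/eqP => P0; have := Pt_gt0 one1.
by rewrite P0 comp_poly0 horner0 ltxx.
Qed.

Lemma Q_neq0 : Q != 0.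
Proof. by apply/eqP => Q0; have := Qpos one1; rewrite Q0 horner0 ltxx. Qed.

Lemma comp_exp_neq0 f : f != 0 -> f \Po 'X^p != 0.
Proof. by move=> f0; rewrite comp_poly_eq0 // size_polyXn. Qed.

Lemma size_comp_exp f : f != 0 -> size (f \Po 'X^p) = ((size f).-1 * p).+1.
Proof.
move=> f0; rewrite -[LHS]prednK ?size_poly_gt0 ?comp_exp_neq0 //.
by rewrite size_comp_poly size_polyXn.
Qed.

(** The degrees of [Pt] and [Qt] are 0 and 1 modulo [p]. *)
Lemma PQt_not_prop c : Pt <> c *: Qt.
Proof.
have [->|c0] := eqVneq c 0.
  by rewrite scale0r; apply/eqP/comp_exp_neq0/P_neq0.
move=> /(congr1 (fun q : {poly R} => size q)); rewrite size_scale // size_comp_exp ?P_neq0 //.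
rewrite mulrC size_mulX ?comp_exp_neq0 ?Q_neq0 // size_comp_exp ?Q_neq0 // => -[].
move/(congr1 (modn^~ p)); rewrite modnMl -addn1 modnMDl modn_small //.
Qed.

Lemma E_gt0 : 0 < E.
Proof.
case/andP: E01; rewrite le_eqVlt => /orP[/eqP E0 _|//]; exfalso.
apply: (@PQt_not_prop 1); rewrite scale1r; apply/eqP; rewrite -subr_eq0; apply/eqP.
apply: (poly_itv_eq0 a1) => t /andP[/ltW at_ /ltW t1].
have t2 : a <= t <= 1 by rewrite at_.
have [] := UL_ge0 t2; rewrite /U /L -E0 addr0 subr0 !scale1r.
rewrite !(hornerD, hornerN) !subr_ge0 => le1 le2.
by apply/eqP; rewrite subr_eq0 eq_le le1.
Qed.

Lemma UL_neq0 t : a <= t <= 1 -> U.[t] = 0 -> L.[t] = 0 -> False.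
Proof.
move=> t1 u0 l0; have : (U + L).[t] = 0 by rewrite hornerD u0 l0 addr0.
have -> : U + L = (2 * E) *: Qt.
  by rewrite /U /L addrA subrK -scaleNr -scalerDl; congr (_ *: _); ring.
rewrite hornerZ => /eqP; rewrite gt_eqF // mulr_gt0 ?Qt_gt0 //.
by rewrite mulr_gt0 ?E_gt0.
Qed.

(** The derivative vanishes at the [p]-th roots of the zeros of a polynomial [D]
whose degree is at most [deg P + deg Q]. *)
Lemma Wr_comp : Wr = - (D \Po 'X^p).
Proof.
have Xp : 'X * ('X^(p.-1) : {poly R}) = 'X^p by rewrite -exprS prednK.
rewrite /Wr /D derivM derivX !deriv_comp derivXn mul1r.
rewrite !(comp_polyB, comp_polyM, comp_polyZ, comp_polyX).
set P1 := P^`() \Po _; set Q1 := Q^`() \Po _; set P2 := Pt; set Q2 := Q \Po _.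
rewrite -Xp -mul_polyC -[_ *+ p]mulr_natl -(polyC_natr _ p).
ring.
Qed.

Lemma Wr_neq0 : Wr != 0.
Proof.
apply/eqP => W0; apply: (@PQt_not_prop (Pt.[1] / Qt.[1])).
apply/eqP; rewrite -subr_eq0; apply/eqP.
apply: (poly_itv_eq0 a1) => t /andP[at_ t1].
have Qn0 s : t <= s <= 1 -> Qt.[s] != 0.
  by move=> /andP[ts s1]; rewrite gt_eqF // Qt_gt0 // s1 (le_trans (ltW at_) ts).
have [x _] := @rat_MVT R Pt Qt t 1 t1 Qn0.
rewrite -/Wr W0 horner0 !mul0r => /eqP; rewrite subr_eq0 => /eqP ->.
have Qtt : Qt.[t] != 0 by apply: Qn0; rewrite lexx (ltW t1).
by rewrite hornerD hornerN hornerZ divfK // subrr.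
Qed.

Lemma D_neq0 : D != 0.
Proof.
by apply: contraNneq Wr_neq0 => D0; rewrite Wr_comp D0 comp_poly0 oppr0.
Qed.

Lemma size_D : (size D < size P + size Q)%N.
Proof.
have sP0 : (0 < size P)%N by rewrite size_poly_gt0 P_neq0.
have sQ0 : (0 < size Q)%N by rewrite size_poly_gt0 Q_neq0.
have sder f : f != 0 -> (size ('X * f^`())%R <= size f)%N.
  move=> f0; have [->|f'0] := eqVneq f^`() 0; first by rewrite mulr0 size_poly0.
  by rewrite mulrC size_mulX // lt_size_deriv.
have arith (x y : nat) : (0 < x)%N -> (0 < y)%N -> ((x + y).-1 < x + y)%N by lia.
apply: (leq_trans _ (arith _ _ sP0 sQ0)); rewrite ltnS.
have sM f g (b c : nat) : (size f <= b)%N -> (size g <= c)%N ->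
    (size (f * g)%R <= (b + c).-1)%N.
  move=> sf sg; apply: (leq_trans (size_polyMleq _ _)).
  by rewrite -!subn1 leq_sub2r // leq_add.
rewrite (leq_trans (size_polyD _ _)) // geq_max sM // size_polyN.
rewrite (leq_trans (size_scale_leq _ _)) //.
rewrite (_ : 'X * _ = ('X * P^`()) * Q - P * ('X * Q^`())); last by ring.
by rewrite (leq_trans (size_polyD _ _)) // geq_max size_polyN !sM ?sder ?P_neq0 ?Q_neq0.
Qed.

Local Notation z := (roots Wr a 1).

Lemma exp_inj_pos x y : 0 < x -> 0 < y -> x ^+ p = y ^+ p -> x = y.
Proof. by move=> x0 y0 /eqP; rewrite eqrXn2 ?(ltW x0) ?(ltW y0) // => /eqP. Qed.

(** Distinct positive roots of [Wr] have distinct [p]-th powers, which are roots of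
[D]. *)
Lemma Wr_roots_size (s : seq R) : uniq s -> (forall t, t \in s -> 0 < t /\ Wr.[t] = 0) ->
  (size s <= (size P).-1 + (size Q).-1)%N.
Proof.
move=> us Hs.
have := @max_poly_roots _ D (map (fun t => t ^+ p) s) D_neq0.
have -> : all (root D) (map (fun t => t ^+ p) s).
  apply/allP => _ /mapP[t /Hs[t0 W0] ->]; move: W0.
  by rewrite Wr_comp hornerN horner_comp_exp => /eqP; rewrite oppr_eq0.
have -> : uniq (map (fun t => t ^+ p) s).
  rewrite map_inj_in_uniq // => x y /Hs[x0 _] /Hs[y0 _]; exact: exp_inj_pos.
move=> /(_ isT isT); rewrite size_map => sD.
have arith (n d x y : nat) : (0 < x)%N -> (0 < y)%N -> (n < d)%N -> (d < x + y)%N ->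
  (n <= x.-1 + y.-1)%N by lia.
by apply: arith sD size_D; rewrite size_poly_gt0 ?P_neq0 ?Q_neq0.
Qed.

(** The points where the error reaches [E] in absolute value. *)
Definition extremal t := (U.[t] == 0) || (L.[t] == 0).

Lemma nonneg_min_deriv g t : (forall x, a <= x <= 1 -> 0 <= g.[x]) ->
  a < t < 1 -> g.[t] = 0 -> g^`().[t] = 0.
Proof.
move=> g0 /andP[at_ t1] gt.
have dmin : is_derive t 1 (horner g) 0.
  apply: (@derive1_at_min R (horner g) a 1 t (ltW a1)) => [y _||].
  - exact: derivable_horner.
  - by rewrite in_itv /= at_.
  - move=> y; rewrite in_itv /= gt => /andP[/ltW ax /ltW x1].
    by apply: g0; rewrite ax.
by rewrite -(@derive_val _ _ _ _ _ _ _ (is_derive_poly g t)) (@derive_val _ _ _ _ _ _ _ dmin).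
Qed.

Lemma extremal_Wr t : a < t < 1 -> extremal t -> Wr.[t] = 0.
Proof.
move=> t1.
have U0 x : a <= x <= 1 -> 0 <= U.[x] by case/UL_ge0.
have L0 x : a <= x <= 1 -> 0 <= L.[x] by case/UL_ge0.
case/orP => /eqP e0.
  have := nonneg_min_deriv U0 t1 e0.
  move: e0; rewrite /U /Wr !(derivB, derivZ) !(hornerD, hornerN, hornerZ, hornerM).
  move/eqP; rewrite subr_eq0 => /eqP <-; move/eqP; rewrite subr_eq0 => /eqP <-.
  ring.
have := nonneg_min_deriv L0 t1 e0.
move: e0; rewrite /L /Wr !(derivB, derivZ) !(hornerD, hornerN, hornerZ, hornerM).
move/eqP; rewrite subr_eq0 => /eqP ->; move/eqP; rewrite subr_eq0 => /eqP ->.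
ring.
Qed.

(* The candidates for being extremal are the endpoints and the critical points. *)
Let full := a :: rcons z 1.
Let ext := [seq t <- full | extremal t].

Lemma full_sorted : sorted <%R full.
Proof.
rewrite /full /= rcons_path path_roots /=; exact: last_roots_le.
Qed.

Lemma full_itv t : t \in full -> a <= t <= 1.
Proof.
rewrite inE mem_rcons inE => /or3P[/eqP->|/eqP->|/roots_in].
- by rewrite lexx (ltW a1).
- exact: one1.
- by rewrite in_itv /= => /andP[/ltW -> /ltW ->].
Qed.

Lemma extremal_full t : a <= t <= 1 -> extremal t -> t \in ext.
Proof.
move=> /andP[at_ t1] et; rewrite mem_filter et /= inE mem_rcons inE.
have [//|ta] := eqVneq t a; have [//|t1'] := eqVneq t 1.
have tt : a < t < 1 by rewrite !lt_neqAle at_ t1 t1' eq_sym ta.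
rewrite /= root_in_roots ?Wr_neq0 ?in_itv //.
by apply/eqP/extremal_Wr.
Qed.

Lemma ext_uniq : uniq ext.
Proof. by rewrite filter_uniq // lt_sorted_uniq // full_sorted. Qed.

Lemma size_z : (size z <= (size P).-1 + (size Q).-1)%N.
Proof.
apply: Wr_roots_size; first exact: uniq_roots.
move=> t tz; split; last by apply/eqP; exact: (root_roots tz).
by apply: tpos; apply: full_itv; rewrite inE mem_rcons inE tz !orbT.
Qed.

(** Moving [P / Q] in a direction which decreases the error at the positive extremal
points and increases it at the negative ones would improve the approximation. *)
Lemma no_separation (dP dQ : {poly R}) : (size dP <= m.+1)%N -> (size dQ <= l.+1)%N ->
  (forall t, a <= t <= 1 -> U.[t] = 0 -> 0 < (P * dQ - Q * dP).[t ^+ p]) ->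
  (forall t, a <= t <= 1 -> L.[t] = 0 -> (P * dQ - Q * dP).[t ^+ p] < 0) -> False.
Proof.
move=> sdP sdQ WU WL.
pose GU := (1 + E) *: ('X * (dQ \Po 'X^p)) - (dP \Po 'X^p).
pose GL := (dP \Po 'X^p) - (1 - E) *: ('X * (dQ \Po 'X^p)).
have UGU t : a <= t <= 1 -> U.[t] = 0 -> 0 < GU.[t].
  move=> t1 u0; have := WU _ t1 u0; have := Qpos t1.
  move: u0; rewrite /U /GU !(hornerD, hornerN, hornerZ, hornerM, hornerX, horner_comp_exp).
  move/eqP; rewrite subr_eq0 => /eqP <- q0.
  rewrite (_ : _ - _ = Q.[t ^+ p] * ((1 + E) * (t * dQ.[t ^+ p]) - dP.[t ^+ p])).
    by rewrite pmulr_rgt0.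
  by ring.
have LGL t : a <= t <= 1 -> L.[t] = 0 -> 0 < GL.[t].
  move=> t1 u0; have := WL _ t1 u0; have := Qpos t1.
  move: u0; rewrite /L /GL !(hornerD, hornerN, hornerZ, hornerM, hornerX, horner_comp_exp).
  move/eqP; rewrite subr_eq0 => /eqP -> q0.
  rewrite (_ : _ - _ = - (Q.[t ^+ p] * (dP.[t ^+ p] - (1 - E) * (t * dQ.[t ^+ p])))).
    by rewrite oppr_lt0 pmulr_rgt0.
  by ring.
have U0 t : a <= t <= 1 -> 0 <= U.[t] by case/UL_ge0.
have L0 t : a <= t <= 1 -> 0 <= L.[t] by case/UL_ge0.
have [x1 x10 H1] := poly_perturb_gt0 a1 U0 UGU.
have [x2 x20 H2] := poly_perturb_gt0 a1 L0 LGL.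
set x := Num.min x1 x2; have xx : 0 < x by rewrite lt_min x10.
have x1x : 0 < x <= x1 by rewrite xx ge_min lexx.
have x2x : 0 < x <= x2 by rewrite xx ge_min lexx orbT.
have [P' P'E] : exists q, q = P + x *: dP by exists (P + x *: dP).
have [Q' Q'E] : exists q, q = Q + x *: dQ by exists (Q + x *: dQ).
have UE : U + x *: GU = (1 + E) *: ('X * (Q' \Po 'X^p)) - (P' \Po 'X^p).
  rewrite /U /GU P'E Q'E !(comp_polyD, comp_polyZ) -!mul_polyC; ring.
have LE : L + x *: GL = (P' \Po 'X^p) - (1 - E) *: ('X * (Q' \Po 'X^p)).
  rewrite /L /GL P'E Q'E !(comp_polyD, comp_polyZ) -!mul_polyC; ring.
have [mu1 mu10 M1] := cont_pos_min a1 (@continuous_horner R (U + x *: GU)) (H1 _ x1x).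
have [mu2 mu20 M2] := cont_pos_min a1 (@continuous_horner R (L + x *: GL)) (H2 _ x2x).
have [B B0 BP] := poly_bound ('X * (Q' \Po 'X^p)) a.
set mu := Num.min mu1 mu2; have mu0 : 0 < mu by rewrite lt_min mu10.
have mum1 : mu <= mu1 by rewrite ge_min lexx.
have mum2 : mu <= mu2 by rewrite ge_min lexx orbT.
have Q'0 t : a <= t <= 1 -> 0 < t * Q'.[t ^+ p].
  move=> t1; have := M1 _ t1; have := M2 _ t1; rewrite UE LE.
  rewrite !(hornerD, hornerN, hornerZ, hornerM, hornerX, horner_comp_exp).
  have := E_gt0; set q := t * _; nra.
have : E <= E - mu / B.
  apply: (@Emin P' Q').
  - by rewrite P'E (leq_trans (size_polyD _ _)) // geq_max sP (leq_trans (size_scale_leq _ _)).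
  - by rewrite Q'E (leq_trans (size_polyD _ _)) // geq_max sQ (leq_trans (size_scale_leq _ _)).
  - by apply/eqP => Q'z; have := Q'0 _ one1; rewrite Q'z horner0 mulr0 ltxx.
  move=> t t1; have q0 := Q'0 _ t1; have t0 := tpos t1.
  have := M1 _ t1; have := M2 _ t1; have := BP _ t1; rewrite UE LE.
  rewrite !(hornerD, hornerN, hornerZ, hornerM, hornerX, horner_comp_exp).
  have -> : `|Q'.[t ^+ p]| = Q'.[t ^+ p] by rewrite gtr0_norm // -(pmulr_rgt0 _ t0).
  rewrite (gtr0_norm q0); set q := t * _ in q0 *; set P1 := P'.[_] => qB l1 l2.
  have muq : mu / B * q <= mu by rewrite mulrAC ler_pdivrMr // ler_wpM2l // ltW.
  rewrite ler_norml mulrBl; apply/andP; split; lra.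
by rewrite lerDl oppr_ge0 leNgt divr_gt0.
Qed.

Lemma size_ext : (size ext <= (size P).-1 + (size Q).-1 + 2)%N.
Proof.
rewrite size_filter (leq_trans (count_size _ _)) //= size_rcons -addn2 leq_add2r.
exact: size_z.
Qed.

(** A polynomial taking prescribed signs at the extremal points. *)
Lemma separating_poly : exists W : {poly R},
  [/\ (size W <= size ext)%N,
   forall t, a <= t <= 1 -> U.[t] = 0 -> 0 < W.[t ^+ p] &
   forall t, a <= t <= 1 -> L.[t] = 0 -> W.[t ^+ p] < 0].
Proof.
pose x (i : 'I_(size ext)) : R := nth 0 ext i ^+ p.
have x_inj : injective x.
  move=> i j /exp_inj_pos xij; apply/val_inj/eqP.
  have pos (k : 'I_(size ext)) : 0 < nth 0 ext k.
    apply/tpos/full_itv; have := mem_nth 0 (ltn_ord k).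
    by rewrite mem_filter => /andP[].
  have := xij (pos i) (pos j) => /eqP.
  by rewrite nth_uniq // ext_uniq.
have [W sW Wx] := lagrange_exists x_inj (fun i => if U.[nth 0 ext i] == 0 then 1 else -1).
rewrite card_ord in sW; exists W; split=> // t t1 e0.
  have te : t \in ext by apply: extremal_full => //; rewrite /extremal e0 eqxx.
  have ti : (index t ext < size ext)%N by rewrite index_mem.
  by have := Wx (Ordinal ti); rewrite /x /= nth_index // e0 eqxx => ->.
have te : t \in ext by apply: extremal_full => //; rewrite /extremal e0 eqxx orbT.
have ti : (index t ext < size ext)%N by rewrite index_mem.
have := Wx (Ordinal ti); rewrite /x /= nth_index // => ->.
by case: eqP => [u0|_]; [case: (UL_neq0 t1 u0 e0) | rewrite ltrN10].
Qed.

(** There are at least [m + l + 2] extremal points, as otherwise, by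
[coprime_repr], a separating polynomial would be of the form [P dQ - Q dP] with
admissible [dP] and [dQ]; and there are at most [deg P + deg Q + 2] of them.  So
the degrees are full, and the endpoints and all critical points are extremal. *)
Lemma ext_full : [/\ size P = m.+1, size Q = l.+1 & size ext = (m + l + 2)%N].
Proof.
have [W [sW WU WL]] := separating_poly.
have sP0 : (0 < size P)%N by rewrite size_poly_gt0 P_neq0.
have sQ0 : (0 < size Q)%N by rewrite size_poly_gt0 Q_neq0.
have H1 : (size P + l < size ext)%N.
  rewrite ltnNge; apply/negP => le1.
  have [A [B [WE sA sB]]] := coprime_repr cop P_neq0 sQ (leq_trans sW le1).
  apply: (@no_separation (- B) A) => //.
  - by rewrite size_polyN (leq_trans (ltnW sB)).
  - by rewrite mulrN opprK -WE.
  - by rewrite mulrN opprK -WE.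
have H2 : (size Q + m < size ext)%N.
  rewrite ltnNge; apply/negP => le1.
  have cop' : coprimep Q P by rewrite coprimep_sym.
  have [A [B [WE sA sB]]] := coprime_repr cop' Q_neq0 sP (leq_trans sW le1).
  apply: (@no_separation (- A) B) => //.
  - by rewrite size_polyN.
  - by rewrite (leq_trans (ltnW sB)).
  - by rewrite mulrN opprK addrC -WE.
  - by rewrite mulrN opprK addrC -WE.
have arith (x y k : nat) : (0 < x)%N -> (0 < y)%N -> (x <= m.+1)%N -> (y <= l.+1)%N ->
  (x + l < k)%N -> (y + m < k)%N -> (k <= x.-1 + y.-1 + 2)%N ->
  [/\ x = m.+1, y = l.+1 & k = (m + l + 2)%N] by move=> *; split; lia.
exact: arith size_ext.
Qed.

Lemma all_extremal t : t \in full -> extremal t.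
Proof.
have [eP eQ es] := ext_full; have := size_z; rewrite eP eQ /= => sz.
have : all extremal full.
  rewrite all_count -size_filter es eqn_leq /= size_rcons.
  have := count_size extremal full; rewrite -size_filter es /= size_rcons => sf.
  by rewrite sf; move: sz; clear; rewrite -[(size z).+2]addn2 leq_add2r.
by move/allP; apply.
Qed.

Lemma size_roots_Wr : size z = (m + l)%N.
Proof.
have [eP eQ es] := ext_full; have := size_z; rewrite eP eQ /= => sz.
apply/eqP; rewrite eqn_leq sz /=.
have := count_size extremal full; rewrite -size_filter es /= size_rcons.
by rewrite -[(size z).+2]addn2 leq_add2r.
Qed.

Lemma Wr_pos_root t : 0 < t -> Wr.[t] = 0 -> t \in z.
Proof.
move=> t0 W0; apply: contraT => tz.
have [eP eQ _] := ext_full.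
have : (size (t :: z) <= (size P).-1 + (size Q).-1)%N.
  apply: Wr_roots_size => [|x]; first by rewrite /= tz uniq_roots.
  rewrite inE => /predU1P[->//|xz]; split; last by apply/eqP; exact: (root_roots xz).
  by apply/tpos/full_itv; rewrite inE mem_rcons inE xz !orbT.
by rewrite eP eQ /= size_roots_Wr ltnn.
Qed.

Local Notation F := (Pt - Qt).

(** The sign of [F = Pt - Qt] is that of the error. *)
Lemma extremal_F t : a <= t <= 1 -> extremal t ->
  (Pt.[t] / Qt.[t] = 1 + E /\ 0 < F.[t]) \/ (Pt.[t] / Qt.[t] = 1 - E /\ F.[t] < 0).
Proof.
move=> t1; have q0 := Qt_gt0 t1; have E0 := E_gt0.
case/orP; rewrite /U /L !(hornerD, hornerN, hornerZ) subr_eq0 => /eqP; [move/esym|] => ->.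
  left; rewrite mulfK ?gt_eqF //; split=> //.
  by rewrite mulrDl mul1r addrAC subrr add0r mulr_gt0.
right; rewrite mulfK ?gt_eqF //; split=> //.
by rewrite mulrBl mul1r addrAC subrr add0r oppr_lt0 mulr_gt0.
Qed.

(** Between consecutive extremal points there is no critical point, so the values of
the error at them differ; both being [E] or [- E], they are opposite. *)
Lemma alternation : path (fun x y => (x < y) && (F.[x] * F.[y] < 0)) a (rcons z 1).
Proof.
apply/(pathP 0) => i ilt.
set x := nth 0 (a :: rcons z 1) i; set y := nth 0 (rcons z 1) i.
have srt := full_sorted.
have yE : y = nth 0 full i.+1 by [].
have isz : (i.+1 < size full)%N by rewrite /= ltnS.
have xy : x < y.
  rewrite yE /x -/full lt_sorted_ltn_nth ?inE //; first exact: ltnW.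
have xf : x \in full by rewrite mem_nth // ltnW.
have yf : y \in full by rewrite yE mem_nth.
have x1 := full_itv xf; have y1 := full_itv yf.
rewrite xy /=.
have noroot c : x < c < y -> Wr.[c] <> 0.
  move=> /andP[xc cy] Wc; have cz : c \in z.
    apply: Wr_pos_root => //; exact: lt_trans (tpos x1) xc.
  have cf : c \in full by rewrite inE mem_rcons inE cz !orbT.
  move: xc cy; rewrite -(nth_index 0 cf) yE /x -/full !lt_sorted_ltn_nth ?inE ?index_mem //.
    by move=> h1 h2; move: (leq_ltn_trans h1 h2); rewrite ltnn.
  exact: ltnW.
have Qn0 s : x <= s <= y -> Qt.[s] != 0.
  move=> /andP[xs sy]; rewrite gt_eqF // Qt_gt0 //.
  by case/andP: x1 => ax _; case/andP: y1 => _ y1; rewrite (le_trans ax xs) (le_trans sy y1).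
have [c cxy] := @rat_MVT R Pt Qt x y xy Qn0; rewrite -/Wr => Ec.
have rne : Pt.[y] / Qt.[y] != Pt.[x] / Qt.[x].
  rewrite -subr_eq0 Ec !mulf_neq0 ?invr_eq0 ?expf_neq0 //.
  - by apply/eqP; exact: noroot.
  - by case/andP: cxy => xc cy; rewrite Qn0 // !ltW.
  - by rewrite subr_eq0 gt_eqF.
move: rne; have [[-> Fx]|[-> Fx]] := extremal_F x1 (all_extremal xf);
  have [[-> Fy]|[-> Fy]] := extremal_F y1 (all_extremal yf); rewrite ?eqxx // => _.
  by rewrite pmulr_rlt0.
by rewrite nmulr_rlt0.
Qed.

End Extremal.

(** * Zeros of exponential sums *)

Section ExponentialSums.
Context {R : realType}.
Implicit Types (F G : {poly R}) (a b t x y beta : R).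

(** [G] has at least [k] distinct zeros in [[a, b]]. *)
Definition has_roots a b (k : nat) G := exists s : seq R,
  [/\ sorted <%R s, size s = k & forall t, t \in s -> a <= t <= b /\ G.[t] = 0].

(** If a zero of [H] lies strictly between any two zeros of [G] in the interval, then
[H] loses at most one zero. *)
Lemma rolle_roots a b k G H :
  (forall x y, a <= x -> y <= b -> x < y -> G.[x] = 0 -> G.[y] = 0 ->
     exists2 c, x < c < y & H.[c] = 0) ->
  has_roots a b k.+1 G -> has_roots a b k H.
Proof.
move=> rol [[|x s] [ss sk Hs]] //.
pose E x y := [&& x < y, a <= x, y <= b, G.[x] == 0 & G.[y] == 0].
have pE : path E x s.
  apply: (sub_in_path (P := mem (x :: s))) ss; last by apply/allP.
  move=> u v /Hs[/andP[au _] u0] /Hs[/andP[_ vb] v0] uv.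
  by rewrite /E uv au vb u0 v0 eqxx.
have EZ u v : E u v -> exists2 c, u < c < v & H.[c] = 0.
  by case/and5P => uv au vb /eqP u0 /eqP v0; exact: rol.
have [s' [ps ss' Zs ls]] := interlace EZ pE.
exists s'; split; [exact: path_sorted ps | by rewrite ss'; case: sk | ].
move=> t ts; split; last exact: Zs.
have [/andP[ax _] _] := Hs x (mem_head _ _).
have [/andP[_ lb] _] := Hs _ (mem_last x s).
rewrite (ltW (lt_le_trans (ls _ ts) lb)) andbT (le_trans ax) // ltW //.
by move: ps; rewrite lt_path_sortedE => /andP[/allP/(_ _ ts)].
Qed.

Lemma deriv_roots a b k G : has_roots a b k.+1 G -> has_roots a b k G^`().
Proof.
apply: rolle_roots => x y _ _ xy x0 y0.
have [c cxy] := poly_rolle xy (etrans x0 (esym y0)).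
by move=> H; exists c; rewrite // -in_itv.
Qed.

Lemma derivn_roots a b k j G : has_roots a b (j + k) G -> has_roots a b k G^`(j).
Proof.
elim: j k => [|j IH] k //; rewrite addSnnS => /IH.
by rewrite derivnS; exact: deriv_roots.
Qed.

(** The operator [t d/dt - beta], which maps [t ^ n] to [(n - beta) t ^ n] and thus
removes the power [t ^ beta]. *)
Definition theta beta G := 'X * G^`() - beta *: G.

(** Rolle's theorem for [G / t ^ n], whose derivative is
[theta n G / t ^ (n + 1)]. *)
Lemma theta_roots a b k (n : nat) G : 0 < a ->
  has_roots a b k.+1 G -> has_roots a b k (theta n%:R G).
Proof.
move=> a0; apply: rolle_roots => x y ax _ xy x0 y0.
have xn0 t : x <= t <= y -> ('X^n : {poly R}).[t] != 0.
  move=> /andP[xt _]; rewrite hornerXn expf_neq0 // gt_eqF //.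
  exact: lt_le_trans (lt_le_trans a0 ax) xt.
have [c cxy] := @rat_MVT R G 'X^n x y xy xn0.
rewrite x0 y0 !mul0r subrr => /esym/eqP e; exists c => //.
have c0 : 0 < c by case/andP: cxy => xc _; exact: lt_trans (lt_le_trans a0 ax) xc.
have yx : y - x != 0 by rewrite subr_eq0 gt_eqF.
have cn : ('X^n : {poly R}).[c] ^- 2 != 0.
  by rewrite invr_eq0 expf_neq0 // hornerXn expf_neq0 // gt_eqF.
move: e; rewrite !mulf_eq0 (negbTE yx) (negbTE cn) !orbF => /eqP.
rewrite /theta derivXn !(hornerD, hornerN, hornerM, hornerZ, hornerX, hornerXn, hornerMn).
case: n {xn0 cn} => [|n] /=.
  by rewrite expr0 mulr1 mulr0n mulr0 subr0 mul0r subr0 => ->; rewrite mulr0.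
move=> e; have : c ^+ n * (c * G^`().[c] - n.+1%:R * G.[c]) = 0.
  rewrite -[RHS]e exprS -mulr_natr; ring.
by move/eqP; rewrite mulf_eq0 expf_eq0 (gt_eqF c0) andbF /= => /eqP.
Qed.

Section Sums.
Variables (I : finType) (n : I -> nat) (c : I -> R).
Hypothesis n_inj : injective n.

Let x (i : I) : R := (n i)%:R.

Lemma natx_inj : injective x.
Proof. by move=> i j /eqP; rewrite eqr_nat => /eqP/n_inj. Qed.

Lemma theta_sum (d : I -> R) beta :
  theta beta (\sum_i d i *: 'X^(n i)) = \sum_i (d i * (x i - beta)) *: 'X^(n i).
Proof.
rewrite /theta linear_sum /= mulr_sumr scaler_sumr -sumrB; apply: eq_bigr => i _.
rewrite derivZ derivXn -scalerAr -(scalerA (d i)) scalerBl scalerBr.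
rewrite (scalerA beta) [beta * _]mulrC -(scalerA (d i) beta); congr (_ *: _ - _).
rewrite /x scaler_nat mulrnAr; case: (n i) => [|k]; first by rewrite !mulr0n.
by rewrite -exprS.
Qed.

(** Removes the powers indexed by [s] from an exponential sum. *)
Definition kill (s : seq I) G := foldr (fun i => theta (x i)) G s.

Lemma kill_roots a b k s G : 0 < a -> has_roots a b (size s + k) G -> has_roots a b k (kill s G).
Proof.
move=> a0; elim: s k => [|i s IH] k //=; rewrite addSnnS => /IH.
exact: theta_roots.
Qed.

Lemma kill_sum (s : seq I) :
  kill s (\sum_i c i *: 'X^(n i)) = \sum_i (c i * \prod_(j <- s) (x i - x j)) *: 'X^(n i).
Proof.
elim: s => [|j s IH] /=; first by apply: eq_bigr => i _; rewrite big_nil mulr1.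
rewrite IH theta_sum; apply: eq_bigr => i _; rewrite big_cons; congr (_ *: _); ring.
Qed.

(** A combination of [|I|] powers with the largest possible number of zeros, [|I| - 1],
has coefficients whose ratios are almost those of the divided difference weights:
all powers but two can be removed at the cost of one zero each, and the two
remaining terms cancel at the last zero. *)
Theorem two_terms a b k k' : 0 < a -> k != k' ->
  has_roots a b #|I|.-1 (\sum_i c i *: 'X^(n i)) ->
  exists2 xi, a <= xi <= b &
    c k / lweight x k * xi ^+ n k = c k' / lweight x k' * xi ^+ n k'.
Proof.
move=> a0 kk' H.
pose s := enum [pred j | (j != k) && (j != k')].
have cI : #|I| = (size s).+2.
  rewrite (cardD1 k) (cardD1 k') !inE eq_sym kk' /= !add1n -cardE; congr _.+2.
  by apply: eq_card => j; rewrite !inE andbC andbT.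
have : has_roots a b 1 (kill s (\sum_i c i *: 'X^(n i))).
  by apply: kill_roots => //; rewrite addn1; move: H; rewrite cI.
move=> [[|xi r] [_ // _ Hr]]; have [xab] := Hr xi (mem_head _ _).
rewrite kill_sum horner_sum (bigD1 k) //= (bigD1 k') 1?eq_sym //=.
rewrite [X in _ + (_ + X)]big1 => [|i /andP[ik ik']].
  rewrite !hornerZ !hornerXn addr0 => e; exists xi => //.
  have prodE u v : u != v -> (forall j, (j \in s) = (j != u) && (j != v)) ->
      \prod_(j <- s) (x u - x j) = (lweight x u * (x u - x v))^-1.
    move=> uv sP; rewrite /lweight (bigD1 v) 1?eq_sym //= mulrAC mulVf ?mul1r.
      rewrite -prodfV; under [RHS]eq_bigr do rewrite invrK.
      by rewrite big_enum; apply: eq_bigl => j; rewrite -sP mem_enum inE.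
    by rewrite subr_eq0 (inj_eq natx_inj).
  have lk := lweight_neq0 natx_inj k; have lk' := lweight_neq0 natx_inj k'.
  have xx : x k - x k' != 0 by rewrite subr_eq0 (inj_eq natx_inj).
  have k'k : k' != k by rewrite eq_sym.
  have e1 := prodE _ _ kk' (fun j => mem_enum _ _).
  have s' j : (j \in s) = (j != k') && (j != k) by rewrite mem_enum inE andbC.
  have e2 := prodE _ _ k'k s'.
  move: e; rewrite e1 e2 -[x k' - x k]opprB; set u := x k - x k' in xx *.
  move: (lweight x k) (lweight x k') lk lk' => w w' w0 w'0 e.
  apply/eqP; rewrite -subr_eq0; apply/eqP.
  apply: (mulfI (invr_neq0 xx)); rewrite mulr0 -[RHS]e; field.
  by rewrite xx w0 w'0.
have is_ : i \in s by rewrite mem_enum inE ik ik'.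
by rewrite (big_rem _ is_) /= subrr mul0r mulr0 scale0r horner0.
Qed.

End Sums.
End ExponentialSums.

(** * Equioscillation, with positive error at the left endpoint *)

Section Structure.
Context {R : realType}.
Implicit Types (F G : {poly R}) (a t x y : R).

(** Exponents and coefficients of [P(t^p) - t Q(t^p)] as a combination of [m + l + 2]
distinct powers of [t]: the left summand indexes the powers coming from [P], the
right one those coming from [Q]. *)
Definition expo (m l p : nat) (k : 'I_m.+1 + 'I_l.+1) : nat :=
  match k with inl i => (p * i)%N | inr j => (p * j).+1 end.

Definition pqcoef (m l : nat) (P Q : {poly R}) (k : 'I_m.+1 + 'I_l.+1) : R :=
  match k with inl i => P`_i | inr j => - Q`_j end.

Lemma expo_inj m l p : (1 < p)%N -> injective (@expo m l p).
Proof.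
move=> p2; have p0 : (0 < p)%N by exact: ltnW.
have H (i j : nat) : (p * i)%N <> (p * j).+1.
  move=> /(congr1 (modn^~ p)); rewrite -addn1 [(p * j)%N]mulnC modnMDl mulnC modnMl.
  by rewrite modn_small.
case=> [i|i] [j|j] /=.
- by move/eqP; rewrite eqn_pmul2l // => /eqP/val_inj->.
- by move/H.
- by move/esym/H.
- by case=> /eqP; rewrite eqn_pmul2l // => /eqP/val_inj->.
Qed.

Lemma card_expo m l : #|{: 'I_m.+1 + 'I_l.+1}| = (m + l).+2.
Proof. by rewrite card_sum !card_ord addSn addnS. Qed.

(** The defect [P(t^p) - t Q(t^p)] vanishes where the approximation is exact. *)
Lemma defect_sum m l p (P Q : {poly R}) : (size P <= m.+1)%N -> (size Q <= l.+1)%N ->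
  P \Po 'X^p - 'X * (Q \Po 'X^p) = \sum_(k : 'I_m.+1 + 'I_l.+1) pqcoef P Q k *: 'X^(expo p k).
Proof.
move=> sP sQ; rewrite big_sumType /=; congr (_ + _).
  rewrite comp_polyE (big_ord_widen _ (fun i => P`_i *: 'X^p ^+ i) sP) big_mkcond /=.
  apply: eq_bigr => i _; rewrite exprM; case: ifP => // /negbT; rewrite -leqNgt => si.
  by rewrite nth_default // scale0r.
rewrite comp_polyE (big_ord_widen _ (fun i => Q`_i *: 'X^p ^+ i) sQ) big_mkcond /=.
rewrite mulr_sumr -sumrN; apply: eq_bigr => i _.
rewrite exprS exprM scaleNr; congr (- _); case: ifP => [_|/negbT].
  by rewrite scalerAr.
by rewrite -leqNgt => si; rewrite nth_default // scale0r mulr0.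
Qed.

(** The weights at the two lowest exponents, 0 and 1, have opposite signs. *)
Lemma lweight_sign_adjacent m l p : (1 < p)%N ->
  lweight (fun k : 'I_m.+1 + 'I_l.+1 => (expo p k)%:R : R) (inl ord0) *
  lweight (fun k : 'I_m.+1 + 'I_l.+1 => (expo p k)%:R : R) (inr ord0) < 0.
Proof.
move=> p2; set x := fun k => _.
have split (u v : 'I_m.+1 + 'I_l.+1) : v != u -> lweight x u =
    (x u - x v)^-1 * \prod_(j | (j != u) && (j != v)) (x u - x j)^-1.
  by move=> vu; rewrite /lweight (bigD1 v).
rewrite (split (inl ord0) (inr ord0)) // (split (inr ord0) (inl ord0)) //.
rewrite mulrACA {1 2 3 4}/x /expo /= muln0 sub0r subr0 invrN invr1 mulr1 mulN1r.
rewrite oppr_lt0 [X in _ * X](eq_bigl (fun j => (j != inl ord0) && (j != inr ord0))).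
  rewrite -big_split /=; apply: prodr_gt0 => j /andP[j0 j1].
  have H : (2 <= expo p j)%N.
    case: j j0 j1 => j /= j0 j1.
      have jn0 : (0 < j)%N.
        by rewrite lt0n; apply: contra j0 => /eqP j0; apply/eqP; congr inl; exact: val_inj.
      by rewrite (leq_trans p2) // leq_pmulr.
    have jn0 : (0 < j)%N.
      by rewrite lt0n; apply: contra j1 => /eqP j1; apply/eqP; congr inr; exact: val_inj.
    by rewrite ltnS muln_gt0 jn0 ltnW.
  rewrite -invfM invr_gt0 /x /= muln0 sub0r mulNr -mulrN opprB mulr_gt0 ?subr_gt0 ?ltr0n ?ltr1n //.
  exact: ltnW.
by move=> j; rewrite andbC.
Qed.

(** A denominator without zeros on the interval is positive there up to a sign. *)
Lemma exists_sign_pos p a (Q : {poly R}) : 0 < a < 1 ->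
  (forall t, a <= t <= 1 -> Q.[t ^+ p] != 0) ->
  exists2 sg : R, sg = 1 \/ sg = -1 & forall t, a <= t <= 1 -> 0 < (sg *: Q).[t ^+ p].
Proof.
move=> /andP[a0 a1] Q0.
have one1 : a <= (1 : R) <= 1 by rewrite lexx ltW.
have cst t : a <= t <= 1 -> 0 < Q.[t ^+ p] * Q.[1 ^+ p].
  move=> t1; rewrite ltNge; apply/negP => le0.
  have t1' : t <= 1 by case/andP: t1.
  have le0' : (Q \Po 'X^p).[t] * (Q \Po 'X^p).[1] <= 0 by rewrite !horner_comp_exp.
  have [x] := polyrcf.poly_ivt t1' le0'.
  rewrite in_itv /= rootE horner_comp_exp => /andP[tx x1]; apply/negP/Q0.
  by rewrite x1 andbT (le_trans _ tx) //; case/andP: t1.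
have := Q0 _ one1; rewrite neq_lt => /orP[neg|pos].
  exists (-1); first by right.
  by move=> t /cst; rewrite hornerZ mulN1r oppr_gt0 nmulr_lgt0.
exists 1; first by left.
by move=> t /cst; rewrite hornerZ mul1r pmulr_lgt0.
Qed.

Variables (m l p : nat) (a : R).
Hypotheses (p2 : (1 < p)%N) (a01 : 0 < a < 1).

Local Notation E := (best_err m l (proot p) (zitv p a)).
Local Notation qt P Q t := ((P \Po 'X^p).[t] / ('X * (Q \Po 'X^p)).[t]).

(** The properties of the best approximant [P / Q], normalised so that [Q] is positive
on the interval: the degrees are full, the error is [E] at the left endpoint and
reaches [- E], it equioscillates at [m + l + 2] points, and [P / Q] interpolates
[z^(1/p)] at [m + l + 1] points. *)
Record equioscillating (P Q : {poly R}) : Prop := Equioscillating {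
  eq_sizeP : size P = m.+1;
  eq_sizeQ : size Q = l.+1;
  eq_Qpos : forall t, a <= t <= 1 -> 0 < Q.[t ^+ p];
  eq_within : within p a E P Q;
  eq_Epos : 0 < E;
  eq_left : P.[a ^+ p] = (1 + E) * (a * Q.[a ^+ p]);
  eq_low : exists2 t, a <= t <= 1 & P.[t ^+ p] = (1 - E) * (t * Q.[t ^+ p]);
  eq_alt : exists s : seq R, [/\ size s = (m + l).+1,
     path (fun x y => (x < y) && ((P \Po 'X^p - 'X * (Q \Po 'X^p)).[x] *
        (P \Po 'X^p - 'X * (Q \Po 'X^p)).[y] < 0)) a s &
     forall t, t \in a :: s -> a <= t <= 1 /\
        `|P.[t ^+ p] - t * Q.[t ^+ p]| = E * (t * Q.[t ^+ p])];
  eq_roots : has_roots a 1 (m + l).+1 (P \Po 'X^p - 'X * (Q \Po 'X^p))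
}.

Theorem best_approx_equioscillates r :
  is_best_approx m l (proot p) (zitv p a) r ->
  exists sg P Q, [/\ sg = 1 \/ sg = -1, r = (sg *: P, sg *: Q) & equioscillating P Q].
Proof.
move=> best; have p0 : (0 < p)%N by exact: ltnW.
have /andP[a0 a1] := a01.
have [[sr1 sr2 cop mon] q0 W] := best_approxP p0 a01 best.
have [sg sg1 Qpos] := exists_sign_pos a01 q0.
have [P PE] : exists P, P = sg *: r.1 by exists (sg *: r.1).
have [Q QE] : exists Q, Q = sg *: r.2 by exists (sg *: r.2).
rewrite -QE in Qpos.
have sg2 : sg * sg = 1 by case: sg1 => ->; rewrite ?mulr1 // mulrNN mulr1.
have sg0 : sg != 0 by case: sg1 => ->; rewrite ?oppr_eq0 oner_neq0.
exists sg, P, Q; split => //.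
  by rewrite PE QE !scalerA sg2 !scale1r -surjective_pairing.
have sP : (size P <= m.+1)%N by rewrite PE size_scale.
have sQ : (size Q <= l.+1)%N by rewrite QE size_scale.
have cPQ : coprimep P Q by rewrite PE QE coprimepZl // coprimepZr.
have E01 : 0 <= E < 1 by rewrite best_err_ge0 // best_err_lt1.
have WPQ : within p a E P Q by rewrite PE QE; exact: within_scale.
have Emin (P' Q' : {poly R}) e : (size P' <= m.+1)%N -> (size Q' <= l.+1)%N ->
  Q' != 0 -> within p a e P' Q' -> E <= e by exact: best_err_le.
have tpos t : a <= t <= 1 -> 0 < t by case/andP => + _; exact: lt_le_trans.
have [eP eQ es] := ext_full p2 a01 sP sQ cPQ E01 Qpos WPQ Emin.
have alt := alternation p2 a01 sP sQ cPQ E01 Qpos WPQ Emin.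
set z := roots _ a 1 in alt.
have sz : size z = (m + l)%N by exact: (size_roots_Wr p2 a01 sP sQ cPQ E01 Qpos WPQ Emin).
have itv t : t \in a :: rcons z 1 -> a <= t <= 1 by exact: full_itv.
have extr t : t \in a :: rcons z 1 -> (qt P Q t = 1 + E /\ 0 < (P \Po 'X^p - 'X * (Q \Po 'X^p)).[t])
   \/ (qt P Q t = 1 - E /\ (P \Po 'X^p - 'X * (Q \Po 'X^p)).[t] < 0).
  move=> tz; have t1 := itv _ tz.
  apply: (extremal_F p2 a01 E01 Qpos WPQ) => //.
  exact: (all_extremal p2 a01 sP sQ cPQ E01 Qpos WPQ Emin).
have E0 : 0 < E by exact: (E_gt0 p2 a01 E01 Qpos WPQ).
have Qt0 t : a <= t <= 1 -> 0 < ('X * (Q \Po 'X^p)).[t] by exact: (Qt_gt0 a01 Qpos).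
have hQt t : ('X * (Q \Po 'X^p)).[t] = t * Q.[t ^+ p] by exact: horner_Qt.
(* The defect changes sign between consecutive extremal points. *)
have FR : has_roots a 1 (m + l).+1 (P \Po 'X^p - 'X * (Q \Po 'X^p)).
  have EZ u v : (u < v) && ((P \Po 'X^p - 'X * (Q \Po 'X^p)).[u] *
      (P \Po 'X^p - 'X * (Q \Po 'X^p)).[v] < 0) ->
      exists2 c, u < c < v & (P \Po 'X^p - 'X * (Q \Po 'X^p)).[c] = 0.
    move=> /andP[uv /(poly_ivtoo (ltW uv))[c]]; rewrite in_itv /= => cuv /eqP c0.
    by exists c.
  have [s' [ps ss Zs ls]] := interlace EZ alt.
  exists s'; split; first exact: path_sorted ps.
    by rewrite ss size_rcons sz.
  move=> t ts; split; last exact: Zs.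
  have /ltW := ls _ ts; rewrite last_rcons => ->; rewrite andbT ltW //.
  by move: ps; rewrite lt_path_sortedE => /andP[/allP/(_ _ ts)].
have lowE t : a <= t <= 1 -> qt P Q t = 1 - E -> P.[t ^+ p] = (1 - E) * (t * Q.[t ^+ p]).
  move=> t1 <-; rewrite -hQt divfK ?gt_eqF ?Qt0 //; exact/esym/horner_comp_exp.
have highE t : a <= t <= 1 -> qt P Q t = 1 + E -> P.[t ^+ p] = (1 + E) * (t * Q.[t ^+ p]).
  move=> t1 <-; rewrite -hQt divfK ?gt_eqF ?Qt0 //; exact/esym/horner_comp_exp.
(* The coefficients of 1 and t in the defect, P`_0 and - Q`_0, have opposite signs
   like the weights at these exponents, by [two_terms]. *)
have PQ0 : 0 < P`_0 * Q`_0.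
  have FR' := FR; rewrite (defect_sum p sP sQ) in FR'.
  have tt k := @two_terms R _ _ (pqcoef P Q) (expo_inj (m := m) (l := l) p2) a 1 (inl ord0) k a0.
  rewrite card_expo in tt.
  have lw := lweight_neq0 (natx_inj (R := R) (expo_inj (m := m) (l := l) p2)).
  have P00 : P`_0 != 0.
    apply/eqP => P00; have [//|xi /andP[axi _]] := tt (inr ord_max) _ FR'.
    rewrite /= P00 mul0r mul0r => /esym/eqP; rewrite !mulf_eq0 invr_eq0 (negbTE (lw _)).
    rewrite expf_eq0 (gt_eqF (lt_le_trans a0 axi)) andbF !orbF oppr_eq0.
    by rewrite -[l]/(l.+1.-1) -eQ -/(lead_coef Q) lead_coef_eq0 -size_poly_eq0 eQ.
  have [//|xi /andP[axi _]] := tt (inr ord0) _ FR'.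
  have := lw (inl ord0); have := lw (inr ord0); have := lweight_sign_adjacent m l p2.
  move: (lweight _ (inl ord0)) (lweight _ (inr ord0)) => w0 w1 ws w10 w00.
  rewrite /= muln0 expr0 mulr1 expr1 => e.
  have xi0 := lt_le_trans a0 axi.
  have P0E : P`_0 = - (Q`_0 * xi * (w0 * w1) / w1 ^+ 2).
    rewrite -[LHS](divfK w00) e; field; exact: w10.
  have Q00 : Q`_0 != 0 by apply: contraNneq P00 => Q0; rewrite P0E Q0 !mul0r oppr0.
  rewrite P0E (_ : _ * _ = Q`_0 ^+ 2 * xi * - (w0 * w1) / w1 ^+ 2); last by ring.
  have sq (u : R) : u != 0 -> 0 < u ^+ 2 by move=> u0; rewrite exprn_even_gt0.
  apply: divr_gt0; last exact: sq.
  by apply: mulr_gt0; [apply: mulr_gt0 => //; exact: sq | rewrite oppr_gt0].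
(* The polynomial D of [Wr_comp] has D(0) = P(0) Q(0) > 0, and no zero before the
   p-th power of the first critical point.  So the error decreases from the left
   endpoint, where it must be + E. *)
pose y := nth 0 (rcons z 1) 0.
have ylt : a < y.
  by have /(pathP 0)/(_ 0%N) := alt; rewrite size_rcons => /(_ isT)/andP[].
have yin : y \in rcons z 1 by rewrite mem_nth // size_rcons.
have y1 : a <= y <= 1 by apply: itv; rewrite inE yin orbT.
have Wneg c : 0 < c < y -> ((P \Po 'X^p)^`() * ('X * (Q \Po 'X^p)) -
    (P \Po 'X^p) * ('X * (Q \Po 'X^p))^`()).[c] < 0.
  move=> /andP[c0 cy]; rewrite (Wr_comp P Q p2) hornerN oppr_lt0 ltNge; apply/negP => le0.
  set g := _ \Po _ in le0.
  have g0 : 0 < g.[0].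
    rewrite horner_comp_exp expr0n gtn_eqF //= !(hornerD, hornerN, hornerM, hornerZ, hornerX).
    by rewrite mul0r mulr0 subr0 !horner_coef0.
  have gg : g.[0] * g.[c] <= 0 by rewrite pmulr_rle0.
  have [x] := polyrcf.poly_ivt (ltW c0) gg; rewrite in_itv /= => /andP[x0 xc] /eqP gx.
  have xpos : 0 < x.
    rewrite lt_def x0 andbT; apply/eqP => x00.
    by rewrite x00 in gx; rewrite gx ltxx in g0.
  have xz : x \in z.
    apply: (Wr_pos_root p2 a01 sP sQ cPQ E01 Qpos WPQ Emin) => //.
    by rewrite (Wr_comp P Q p2) hornerN -/g gx oppr0.
  have xr : x \in rcons z 1 by rewrite mem_rcons inE xz orbT.
  have : y <= x.
    rewrite -(nth_index 0 xr) /y lt_sorted_leq_nth ?inE ?index_mem ?size_rcons //.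
    exact: path_sorted (full_sorted p P Q a01).
  by rewrite leNgt (le_lt_trans xc cy).
have left : qt P Q y < qt P Q a.
  have Qn0 t : a <= t <= y -> ('X * (Q \Po 'X^p)).[t] != 0.
    move=> /andP[at_ ty]; rewrite gt_eqF // Qt0 // at_ (le_trans ty) //.
    by case/andP: y1.
  have [c /andP[ac cy] e] := @rat_MVT R (P \Po 'X^p) _ a y ylt Qn0.
  rewrite -subr_lt0 e nmulr_rlt0 ?subr_gt0 // nmulr_rlt0 ?Wneg ?cy ?(lt_trans a0 ac) //.
  by rewrite invr_gt0 exprn_gt0 // Qt0 // (ltW ac) (le_trans (ltW cy)) //; case/andP: y1.
have aa : a \in a :: rcons z 1 by rewrite mem_head.
have yy : y \in a :: rcons z 1 by rewrite inE yin orbT.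
have [[ea _]|[ea _]] := extr _ aa; last first.
  by have [[ey _]|[ey _]] := extr _ yy; move: left; rewrite ea ey; [|rewrite ltxx]; lra.
split => //.
- by apply: highE => //; exact: itv.
- exists y => //; apply: lowE => //.
  by have [[ey _]|[ey _]//] := extr _ yy; move: left; rewrite ea ey ltxx.
- exists (rcons z 1); split=> //; first by rewrite size_rcons sz.
  move=> t tz; have t1 := itv _ tz; split=> //.
  have tQ : 0 < t * Q.[t ^+ p] by rewrite -hQt Qt0.
  have [[/highE-> // _]|[/lowE-> // _]] := extr _ tz.
    rewrite mulrDl mul1r addrAC subrr add0r gtr0_norm //; exact: mulr_gt0.
  by rewrite mulrBl mul1r addrAC subrr add0r normrN gtr0_norm //; exact: mulr_gt0.
Qed.
End Structure.

(** * Chebyshev polynomials *)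

Section Chebyshev.
Context {R : realType}.
Implicit Types (a b x y t : R) (w g : {poly R}).

(** The Chebyshev polynomials of the first kind. *)
Fixpoint cheb (n : nat) : {poly R} :=
  if n is n1.+1 then
    (if n1 is n2.+1 then 2 *: ('X * cheb n1) - cheb n2 else 'X)
  else 1.

Arguments cheb : simpl never.

Lemma chebSS n : cheb n.+2 = 2 *: ('X * cheb n.+1) - cheb n.
Proof. by []. Qed.

Lemma horner_cheb_cos n t : (cheb n).[cos t] = cos (n%:R * t).
Proof.
suff: (cheb n).[cos t] = cos (n%:R * t) /\ (cheb n.+1).[cos t] = cos (n.+1%:R * t).
  by case.
elim: n => [|n [IH0 IH1]]; first by rewrite mul0r cos0 mul1r hornerC hornerX.
split=> //; rewrite chebSS !(hornerD, hornerN, hornerZ, hornerM, hornerX) IH0 IH1.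
have -> : n.+2%:R * t = n.+1%:R * t + t by rewrite -natr1 mulrDl mul1r.
have -> : n%:R * t = n.+1%:R * t - t by rewrite -natr1 mulrDl mul1r addrK.
by rewrite (cosD _ t) cosB; ring.
Qed.

Lemma size_lead_cheb n : size (cheb n.+1) = n.+2 /\ lead_coef (cheb n.+1) = 2 ^+ n.
Proof.
suff H k : (k <= n)%N -> size (cheb k.+1) = k.+2 /\ lead_coef (cheb k.+1) = 2 ^+ k.
  exact: H.
elim: n k => [|n IH] k; first by rewrite leqn0 => /eqP->; rewrite size_polyX lead_coefX.
rewrite leq_eqVlt => /predU1P[->|]; last exact: IH.
have [sn ln] := IH n (leqnn n).
have c0 : cheb n.+1 != 0 by rewrite -size_poly_eq0 sn.
have s2 : size (2 *: ('X * cheb n.+1)) = n.+3.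
  by rewrite size_scale ?pnatr_eq0 // mulrC size_mulX // sn.
have s1 : (size (- cheb n) < n.+3)%N.
  rewrite size_polyN; case: n {sn ln c0 s2} IH => [|n] IH; first by rewrite size_poly1.
  by rewrite (IH n _).1.
rewrite chebSS size_polyDl ?s2 //; split=> //.
by rewrite lead_coefDl ?s2 // lead_coefZ (mulrC 'X) lead_coefMX ln exprS.
Qed.

Lemma cheb_le1 n x : -1 <= x <= 1 -> `|(cheb n).[x]| <= 1.
Proof.
move=> x1; have xi : x \in `[-1, 1] by rewrite in_itv.
rewrite -(acosK xi) horner_cheb_cos ler_norml.
by rewrite cos_geN1 cos_le1.
Qed.

Lemma cos_natpi n : cos (n%:R * pi) = (-1) ^+ n :> R.
Proof.
elim: n => [|n IH]; first by rewrite mul0r cos0.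
by rewrite -natr1 mulrDl mul1r cosDpi IH exprS mulN1r.
Qed.

(** Consecutive points at which the signs of [g] are opposite; alternating chains are
expressed as paths for this relation. *)
Definition alternates g x y := (x < y) && (g.[x] * g.[y] < 0).

Lemma alternates_size g a s : path (alternates g) a s -> (size s < size g)%N \/ s = [::].
Proof.
move=> alt; case: s alt => [|y s] alt; [by right | left].
have EZ u v : alternates g u v -> exists2 c, u < c < v & g.[c] = 0.
  move=> /andP[uv /(poly_ivtoo (ltW uv))[c]]; rewrite in_itv /= => cuv /eqP c0.
  by exists c.
have [s' [ps ss Zs ls]] := interlace EZ alt.
rewrite -ss; apply: max_poly_roots.
- by apply: contraTneq alt => ->; rewrite /= /alternates !horner0 mul0r ltxx andbF.
- by apply/allP => t /Zs; rewrite rootE => ->.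
- by apply: lt_sorted_uniq; exact: path_sorted ps.
Qed.

Lemma cheb_alternation n : exists x0 s, [/\ size s = n,
   path (alternates (cheb n)) x0 s &
   forall t, t \in x0 :: s -> -1 <= t <= 1 /\ `|(cheb n).[t]| = 1].
Proof.
case: n => [|n].
  exists 0, [::]; split=> // t; rewrite inE => /eqP ->.
  by rewrite hornerC normr1 lerN10 ler01.
pose N := n.+1; pose th (i : nat) : R := (N - i)%:R / N%:R * pi; pose y i := cos (th i).
have N0 : 0 < N%:R :> R by rewrite ltr0n.
have thi i : th i \in `[0, pi].
  rewrite in_itv /= mulr_ge0 ?pi_ge0 ?divr_ge0 //= ger_pMl ?pi_gt0 //.
  by rewrite ler_pdivrMr // mul1r ler_nat leq_subr.
have chy i : (cheb N).[y i] = (-1) ^+ (N - i).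
  rewrite /y horner_cheb_cos /th -cos_natpi; congr cos; field.
  by rewrite -natr1 in N0; rewrite gt_eqF // natr1.
have ylt i : (i < N)%N -> alternates (cheb N) (y i) (y i.+1).
  move=> iN; rewrite /alternates /y ltr_cos ?thi // -/(y i) -/(y i.+1) !chy.
  rewrite ltr_pM2r ?pi_gt0 // ltr_pM2r ?invr_gt0 // ltr_nat ltn_sub2l //=.
  by rewrite -(subnSK iN) exprS mulN1r mulNr -expr2 sqrr_sign oppr_lt0.
exists (y 0%N), [seq y i | i <- iota 1 N]; split.
- by rewrite size_map size_iota.
- apply/(pathP 0) => i; rewrite size_map size_iota => iN.
  have nm k : (k < N)%N -> nth 0 [seq y i | i <- iota 1 N] k = y k.+1.
    by move=> kN; rewrite (nth_map 0%N) ?size_iota // nth_iota.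
  rewrite (nm _ iN); case: i iN => [|i] iN; first exact: ylt.
  by rewrite -[nth _ _ i.+1]/(nth 0 [seq y i | i <- iota 1 N] i) nm ?ylt // ltnW.
- move=> t tin; have [i ->] : exists i, t = y i.
    by move: tin; rewrite inE => /predU1P[->|/mapP[i _ ->]]; [exists 0%N | exists i].
  by rewrite cos_geN1 cos_le1 chy normrX normrN1 expr1n.
Qed.

(** The largest absolute value on [[a, b]] of the monic Chebyshev polynomial of degree
[n > 0] of this interval. *)
Definition chebM a b n : R := 2 * ((b - a) / 4) ^+ n.

Lemma scaled_cheb a b n : a < b -> exists T : {poly R},
  [/\ size T = n.+2, T \is monic,
      forall x, a <= x <= b -> `|T.[x]| <= chebM a b n.+1 &
      exists x0 s, [/\ size s = n.+1, path (alternates T) x0 s &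
        forall t, t \in x0 :: s -> a <= t <= b /\ `|T.[t]| = chebM a b n.+1]].
Proof.
move=> ab; have ba0 : 0 < b - a by rewrite subr_gt0.
have M0 : 0 < chebM a b n.+1 by rewrite mulr_gt0 // exprn_gt0 // divr_gt0.
set M := chebM a b n.+1 in M0 *.
have k0 : 0 < 2 / (b - a) by rewrite divr_gt0.
pose q : {poly R} := (2 / (b - a)) *: 'X - ((a + b) / (b - a))%:P.
have sq1 : (size (- ((a + b) / (b - a))%:P : {poly R}) < size ((2 / (b - a)) *: 'X : {poly R}))%N.
  by rewrite size_polyN size_scale ?gt_eqF // size_polyX ltnS size_polyC_leq1.
have sq : size q = 2%N by rewrite /q size_polyDl // size_scale ?gt_eqF // size_polyX.
have lq : lead_coef q = 2 / (b - a) by rewrite /q lead_coefDl // lead_coefZ lead_coefX mulr1.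
have hq x : q.[x] = (2 * x - (a + b)) / (b - a).
  rewrite /q hornerD hornerN hornerZ hornerX hornerC; field; exact: lt0r_neq0.
have [sc lc] := size_lead_cheb n.
have c0 : cheb n.+1 != 0 by rewrite -size_poly_eq0 sc.
exists (M *: (cheb n.+1 \Po q)).
have hT x : (M *: (cheb n.+1 \Po q)).[x] = M * (cheb n.+1).[q.[x]].
  by rewrite hornerZ horner_comp.
split.
- rewrite size_scale ?gt_eqF // -[LHS]prednK ?size_poly_gt0 ?comp_poly_eq0 ?sq //.
  by rewrite size_comp_poly sq sc muln1.
- rewrite monicE lead_coefZ lead_coef_comp ?sq // lq lc sc /= /M /chebM.
  rewrite mulrACA -exprMn -exprS (_ : (b - a) / 4 * _ = 2^-1); last first.
    by field; exact: lt0r_neq0.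
  by rewrite -exprMn divff ?expr1n // pnatr_eq0.
- move=> x /andP[ax xb]; rewrite hT normrM (gtr0_norm M0) ger_pMr // cheb_le1 // hq.
  rewrite ler_pdivlMr // ler_pdivrMr //; apply/andP; split; lra.
- have [x0 [s [ss ps Hs]]] := cheb_alternation n.+1.
  pose u x := ((b - a) * x + (a + b)) / 2.
  have qu x : q.[u x] = x by rewrite hq /u; field; exact: lt0r_neq0.
  exists (u x0), (map u s); split; first by rewrite size_map.
    rewrite path_map; apply: sub_path ps => x y /andP[xy cxy].
    rewrite /alternates /= !hT !qu mulrACA (pmulr_rlt0 _ (mulr_gt0 M0 M0)) cxy andbT.
    by rewrite /u ltr_pM2r ?invr_gt0 // ltrD2r ltr_pM2l.
  move=> t; rewrite -map_cons => /mapP[x /Hs[/andP[x1 x2] cx] ->].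
  rewrite hT qu normrM cx mulr1 gtr0_norm //; split=> //.
  rewrite /u ler_pdivlMr // ler_pdivrMr //; apply/andP; split; nra.
Qed.

Lemma size_sub_monic w g n : size w = n.+1 -> w \is monic -> size g = n.+1 -> g \is monic ->
  (size (w - g)%R <= n)%N.
Proof.
move=> sw /monicP lw sg /monicP lg; apply/leq_sizeP => j nj; rewrite coefB.
move: nj; rewrite leq_eqVlt => /predU1P[<-|nj].
  by move: lw lg; rewrite /lead_coef sw sg /= => -> ->; rewrite subrr.
by rewrite !nth_default ?subrr // ?sw ?sg.
Qed.

Lemma alternates_perturb g h x y : alternates g x y ->
  `|h.[x]| < `|g.[x]| -> `|h.[y]| < `|g.[y]| -> alternates (g - h) x y.
Proof.
move=> /andP[xy gxy]; rewrite /alternates xy /= !(hornerD, hornerN).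
move: gxy; move: g.[x] g.[y] h.[x] h.[y] => u v c d uv.
rewrite !ltr_norml => /andP[h1 h2] /andP[h3 h4].
have [u0|u0] := ltP 0 u.
  have v0 : v < 0 by move: uv; rewrite pmulr_rlt0.
  rewrite gtr0_norm // in h1 h2; rewrite ltr0_norm // in h3 h4.
  by rewrite pmulr_rlt0; lra.
have u0' : u < 0.
  by rewrite lt_neqAle u0 andbT; apply/eqP => u00; rewrite u00 mul0r ltxx in uv.
have v0 : 0 < v by move: uv; rewrite nmulr_rlt0.
rewrite ltr0_norm // in h1 h2; rewrite gtr0_norm // in h3 h4.
by rewrite nmulr_rlt0; lra.
Qed.

(** No monic polynomial of degree [n + 1] stays below the Chebyshev bound. *)
Theorem cheb_lower a b n w : a < b -> size w = n.+2 -> w \is monic ->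
  exists2 x, a <= x <= b & chebM a b n.+1 <= `|w.[x]|.
Proof.
move=> ab sw mw; apply: contrapT => Hn.
have Hw x : a <= x <= b -> `|w.[x]| < chebM a b n.+1.
  by move=> xab; rewrite ltNge; apply/negP => le; apply: Hn; exists x.
have [T [sT mT _ [x0 [s [ss ps Hs]]]]] := scaled_cheb n ab.
have sTw := size_sub_monic sT mT sw mw.
have [|] : (size s < size (T - w)%R)%N \/ s = [::].
- apply: (alternates_size (a := x0)).
  apply: (sub_in_path (P := mem (x0 :: s))) ps; last by apply/allP.
  move=> x y /Hs[x1 Tx] /Hs[y1 Ty] xy.
  by apply: alternates_perturb xy _ _; rewrite ?Tx ?Ty; apply: Hw.
- by rewrite ss ltnNge sTw.
- by move=> s0; rewrite s0 in ss.
Qed.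

(** A monic polynomial of degree [n + 1] alternating at [n + 2] points cannot exceed
the Chebyshev bound at all of them. *)
Theorem cheb_upper a b n w x0 s : a < b -> size w = n.+2 -> w \is monic ->
  size s = n.+1 -> path (alternates w) x0 s -> (forall t, t \in x0 :: s -> a <= t <= b) ->
  exists2 t, t \in x0 :: s & `|w.[t]| <= chebM a b n.+1.
Proof.
move=> ab sw mw ss ps Hs; apply: contrapT => Hn.
have Hw x : x \in x0 :: s -> chebM a b n.+1 < `|w.[x]|.
  by move=> xab; rewrite ltNge; apply/negP => le; apply: Hn; exists x.
have [T [sT mT bT _]] := scaled_cheb n ab.
have sTw := size_sub_monic sw mw sT mT.
have [|] : (size s < size (w - T)%R)%N \/ s = [::].
- apply: (alternates_size (a := x0)).
  apply: (sub_in_path (P := mem (x0 :: s))) ps; last by apply/allP.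
  move=> x y xs ys xy.
  by apply: alternates_perturb xy _ _; apply: le_lt_trans (bT _ (Hs _ _)) (Hw _ _).
- by rewrite ss ltnNge sTw.
- by move=> s0; rewrite s0 in ss.
Qed.

End Chebyshev.

(** * Divided difference weights and the rate constant *)

Section RateConstant.
Context {R : realType}.
Implicit Types (y s : R) (f : R -> R).

(** The forward difference. *)
Definition fdiff f y : R := f (y + 1) - f y.

Lemma iter_fdiff f l y : iter l fdiff f y =
  \sum_(j < l.+1) (-1) ^+ (l - j) * 'C(l, j)%:R * f (y + j%:R).
Proof.
elim: l y => [|l IH] y.
  by rewrite big_ord_recl big_ord0 /= bin0 mulr1 mul1r !addr0.
rewrite iterS /fdiff !IH big_ord_recr [X in _ - X]big_ord_recl /=.
rewrite [RHS]big_ord_recl [X in _ = _ + X]big_ord_recr /=.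
rewrite /bump /= !add1n !subn0 !subnn !binn !bin0 !addr0.
have -> : \sum_(i < l) (-1) ^+ (l.+1 - i.+1) * 'C(l.+1, i.+1)%:R * f (y + i.+1%:R) =
  \sum_(i < l) (-1) ^+ (l - i) * 'C(l, i)%:R * f (y + 1 + i%:R) -
  \sum_(i < l) (-1) ^+ (l - i.+1) * 'C(l, i.+1)%:R * f (y + i.+1%:R).
  rewrite -sumrB; apply: eq_bigr => i _.
  rewrite subSS binS natrD -(subnSK (ltn_ord i)) exprS (_ : y + 1 + i%:R = y + i.+1%:R);
    last by rewrite -addrA nat1r.
  ring.
rewrite [X in _ - (_ + X) = _](_ : _ =
  \sum_(i < l) (-1) ^+ (l - i.+1) * 'C(l, i.+1)%:R * f (y + i.+1%:R)) //.
rewrite (_ : y + 1 + l%:R = y + l.+1%:R); last by rewrite -addrA nat1r.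
rewrite exprS; ring.
Qed.

(** [y] is not an integer. *)
Definition nonint y := forall z : int, y != z%:~R.

Lemma nonintD y (k : nat) : nonint y -> nonint (y + k%:R).
Proof.
move=> ny z; apply/eqP => e; have := ny (z - k%:Z).
by rewrite intrB /= -e -pmulrn addrK eqxx.
Qed.

(** The falling factorial [y (y - 1) ... (y - m)], with [m + 1] factors. *)
Definition Gprod m y : R := \prod_(i < m.+1) (y - i%:R).

Lemma Gprod_neq0 m y : nonint y -> Gprod m y != 0.
Proof. by move=> ny; apply/prodf_neq0 => i _; rewrite subr_eq0 pmulrn ny. Qed.

Lemma Gprod_shift m y : Gprod m.+1 (y + 1) = (y + 1) * Gprod m y.
Proof.
rewrite /Gprod big_ord_recl subr0; congr (_ * _); apply: eq_bigr => i _.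
by rewrite /= /bump /= add1n -natr1 opprD addrACA subrr addr0.
Qed.

Lemma Gprod_recr m y : Gprod m.+1 y = Gprod m y * (y - m.+1%:R).
Proof. by rewrite /Gprod big_ord_recr. Qed.

Lemma fdiff_inv_Gprod m y : nonint y ->
  (Gprod m (y + 1))^-1 - (Gprod m y)^-1 = - m.+1%:R / Gprod m.+1 (y + 1).
Proof.
move=> ny; have ny1 : nonint (y + 1) by exact: (nonintD 1 ny).
have g0 := Gprod_neq0 m ny; have g1 := Gprod_neq0 m ny1.
have g2 := Gprod_neq0 m.+1 ny1.
have e1 := Gprod_shift m y; have e2 := Gprod_recr m (y + 1).
move: g0 g1 g2 e1 e2; move: (Gprod m y) (Gprod m (y + 1)) (Gprod _.+1 _) => u v w u0 v0 w0 e1 e2.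
have y1 : y + 1 = w / u by rewrite e1 (mulfK u0).
have y2 : y + 1 - m.+1%:R = w / v by rewrite e2 mulrC (mulKf v0).
have -> : - m.+1%:R = w / v - w / u by rewrite -y2 y1; ring.
by field; rewrite u0 v0 w0.
Qed.

(** Iterated differences of the reciprocal of a falling factorial. *)
Lemma iter_fdiff_Gprod m l y : nonint y ->
  iter l fdiff (fun y => (Gprod m y)^-1) y =
  (-1) ^+ l * (m + l)`!%:R / m`!%:R / Gprod (m + l) (y + l%:R).
Proof.
elim: l y => [|l IH] y ny.
  by rewrite /= addn0 addr0 mul1r divff ?mul1r // pnatr_eq0 -lt0n fact_gt0.
rewrite iterS /fdiff IH; last exact: (nonintD 1 ny).
rewrite IH // -mulrBr addrAC fdiff_inv_Gprod; last exact: nonintD.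
rewrite (_ : y + l%:R + 1 = y + l.+1%:R); last by rewrite -addrA natr1.
rewrite addnS factS natrM exprS; ring.
Qed.

Lemma prod_diff_nat (j k : nat) :
  \prod_(i < (j + k).+1 | i != j :> nat) (j%:R - i%:R) =
  (-1) ^+ k * j`!%:R * k`!%:R :> R.
Proof.
elim: k => [|k IH].
  rewrite addn0 mul1r mulr1 big_mkcond big_ord_recr /= eqxx mulr1.
  rewrite (eq_bigr (fun i : 'I_j => j%:R - i%:R)); last first.
    by move=> i _; rewrite /= ltn_eqF.
  rewrite (reindex_inj rev_ord_inj) /= fact_prod natr_prod big_add1 big_mkord /=.
  by apply: eq_bigr => i _; rewrite natrB // opprB addrCA subrr addr0.
rewrite addnS big_mkcond big_ord_recr -big_mkcond /= IH.
have -> : ((j + k).+1 != j)%N by rewrite -addnS -[X in _ != X]addn0 eqn_add2l.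
rewrite factS natrM exprS -addnS natrD opprD addrA subrr add0r; ring.
Qed.

Lemma lweight_nat l (j : 'I_l.+1) :
  lweight (fun j : 'I_l.+1 => (j : nat)%:R : R) j = (-1) ^+ (l - j) * 'C(l, j)%:R / l`!%:R.
Proof.
have jl : (j <= l)%N by rewrite -ltnS.
have fn0 n : n`!%:R != 0 :> R by rewrite pnatr_eq0 -lt0n fact_gt0.
rewrite /lweight prodfV.
have := prod_diff_nat j (l - j); rewrite subnKC // => ->.
rewrite -(bin_fact jl) !natrM.
have s1 : (-1) ^+ (l - j) * (-1) ^+ (l - j) = 1 :> R by rewrite -expr2 sqrr_sign.
have b0 : 'C(l, j)%:R != 0 :> R by rewrite pnatr_eq0 -lt0n bin_gt0.
have s0 : (-1) ^+ (l - j) != 0 :> R by rewrite signr_eq0.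
apply: (mulfI s0); rewrite !mulrA s1 mul1r !invfM; field.
by rewrite !fn0 b0.
Qed.

(** Up to powers of [p], the weights at the exponents [p j + 1] are binomial
coefficients times [1 / Gprod m (1/p + j)], so that their sum is an iterated
difference of [1 / Gprod m] at [1/p]. *)
Lemma sum_lweight_expo m l p : (1 < p)%N ->
  \sum_(j < l.+1) lweight (fun k : 'I_m.+1 + 'I_l.+1 => (expo p k)%:R : R) (inr j) =
  (p%:R ^+ (m + l).+1)^-1 * (-1) ^+ l * (m + l)`!%:R / (m`!%:R * l`!%:R)
     / Gprod (m + l) (p%:R^-1 + l%:R).
Proof.
move=> p2; have p0 : p%:R != 0 :> R by rewrite pnatr_eq0 gtn_eqF // ltnW.
have fn0 n : n`!%:R != 0 :> R by rewrite pnatr_eq0 -lt0n fact_gt0.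
have ni : nonint (p%:R^-1 : R).
  move=> z; apply/eqP => e; have p1 : 1 < p%:R :> R by rewrite ltr1n.
  have i0 : 0 < (p%:R : R)^-1 by rewrite invr_gt0 (lt_trans ltr01).
  have i1 : (p%:R : R)^-1 < 1 by rewrite invf_lt1 ?(lt_trans ltr01).
  by move: i0 i1; rewrite e ltr0z ltrz1; case: z {e} => // -[].
have term (j : 'I_l.+1) :
   lweight (fun k : 'I_m.+1 + 'I_l.+1 => (expo p k)%:R : R) (inr j) =
   (p%:R ^+ (m + l).+1)^-1 / l`!%:R *
    ((-1) ^+ (l - j) * 'C(l, j)%:R * (Gprod m (p%:R^-1 + j%:R))^-1).
  rewrite /lweight big_sumType /=.
  have -> : \prod_(i < m.+1 | (inl i : 'I_m.+1 + 'I_l.+1) != inr j)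
      ((p * j).+1%:R - (p * i)%:R : R)^-1 =
      (p%:R ^+ m.+1)^-1 * (Gprod m (p%:R^-1 + j%:R))^-1.
    rewrite (eq_bigl xpredT) // prodfV -invfM /Gprod; congr (_^-1).
    rewrite -[X in _ ^+ X]card_ord -prodr_const -big_split /=; apply: eq_bigr => i _.
    by rewrite -natr1 !natrM; field.
  have -> : \prod_(i < l.+1 | (inr i : 'I_m.+1 + 'I_l.+1) != inr j)
      ((p * j).+1%:R - (p * i).+1%:R : R)^-1 =
      (p%:R ^+ l)^-1 * lweight (fun j : 'I_l.+1 => (j : nat)%:R : R) j.
    rewrite (eq_bigl (fun i => i != j)) // /lweight !prodfV -invfM; congr (_^-1).
    have -> : p%:R ^+ l = \prod_(i < l.+1 | i != j) (p%:R : R).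
      by rewrite prodr_const (cardC1 j) card_ord.
    rewrite -big_split /=; apply: eq_bigr => i _.
    by rewrite -!natr1 !natrM; ring.
  rewrite lweight_nat -addSn exprD; field.
  by rewrite Gprod_neq0 ?fn0 ?expf_neq0 //; exact: nonintD.
rewrite (eq_bigr _ (fun j _ => term j)) -mulr_sumr.
rewrite -(iter_fdiff (fun y => (Gprod m y)^-1)) iter_fdiff_Gprod //; field.
by rewrite Gprod_neq0 ?fn0 ?expf_neq0 //; exact: nonintD.
Qed.

Lemma Gprod_rising m l s : Gprod (m + l) (s + l%:R) =
  (-1) ^+ m * rising s l.+1 * rising (1 - s) m.
Proof.
have risingS b k : rising b k.+1 = rising b k * (b + k%:R) by rewrite /rising big_ord_recr.
rewrite /Gprod; elim: m => [|m IH].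
  rewrite add0n [rising _ 0]big_ord0 mulr1 mul1r (reindex_inj rev_ord_inj) /=.
  apply: eq_bigr => i _; rewrite subSS natrB ?opprB; last by rewrite -ltnS.
  by rewrite addrA addrAC addrK.
rewrite addSn big_ord_recr /= IH (risingS _ (1 - s) m) exprS.
rewrite (_ : s + l%:R - (m + l).+1%:R = - (1 - s + m%:R)); first by ring.
by rewrite -natr1 natrD; ring.
Qed.

(** The limit, as the interval shrinks to 1, of the best error divided by the
Chebyshev bound of degree [m + l + 1]. *)
Definition cheb_const m l p : R :=
  (p%:R ^+ (m + l + 1) * m`!%:R * l`!%:R * rising (p%:R^-1) l.+1 * rising (1 - p%:R^-1) m)
  / ((m + l + 1)`!%:R * (m + l)`!%:R).

Lemma rising_gt0 s k : 0 < s -> 0 < rising s k.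
Proof. by move=> s0; apply: prodr_gt0 => i _; rewrite ltr_wpDr. Qed.

Lemma cheb_const_gt0 m l p : (1 < p)%N -> 0 < cheb_const m l p.
Proof.
move=> p2; have p0 : 0 < p%:R :> R by rewrite ltr0n ltnW.
have p1 : p%:R^-1 < 1 :> R by rewrite invf_lt1 // ltr1n.
have i0 : 0 < (p%:R : R)^-1 by rewrite invr_gt0.
have f0 n : 0 < n`!%:R :> R by rewrite ltr0n fact_gt0.
have r1 := @rising_gt0 (p%:R^-1) l.+1 i0.
have r2 : 0 < rising (1 - (p%:R : R)^-1) m by rewrite rising_gt0 // subr_gt0.
apply: divr_gt0; last exact: mulr_gt0.
by do 4 (apply: mulr_gt0 => //); exact: exprn_gt0.
Qed.

Lemma rate_constE m l p : rate_const m l p = cheb_const m l p / 2 ^+ (m + l).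
Proof.
have e (u a b c : R) : u / (a * b * c) = u / (b * c) / a.
  by rewrite -(mulrA a) invfM mulrCA mulrC.
exact: e.
Qed.

Lemma cheb_constE m l p : (1 < p)%N ->
  `|\sum_(j < l.+1) lweight (fun k : 'I_m.+1 + 'I_l.+1 => (expo p k)%:R : R) (inr j)|
  = ((m + l).+1`!%:R * cheb_const m l p)^-1.
Proof.
move=> p2; have p0 : 0 < p%:R :> R by rewrite ltr0n ltnW.
have p1 : p%:R^-1 < 1 :> R by rewrite invf_lt1 // ltr1n.
have i0 : 0 < (p%:R : R)^-1 by rewrite invr_gt0.
have r1 := @rising_gt0 (p%:R^-1) l.+1 i0.
have r2 : 0 < rising (1 - (p%:R : R)^-1) m by rewrite rising_gt0 // subr_gt0.
have fn0 n : n`!%:R != 0 :> R by rewrite pnatr_eq0 -lt0n fact_gt0.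
rewrite sum_lweight_expo // Gprod_rising /cheb_const.
move: (rising _ l.+1) (rising _ m) r1 r2 => u v u0 v0.
rewrite !(normrM, normfV, normrX, normrN1, expr1n, normr_nat) (gtr0_norm u0) (gtr0_norm v0).
rewrite addn1 !mul1r mulr1; field.
by rewrite !fn0 !gt_eqF ?exprn_gt0.
Qed.

End RateConstant.

(** * The defect as a perturbed monic polynomial *)

Section Asymptotics.
Context {R : realType}.
Implicit Types (F P Q w : {poly R}) (a b t : R).

Lemma derivn_monic w n : size w = n.+1 -> w \is monic -> w^`(n) = (n`!%:R)%:P.
Proof.
move=> sw /monicP lw; apply/polyP => i; rewrite coef_derivn coefC.
case: i => [|i] /=; last by rewrite nth_default ?mul0rn // sw addnS ltnS leq_addr.
by rewrite addn0 ffactnn; move: lw; rewrite /lead_coef sw /= => ->.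
Qed.

(** The remainder of the interpolation of zero at the zeros [s] of [F]. *)
Lemma interpolation_error F (s : seq R) a b t : sorted <%R s ->
  (forall x, x \in s -> a <= x <= b /\ F.[x] = 0) -> a <= t <= b ->
  exists2 eta, a <= eta <= b &
    F.[t] * (size s)`!%:R = (\prod_(r <- s) ('X - r%:P)).[t] * F^`(size s).[eta].
Proof.
move=> ss Hs tab; set w := \prod_(r <- s) _.
have rw y : (w.[y] == 0) = (y \in s) by rewrite -rootE root_prod_XsubC.
have [ts|ts] := boolP (t \in s).
  exists t => //; rewrite (Hs _ ts).2 mul0r.
  by have := rw t; rewrite ts => /eqP->; rewrite mul0r.
have wt : w.[t] != 0 by rewrite rw.
have mw : w \is monic by exact: monic_prod_XsubC.
have sw : size w = (size s).+1 by exact: size_prod_XsubC.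
pose G := F - (F.[t] / w.[t]) *: w.
have HG : has_roots a b (size s + 1) G.
  exists (sort <=%R (t :: s)); split.
  - by rewrite sort_lt_sorted /= ts lt_sorted_uniq.
  - by rewrite size_sort addn1.
  move=> x; rewrite mem_sort inE => /predU1P[->|xs].
    by split=> //; rewrite /G hornerD hornerN hornerZ divfK // subrr.
  have [xab Fx] := Hs _ xs; split=> //.
  rewrite /G hornerD hornerN hornerZ Fx.
  by have := rw x; rewrite xs => /eqP->; rewrite mulr0 subr0.
have [[|eta s'] [_ // _ He]] := derivn_roots HG.
have [eab] := He eta (mem_head _ _).
rewrite /G derivnB derivnZ (derivn_monic sw mw) hornerD hornerN hornerZ hornerC.
move/eqP; rewrite subr_eq0 => /eqP e; exists eta => //.
by rewrite e mulrCA mulrA divfK.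
Qed.

Lemma weighted_sum_dev (I : finType) (A f : I -> R) kap :
  (forall i, `|f i - 1| <= kap) ->
  `|\sum_i A i * f i - \sum_i A i| <= kap * \sum_i `|A i|.
Proof.
move=> H; rewrite -sumrB (le_trans (ler_norm_sum _ _ _)) // mulr_sumr ler_sum // => i _.
by rewrite -[X in _ - X]mulr1 -mulrBr normrM mulrC ler_wpM2r.
Qed.

Section Fixed.
Variables (m l p : nat).
Hypothesis p2 : (1 < p)%N.

Local Notation I := ('I_m.+1 + 'I_l.+1)%type.
(* K bounds the exponents.  As the interval shrinks to 1, A1 collects the limit
   coefficients of the derivative of order N1 of the defect, and q0 is the limit of
   t Q(t^p), both up to a common factor. *)
Let K := (p * (m + l)).+1.
Let x (k : I) : R := (expo p k)%:R.
Let lam k := lweight x k.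
Let N1 := (m + l).+1.
Let q0 : R := - \sum_(j < l.+1) lam (inr j).
Let A1 (k : I) : R := lam k * (expo p k ^_ N1)%:R.

Lemma expo_le (k : I) : (expo p k <= K)%N.
Proof.
rewrite /K; case: k => [i|j] /=;
  last by rewrite ltnS leq_mul2l (leq_trans (leq_ord j)) ?orbT // leq_addl.
by rewrite ltnW // ltnS leq_mul2l (leq_trans (leq_ord i)) ?orbT // leq_addr.
Qed.

(** The divided difference of the monic polynomial [y (y - 1) ... (y - (m + l))] of
degree [m + l + 1] at the [m + l + 2] exponents. *)
Lemma sum_A1 : \sum_k A1 k = 1.
Proof.
have xi : injective x by apply: natx_inj; exact: expo_inj.
pose g : {poly R} := \prod_(i < N1) ('X - (i%:R)%:P).
have sg : size g = N1.+1 by rewrite size_prod_XsubC /index_enum -enumT size_enum_ord.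
have := @lagrange_lead _ _ _ xi g; rewrite card_expo sg => /(_ (leqnn _)) /=.
have : lead_coef g = 1 by apply/monicP; exact: monic_prod_XsubC.
rewrite /lead_coef sg /= => -> <-; apply: eq_bigr => k _.
rewrite /A1 mulrC; congr (_ * _); rewrite horner_prod ffact_prod.
have [le|lt] := leqP N1 (expo p k).
  rewrite natr_prod; apply: eq_bigr => i _; rewrite !hornerE natrB //.
  by rewrite (leq_trans (ltnW (ltn_ord i))).
rewrite (bigD1 (Ordinal lt)) //= subnn mul0n (bigD1 (Ordinal lt)) //= !hornerE.
by rewrite /x subrr mul0r.
Qed.

(** The relative size of the perturbation; it tends to 0 as [a] tends to 1. *)
Definition kappa a : R := a^-1 ^+ K - 1.

Lemma power_dev a y u e : 0 < a < 1 -> 1 <= y <= a^-1 ^+ K -> a <= u <= 1 -> (e <= K)%N ->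
  `|y * u ^+ e - 1| <= kappa a.
Proof.
move=> /andP[a0 a1] /andP[y1 yK] /andP[au u1] eK.
have u0 := lt_le_trans a0 au.
have aK0 : 0 < a ^+ K by rewrite exprn_gt0.
have ue : a ^+ K <= u ^+ e.
  apply: (@le_trans _ _ (u ^+ K)).
    by rewrite lerXn2r // ?nnegrE ltW.
  by rewrite ler_wiXn2l // ltW.
have ue1 : u ^+ e <= 1 by rewrite exprn_ile1 // ltW.
have up : y * u ^+ e <= a^-1 ^+ K.
  by rewrite -[leRHS]mulr1 ler_pM ?exprn_ge0 ?(ltW u0) ?(le_trans ler01 y1).
have lo : a ^+ K <= y * u ^+ e.
  by rewrite -[leLHS]mul1r ler_pM ?(ltW aK0).
have two : 2 <= a ^+ K + a^-1 ^+ K.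
  rewrite exprVn; move: (a ^+ K) aK0 => z z0.
  have := sqr_ge0 (z - 1); rewrite sqrrB1 => sq.
  rewrite -subr_ge0 (_ : _ - 2 = (z ^+ 2 - z *+ 2 + 1) / z); last by field; exact: lt0r_neq0.
  by rewrite divr_ge0 // ltW.
by rewrite /kappa ler_norml; apply/andP; split; lra.
Qed.

Variables (a : R) (P Q : {poly R}).
Hypotheses (a01 : 0 < a < 1) (eqs : equioscillating m l p a P Q).
Local Notation F := (P \Po 'X^p - 'X * (Q \Po 'X^p)).

(** The coefficients of the defect are those of the divided difference up to a common
factor and factors [y k] close to 1. *)
Lemma coef_ratios : exists mu : R, exists2 y : I -> R,
  forall k, 1 <= y k <= a^-1 ^+ K & forall k, pqcoef P Q k = mu * lam k * y k.
Proof.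
have [sP sQ] := (eq_sizeP eqs, eq_sizeQ eqs).
have /andP[a0 a1] := a01.
have FR := eq_roots eqs; rewrite (@defect_sum _ m l) ?sP ?sQ // in FR.
have aV : 1 <= a^-1 ^+ K by rewrite exprn_ege1 // invf_ge1 // ltW.
pose k0 : I := inl ord0; exists (pqcoef P Q k0 / lam k0).
have lam0 k : lam k != 0 by apply: lweight_neq0; apply: natx_inj; exact: expo_inj.
suff H k : exists y, 1 <= y <= a^-1 ^+ K /\
    pqcoef P Q k = pqcoef P Q k0 / lam k0 * lam k * y.
  by have [y Hy] := choice H; exists y => k; have [] := Hy k.
have [->|kk0] := eqVneq k k0.
  by exists 1; rewrite lexx aV mulr1 divfK.
have kk0' : k0 != k by rewrite eq_sym.
have := two_terms (expo_inj p2) a0 kk0'; rewrite card_expo => /(_ _ _ FR).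
move=> [xi /andP[axi xi1]]; rewrite {2}/k0 /= muln0 expr0 mulr1 => ->.
have xi0 := lt_le_trans a0 axi.
exists (xi^-1 ^+ expo p k); split.
  apply/andP; split; first by rewrite exprn_ege1 // invf_ge1.
  apply: (@le_trans _ _ (a^-1 ^+ expo p k)).
    by rewrite lerXn2r ?nnegrE ?invr_ge0 ?(ltW xi0) ?(ltW a0) // lef_pV2.
  by rewrite ler_weXn2l ?expo_le // invf_ge1 // ltW.
have xin : xi ^+ expo p k != 0 by rewrite expf_neq0 // gt_eqF.
have := lam0 k; rewrite /lam exprVn -[fun k => (expo p k)%:R]/x => lk.
by field; rewrite xin lk.
Qed.

(** The relative error is [S1 / ((m + l + 1)! S2)] times the monic polynomial [w] which
vanishes at the [m + l + 1] zeros of the defect, with [S1] close to 1 and [S2]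
close to [q0]. *)
Lemma error_representation : exists w : {poly R},
  [/\ size w = N1.+1, w \is monic & forall t, a <= t <= 1 -> exists S1 S2 : R,
   [/\ `|S1 - 1| <= kappa a * \sum_k `|A1 k|,
       `|S2 - q0| <= kappa a * \sum_(j < l.+1) `|lam (inr j)| &
       F.[t] * (N1`!%:R * S2) = w.[t] * S1 * (t * Q.[t ^+ p])]].
Proof.
have [sP sQ] := (eq_sizeP eqs, eq_sizeQ eqs).
have Fs : F = \sum_(k : I) pqcoef P Q k *: 'X^(expo p k) by apply: defect_sum; rewrite ?sP ?sQ.
have [s [ss sN Hs]] := eq_roots eqs.
have [mu [y yK cy]] := coef_ratios.
exists (\prod_(r <- s) ('X - r%:P)); split.
- by rewrite size_prod_XsubC sN.
- exact: monic_prod_XsubC.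
move=> t t1; have [eta eta1] := interpolation_error ss Hs t1.
rewrite sN -/N1 => FE.
pose S1 := \sum_k A1 k * (y k * eta ^+ (expo p k - N1)).
pose S2 := - \sum_(j < l.+1) lam (inr j) * (y (inr j) * t ^+ (p * j).+1).
exists S1, S2; split.
- rewrite -[X in S1 - X]sum_A1; apply: weighted_sum_dev => k.
  by apply: power_dev; rewrite // (leq_trans (leq_subr _ _)) // expo_le.
- rewrite /S2 /q0 -opprB opprK normrN addrC; apply: weighted_sum_dev => j.
  by apply: power_dev => //; exact: (expo_le (inr j)).
have dF : F^`(N1).[eta] = mu * S1.
  rewrite Fs linear_sum horner_sum /S1 mulr_sumr; apply: eq_bigr => k _.
  rewrite [LHS](_ : _ = (pqcoef P Q k *: 'X^(expo p k))^`(N1).[eta]) //.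
  rewrite derivnZ derivnXn hornerZ hornerMn hornerXn cy /A1 -mulr_natr; ring.
have tQ : t * Q.[t ^+ p] = mu * S2.
  rewrite (@horner_coef_wide _ l.+1) ?sQ // /S2 mulrN !mulr_sumr -sumrN; apply: eq_bigr => j _.
  rewrite -exprM; have := cy (inr j); rewrite /= => /(canRL opprK) ->.
  by rewrite exprS; ring.
rewrite mulrA FE dF tQ; ring.
Qed.

End Fixed.
End Asymptotics.

(** * Comparison of the best error with the Chebyshev bound *)

Section ErrorAsymptotics.
Context {R : realType}.
Implicit Types (P Q w : {poly R}) (a t : R).
Variables (m l p : nat).
Hypothesis p2 : (1 < p)%N.

Local Notation N1 := (m + l).+1.
Local Notation lam := (lweight (fun k : 'I_m.+1 + 'I_l.+1 => (expo p k)%:R : R)).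
Local Notation q0 := (- \sum_(j < l.+1) lam (inr j)).
Local Notation theta0 := ((N1`!%:R * q0)^-1).
Local Notation defect P Q := (P \Po 'X^p - 'X * (Q \Po 'X^p)).

Lemma normr_theta0 : `|theta0| = cheb_const m l p.
Proof.
have c0 := @cheb_const_gt0 R m l p p2.
have f0 : N1`!%:R != 0 :> R by rewrite pnatr_eq0 -lt0n fact_gt0.
rewrite normfV normrM normrN cheb_constE // normr_nat invfM invrK mulrA mulVf //.
by rewrite mul1r.
Qed.

(** A quotient of perturbed quantities, with an error linear in [kap]. *)
Lemma quotient_dev (A1 A2 kap S1 S2 q : R) : q != 0 -> 0 <= A1 -> 0 <= A2 -> 0 <= kap ->
  kap * A2 <= `|q| / 2 -> `|S1 - 1| <= kap * A1 -> `|S2 - q| <= kap * A2 ->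
  S2 != 0 /\ `|S1 / S2 - q^-1| <= kap * ((A1 * `|q| + A2) * 2 / `|q| ^+ 2).
Proof.
move=> q0 A10 A20 kap0 small d1 d2.
have nq : 0 < `|q| by rewrite normr_gt0.
have S2l : `|q| / 2 <= `|S2|.
  have := lerB_dist q (q - S2); rewrite opprB addrCA subrr addr0.
  rewrite distrC in d2; lra.
have S20 : S2 != 0.
  by rewrite -normr_gt0 (lt_le_trans _ S2l) // divr_gt0.
split=> //.
have -> : S1 / S2 - q^-1 = ((S1 - 1) * q - (S2 - q)) / (S2 * q) by field; rewrite S20 q0.
rewrite normrM normfV normrM ler_pdivrMr ?mulr_gt0 ?normr_gt0 //.
have h1 : `|(S1 - 1) * q - (S2 - q)| <= kap * (A1 * `|q| + A2).
  rewrite (le_trans (ler_normB _ _)) // normrM mulrDr mulrA lerD // ler_wpM2r //.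
apply: (le_trans h1); set X := A1 * _ + _.
have -> : kap * (X * 2 / `|q| ^+ 2) * (`|S2| * `|q|) = kap * X * (`|S2| / (`|q| / 2)).
  by field; rewrite gt_eqF.
have X0 : 0 <= kap * X by rewrite mulr_ge0 // addr_ge0 // mulr_ge0.
by rewrite ler_peMr // ler_pdivlMr ?divr_gt0 // mul1r.
Qed.

(** The relative error is [th * w] with [w] monic of degree [m + l + 1] and [th] close
to [theta0], of the same sign, uniformly in [a]. *)
Lemma uniform_representation : exists B k0 : R, [/\ 0 < B, 0 < k0 &
  forall a P Q, 0 < a < 1 -> equioscillating m l p a P Q -> kappa m l p a <= k0 ->
  B * kappa m l p a < cheb_const m l p /\ exists w : {poly R},
  [/\ size w = N1.+1, w \is monic & forall t, a <= t <= 1 -> exists2 th : R,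
    `|th - theta0| <= B * kappa m l p a &
    (defect P Q).[t] = th * w.[t] * (t * Q.[t ^+ p])]].
Proof.
have c0 := @cheb_const_gt0 R m l p p2.
have f0 : 0 < N1`!%:R :> R by rewrite ltr0n fact_gt0.
have q00 : q0 != 0.
  apply/eqP => q0z; have := normr_theta0; rewrite q0z mulr0 invr0 normr0 => e.
  by rewrite -e ltxx in c0.
pose S (k : 'I_m.+1 + 'I_l.+1) := `|lam k * (expo p k ^_ N1)%:R|.
pose A1 := \sum_k S k; pose A2 := \sum_(j < l.+1) `|lam (inr j)|.
have A10 : 0 <= A1 by apply: sumr_ge0 => k _; exact: normr_ge0.
have A20 : 0 <= A2 by apply: sumr_ge0 => k _; exact: normr_ge0.
have nq : 0 < `|q0| by rewrite normr_gt0.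
pose B := (A1 * `|q0| + A2) * 2 / `|q0| ^+ 2 / N1`!%:R + 1.
have B0' : 0 <= (A1 * `|q0| + A2) * 2 / `|q0| ^+ 2 / N1`!%:R.
  by rewrite !divr_ge0 // mulr_ge0 // addr_ge0 // mulr_ge0.
have B0 : 0 < B by rewrite ltr_wpDl.
pose k0 := Num.min (cheb_const m l p / (2 * B)) (`|q0| / 2 / (A2 + 1)).
exists B, k0; split=> //.
  have A21 : 0 < A2 + 1 by rewrite ltr_wpDl.
  by rewrite lt_min; apply/andP; split; apply: divr_gt0 => //;
    [exact: mulr_gt0 | exact: divr_gt0].
move=> a P Q a01 eqs; rewrite le_min => /andP[kB kA].
have /andP[a0 a1] := a01.
have kap0 : 0 <= kappa m l p a.
  by rewrite subr_ge0 exprn_ege1 // invf_ge1 // ltW.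
split.
  move: kB; rewrite ler_pdivlMr ?mulr_gt0 // mulrA mulrAC -mulrA => kB.
  rewrite mulrC; lra.
have [w [sw mw Hw]] := error_representation p2 a01 eqs.
exists w; split=> // t t1; have [S1 [S2 [d1 d2 e]]] := Hw _ t1.
have small : kappa m l p a * A2 <= `|q0| / 2.
  move: kA; rewrite ler_pdivlMr ?ltr_wpDl // mulrDr mulr1; lra.
have [S20 dq] := quotient_dev q00 A10 A20 kap0 small d1 d2.
exists (S1 / S2 / N1`!%:R).
  rewrite invfM [_^-1 / _]mulrC -mulrBl normrM [`|(_`!%:R)^-1|]gtr0_norm ?invr_gt0 //.
  rewrite (@le_trans _ _ (kappa m l p a * ((A1 * `|q0| + A2) * 2 / `|q0| ^+ 2) / N1`!%:R)) //.
    by rewrite ler_wpM2r // ltW // invr_gt0.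
  by rewrite -mulrA mulrC ler_wpM2r // lerDl.
have NS : N1`!%:R * S2 != 0 by rewrite mulf_neq0 // gt_eqF.
apply: (mulIf NS); rewrite e; field.
by rewrite S20 gt_eqF.
Qed.

(** The lower bound for the best error comes from the minimality of Chebyshev
polynomials, the upper bound from the alternation of [w] at the extremal points. *)
Lemma best_err_bounds : exists B k0 : R, [/\ 0 < B, 0 < k0 &
  forall a, 0 < a < 1 -> kappa m l p a <= k0 ->
  `|best_err m l (proot p) (zitv p a) - cheb_const m l p * chebM a 1 N1|
    <= B * kappa m l p a * chebM a 1 N1].
Proof.
have [B [k0 [B0 k00 H]]] := uniform_representation.
exists B, k0; split=> // a a01 kk; have /andP[a0 a1] := a01.
have [r best] := @best_approx_exists R m l p a (ltnW p2) a01.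
have [sg [P [Q [_ _ eqs]]]] := best_approx_equioscillates p2 a01 best.
have [small [w [sw mw Hw]]] := H a P Q a01 eqs kk.
set E := best_err _ _ _ _; set M := chebM _ _ _.
have M0 : 0 <= M by rewrite mulr_ge0 // exprn_ge0 // divr_ge0 // subr_ge0 ltW.
have tQ t : a <= t <= 1 -> 0 < t * Q.[t ^+ p].
  move=> t1; rewrite mulr_gt0 ?(eq_Qpos eqs) //.
  by case/andP: t1 => at_ _; exact: lt_le_trans a0 at_.
have hF t : (defect P Q).[t] = P.[t ^+ p] - t * Q.[t ^+ p].
  by rewrite hornerD hornerN hornerM hornerX !horner_comp_exp.
have thb th : `|th - theta0| <= B * kappa m l p a ->
    cheb_const m l p - B * kappa m l p a <= `|th| <= cheb_const m l p + B * kappa m l p a.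
  move=> d; rewrite -normr_theta0; apply/andP; split.
    by rewrite lerBlDr addrC -lerBlDr; apply: le_trans (lerB_dist _ _) _; rewrite distrC.
  by rewrite addrC -lerBlDr; apply: le_trans (lerB_dist _ _) _.
rewrite ler_norml; apply/andP; split.
  have [t t1 wM] := cheb_lower a1 sw mw.
  have [th /thb/andP[th1 _] e] := Hw _ t1.
  have := eq_within eqs t1; rewrite -hF e (gtr0_norm (eq_Qpos eqs t1)) normrM (gtr0_norm (tQ _ t1)).
  rewrite ler_pM2r ?tQ // normrM -/E => le.
  have : (cheb_const m l p - B * kappa m l p a) * M <= `|th| * `|w.[t]|.
    by rewrite ler_pM // subr_ge0 ltW.
  move: le; nra.
have [s [ss ps Hs]] := eq_alt eqs.
have pw : path (alternates w) a s.
  apply: (sub_in_path (P := mem (a :: s))) ps; last by apply/allP.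
  move=> x y /Hs[x1 _] /Hs[y1 _] /andP[xy]; rewrite /alternates xy /=.
  have [u du ->] := Hw _ x1; have [v dv ->] := Hw _ y1.
  have uv : 0 < u * v.
    have : `|u - theta0| < `|theta0| by rewrite normr_theta0 (le_lt_trans du).
    have : `|v - theta0| < `|theta0| by rewrite normr_theta0 (le_lt_trans dv).
    move: theta0 => th; rewrite !ltr_norml.
    have [th0|th0] := ltP 0 th.
      by rewrite gtr0_norm // => /andP[v1 v2] /andP[u1 u2]; rewrite mulr_gt0 //; lra.
    by rewrite ler0_norm // => /andP[v1 v2] /andP[u1 u2]; rewrite nmulr_rgt0; lra.
  have prod6 (b1 b2 b3 c1 c2 c3 : R) :
      b1 * b2 * b3 * (c1 * c2 * c3) = b1 * c1 * (b3 * c3) * (b2 * c2) by ring.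
  rewrite prod6.
  by rewrite pmulr_rlt0 // mulr_gt0 // mulr_gt0 ?tQ.
have [t ts wM] := cheb_upper a1 sw mw ss pw (fun t ts => (Hs t ts).1).
have [t1 e] := Hs _ ts.
have [th /thb/andP[_ th1] e2] := Hw _ t1.
move: e; rewrite -hF e2 normrM (gtr0_norm (tQ _ t1)) => /(mulIf (lt0r_neq0 (tQ _ t1))).
rewrite normrM -/E => <-.
have : `|th| * `|w.[t]| <= (cheb_const m l p + B * kappa m l p a) * M by rewrite ler_pM.
lra.
Qed.

End ErrorAsymptotics.

(** * The function h and the recursion for alpha *)

Section Iteration.
Context {R : realType}.
Implicit Types (P Q w : {poly R}) (a t e : R).
Variables (m l p : nat).
Hypothesis p2 : (1 < p)%N.

Local Notation E a := (best_err m l (proot p) (zitv p a)).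

(** The expansion of the best error on the interval of parameter
[a = (1 - e) / (1 + e)], for which [(1 - a) / 4 = e / (2 (1 + e))]. *)
Lemma best_err_asymptotic (eta : R) : 0 < eta -> exists2 d : R, 0 < d < 1 &
  forall e, 0 < e < d -> `|E ((1 - e) / (1 + e)) - rate_const m l p * e ^+ (m + l + 1)|
     <= eta * e ^+ (m + l + 1).
Proof.
move=> eta0; have [B [k0 [B0 k00 H]]] := @best_err_bounds R m l p p2.
have c0 := @cheb_const_gt0 R m l p p2; set c := cheb_const m l p in c0 H *.
set K := (p * (m + l)).+1; set N1 := (m + l).+1.
pose hk : {poly R} := 2 ^+ K *: ((1 + 'X) ^+ K - (1 - 'X) ^+ K).
pose hu : {poly R} := (1 + 'X) ^+ N1 - 1.
pose h := B *: hk + c *: hu.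
have hp (k : nat) (e : R) : ((1 + 'X) ^+ k).[e] = (1 + e) ^+ k.
  by rewrite horner_exp hornerD hornerX -(polyC1 R) hornerC.
have hm (k : nat) (e : R) : ((1 - 'X) ^+ k).[e] = (1 - e) ^+ k.
  by rewrite horner_exp hornerD hornerN hornerX -(polyC1 R) hornerC.
have hkE e : hk.[e] = 2 ^+ K * ((1 + e) ^+ K - (1 - e) ^+ K).
  by rewrite hornerZ hornerD hornerN hp hm.
have huE e : hu.[e] = (1 + e) ^+ N1 - 1.
  by rewrite hornerD hornerN hp -(polyC1 R) hornerC.
have hk0 : hk.[0] = 0 by rewrite hkE subr0 addr0 subrr mulr0.
have hu0 : hu.[0] = 0 by rewrite huE addr0 expr1n subrr.
have hE0 e : h.[e] = B * hk.[e] + c * hu.[e] by rewrite hornerD (hornerZ B hk) (hornerZ c hu).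
have h0 : h.[0] = 0 by rewrite hE0 hk0 hu0 !mulr0 addr0.
have [d1 d10 D1] := @poly_cont R 0 hk k0 k00.
have [d2 d20 D2] := @poly_cont R 0 h eta eta0.
(* hk bounds kappa when e <= 1/2, and h bounds the total relative error; both are
   polynomials in e vanishing at 0. *)
exists (Num.min (2^-1) (Num.min d1 d2)).
  rewrite !lt_min d10 d20 invr_gt0 ltr0n /= gt_min; apply/orP; left.
  by rewrite invf_lt1 ?ltr1n.
move=> e /andP[e0]; rewrite !lt_min => /and3P[eh ed1 ed2].
have e1 : e < 1 by rewrite (lt_trans eh) // invf_lt1 ?ltr1n.
set a := (1 - e) / (1 + e).
have me0 : 0 < 1 - e by rewrite subr_gt0.
have pe0 : 0 < 1 + e by rewrite addr_gt0.
have a01 : 0 < a < 1.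
  by rewrite divr_gt0 //= ltr_pdivrMr // mul1r; lra.
have kapE : kappa m l p a <= hk.[e].
  rewrite /kappa hkE -/K /a invf_div expr_div_n.
  set u := (1 - e) ^+ K; set v := (1 + e) ^+ K.
  have u0 : 0 < u by rewrite exprn_gt0.
  have uv : u <= v by rewrite lerXn2r ?nnegrE ?(ltW me0) ?(ltW pe0) //; lra.
  have u2 : 1 <= 2 ^+ K * u.
    by rewrite -exprMn exprn_ege1 //; move: eh; rewrite -[2^-1]mul1r ltr_pdivlMr //; lra.
  rewrite (_ : v / u - 1 = (v - u) / u); last by field; exact: lt0r_neq0.
  by rewrite ler_pdivrMr // mulrAC ler_peMl // subr_ge0.
have kap0 : 0 <= kappa m l p a.
  by case/andP: a01 => a0 a1; rewrite subr_ge0 exprn_ege1 // invf_ge1 // ltW.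
have kk0 : kappa m l p a <= k0.
  apply: (le_trans kapE); have := D1 e; rewrite subr0 gtr0_norm // hk0 subr0 => /(_ ed1).
  by move=> /ltW; apply: le_trans (ler_norm _).
have hE : h.[e] <= eta.
  have := D2 e; rewrite subr0 gtr0_norm // h0 subr0 => /(_ ed2) /ltW.
  by apply: le_trans (ler_norm _).
have := H a a01 kk0; set M := chebM _ _ _.
pose u := (1 + e) ^- N1.
have pN : 1 <= (1 + e) ^+ N1 by rewrite exprn_ege1 // lerDl ltW.
have u0 : 0 < u by rewrite invr_gt0 exprn_gt0.
have u1 : u <= 1 by rewrite invf_le1 // exprn_gt0.
have ME : M = e ^+ N1 / 2 ^+ (m + l) * u.
  rewrite /M /chebM (_ : (1 - a) / 4 = e / 2 / (1 + e)); last first.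
    by rewrite /a; field; rewrite gt_eqF.
  rewrite !expr_div_n (_ : 2 ^+ N1 = 2 * 2 ^+ (m + l)); last by rewrite -exprS.
  have v0 : (1 + e) ^+ N1 != 0 by rewrite expf_neq0 // gt_eqF.
  have t0 : 2 ^+ (m + l) != 0 :> R by rewrite expf_neq0.
  have alg (x1 x2 x3 : R) : x2 != 0 -> x3 != 0 -> 2 * (x1 / (2 * x3) / x2) = x1 / x3 * x2^-1.
    by move=> x20 x30; field; rewrite x20 x30.
  exact: alg.
rewrite rate_constE -/c addn1 -/N1; set X := e ^+ N1 / 2 ^+ (m + l) in ME.
have X0 : 0 <= X by rewrite divr_ge0 ?exprn_ge0 // ltW.
have Xe : X <= e ^+ N1.
  rewrite ler_piMr ?exprn_ge0 ?(ltW e0) // invf_le1 ?exprn_gt0 //.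
  by rewrite exprn_ege1 // ler1n.
have uE : 1 - u <= hu.[e].
  rewrite huE /u; set v := _ ^+ N1 in pN *.
  have v0 : 0 < v by rewrite (lt_le_trans ltr01).
  rewrite (_ : 1 - v^-1 = (v - 1) / v); last by field; exact: lt0r_neq0.
  by rewrite ler_pdivrMr // ler_peMr // subr_ge0.
have hX : X * (B * kappa m l p a + c * (1 - u)) <= eta * e ^+ N1.
  apply: (@le_trans _ _ (X * eta)); last by rewrite mulrC ler_wpM2l // ltW.
  apply: ler_wpM2l => //; apply: le_trans hE.
  by rewrite hE0 lerD // ler_wpM2l // ltW.
have cX : c / 2 ^+ (m + l) * e ^+ N1 = c * X by rewrite /X; ring.
rewrite cX ME => HE.
apply: le_trans hX.
rewrite (_ : E a - c * X = (E a - c * (X * u)) - c * X * (1 - u)); last by ring.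
apply: (le_trans (ler_normB _ _)); rewrite [leRHS]mulrDr; apply: lerD.
  apply: (le_trans HE); rewrite mulrCA mulrA.
  by rewrite ler_piMr // (mulr_ge0 X0 (mulr_ge0 (ltW B0) kap0)).
have u1' : 0 <= 1 - u by rewrite subr_ge0.
by rewrite (ger0_norm (mulr_ge0 (mulr_ge0 (ltW c0) X0) u1')) (mulrC c) -mulrA.
Qed.

Section Fixed.
Variable a : R.
Hypothesis a01 : 0 < a < 1.
Let a0 : 0 < a. Proof. by case/andP: a01. Qed.
Let a1 : a < 1. Proof. by case/andP: a01. Qed.

Lemma best_err_gt0 : 0 < E a.
Proof.
have [r best] := @best_approx_exists R m l p a (ltnW p2) a01.
have [sg [P [Q [_ _ eqs]]]] := best_approx_equioscillates p2 a01 best.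
exact: eq_Epos eqs.
Qed.

(** A constant does not have full degrees unless [m = l = 0]. *)
Lemma best_err_lt_const : (m, l) != (0%N, 0%N) -> E a < (1 - a) / (1 + a).
Proof.
move=> ml; rewrite lt_neqAle best_err_le_const ?(ltnW p2) // andbT.
apply: contra ml => /eqP Ee; set c := 2 * a / (1 + a).
have c0 : c != 0 by rewrite gt_eqF // divr_gt0 ?mulr_gt0 ?addr_gt0.
have best : is_best_approx m l (proot p) (zitv p a) (c%:P, 1).
  split.
    split=> /=; [by rewrite size_polyC c0 | by rewrite size_poly1 |
      exact: coprimep1 | exact: monic1].
  move=> s st; rewrite (@le_trans _ _ (E a)%:E) //.
    apply/(max_rel_errP _ _ (ltnW p2) a0); split => [t _|].
      by rewrite /= hornerC oner_neq0.
    by rewrite Ee; exact: within_const a01.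
  rewrite -(best_err_ereal m l (ltnW p2) a01).
  by apply: ge_ereal_inf; exists (max_rel_err s (proot p) (zitv p a)) => //; exists s.
have [sg [P [Q [sg1 [PE QE] eqs]]]] := best_approx_equioscillates p2 a01 best.
have sg0 : sg != 0 by case: sg1 => ->; rewrite ?oppr_eq0 oner_neq0.
have sP : size P = 1%N by rewrite -(size_scale _ sg0) -PE size_polyC c0.
have sQ : size Q = 1%N by rewrite -(size_scale _ sg0) -QE size_poly1.
have := eq_sizeP eqs; have := eq_sizeQ eqs; rewrite sP sQ => -[<-] [<-].
by rewrite eqxx.
Qed.

(** The best approximant scaled so that its smallest relative error is 0. *)
Lemma rhatP : exists c P Q, [/\ c != 0, equioscillating m l p a P Q &
  rhat m l p a = ((c / (1 - E a)) *: P, c *: Q)].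
Proof.
have [r0 best0] := @best_approx_exists R m l p a (ltnW p2) a01.
pose S := zitv p a.
have best : is_best_approx m l (proot p) S (best_approx m l (proot p) S).
  exact: (xgetI (0, 1) best0).
have [sg [P [Q [sg1 rE eqs]]]] := best_approx_equioscillates p2 a01 best.
have sg0 : sg != 0 by case: sg1 => ->; rewrite ?oppr_eq0 oner_neq0.
have E1 : 0 < 1 - E a by rewrite subr_gt0 best_err_lt1 // ltnW.
have Qpos := eq_Qpos eqs.
have tpos t : a <= t <= 1 -> 0 < t by case/andP => + _; exact: lt_le_trans.
have relE (c t : R) : a <= t <= 1 ->
    rel_err (rat_scale c (sg *: P, sg *: Q)) (proot p) (t ^+ p) =
    c * (P.[t ^+ p] / (t * Q.[t ^+ p])) - 1.
  move=> t1; have t0 := tpos _ t1; have q0 := Qpos _ t1.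
  rewrite /rel_err (proot_exp (ltnW p2) (ltW t0)) /rat_eval /= !hornerZ; field.
  by rewrite sg0 !gt_eqF.
have bnd t : a <= t <= 1 -> 1 - E a <= P.[t ^+ p] / (t * Q.[t ^+ p]).
  move=> t1; have t0 := tpos _ t1; have q0 := Qpos _ t1.
  have := eq_within eqs t1; rewrite (gtr0_norm q0) ler_norml => /andP[le _].
  by rewrite ler_pdivlMr ?mulr_gt0 //; move: le; lra.
have [tl tl1 Pl] := eq_low eqs.
have low : P.[tl ^+ p] / (tl * Q.[tl ^+ p]) = 1 - E a.
  by rewrite Pl mulfK // gt_eqF // (mulr_gt0 (tpos _ tl1) (Qpos _ tl1)).
have Sim : S = [set t ^+ p | t in (`[a, 1]%classic : set R)].
  by apply: image_itv_exp => //; exact: ltnW.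
have memS t : a <= t <= 1 -> S (t ^+ p).
  by move=> t1; rewrite Sim; exists t => //=; rewrite in_itv.
have ex : ((exists c, rat_scale (1 - E a)^-1 (sg *: P, sg *: Q) =
      rat_scale c (best_approx m l (proot p) S))
   /\ is_minimum [set rel_err (rat_scale (1 - E a)^-1 (sg *: P, sg *: Q)) (proot p) z | z in S] 0).
  split; first by exists (1 - E a)^-1; rewrite rE.
  split.
    exists (tl ^+ p); first exact: memS.
    by rewrite relE // low mulVf ?subrr // gt_eqF.
  move=> _ [z + <-]; rewrite Sim => -[t + <-]; rewrite /= in_itv /= => t1.
  by rewrite relE // subr_ge0 mulrC ler_pdivlMr // mul1r bnd.
pose good := [set s : @ratfun R |
  (exists c, s = rat_scale c (best_approx m l (proot p) S)) /\
  is_minimum [set rel_err s (proot p) z | z in S] 0].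
have [[c hc] [min1 min2]] : good (rhat m l p a) by exact: (@xgetI _ (0, 1) good _ ex).
rewrite rE in hc.
have cE : c = (1 - E a)^-1.
  case: min1 => z; rewrite Sim hc => -[t + <-]; rewrite /= in_itv /= => t1.
  rewrite relE // => /eqP; rewrite subr_eq0 => /eqP ce.
  have c0 : 0 < c.
    have g0 := lt_le_trans E1 (bnd _ t1).
    by rewrite -(pmulr_lgt0 _ g0) ce.
  have le1 : 1 <= c * (1 - E a).
    have : (0 <= rel_err (rhat m l p a) (proot p) (tl ^+ p)).
      by apply: min2; exists (tl ^+ p) => //; exact: memS.
    by rewrite hc relE // low subr_ge0.
  have le2 : c * (1 - E a) <= 1 by rewrite -[leRHS]ce ler_pM2l // bnd.
  apply: (mulIf (lt0r_neq0 E1)); rewrite mulVf ?gt_eqF //; apply/eqP.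
  by rewrite eq_le le1 le2.
exists sg, P, Q; split => //.
by rewrite hc /rat_scale /= scalerA cE mulrC.
Qed.

(** The map [t |-> t h(t^p)] sends [[a, 1]] into [[(1 - E) / (1 + E), 1]], and [a] to the
left endpoint of this interval. *)
Lemma hfunP :
  (forall t, a <= t <= 1 -> (hfun l m p a).2.[t ^+ p] != 0 /\
     (1 - E a) / (1 + E a) <= t * rat_eval (hfun l m p a) (t ^+ p) <= 1) /\
  a * rat_eval (hfun l m p a) (a ^+ p) = (1 - E a) / (1 + E a).
Proof.
have [c [P [Q [c0 eqs hE]]]] := rhatP.
have E1 : 0 < 1 - E a by rewrite subr_gt0 best_err_lt1 // ltnW.
have E0 := best_err_gt0.
have Qpos := eq_Qpos eqs.
have tpos t : a <= t <= 1 -> 0 < t by case/andP => + _; exact: lt_le_trans.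
have ev t : a <= t <= 1 -> P.[t ^+ p] != 0 -> t * rat_eval (hfun l m p a) (t ^+ p) =
   (1 - E a) * (t * Q.[t ^+ p]) / P.[t ^+ p].
  move=> t1 P0; rewrite /hfun hE /rat_inv /rat_eval /= !hornerZ; field.
  by rewrite c0 P0 gt_eqF.
have bnd t : a <= t <= 1 ->
    (1 - E a) * (t * Q.[t ^+ p]) <= P.[t ^+ p] <= (1 + E a) * (t * Q.[t ^+ p]).
  move=> t1; have := eq_within eqs t1; rewrite (gtr0_norm (Qpos _ t1)) ler_norml.
  by move=> /andP[h1 h2]; apply/andP; split; move: h1 h2; lra.
have tq t : a <= t <= 1 -> 0 < t * Q.[t ^+ p] by move=> t1; exact: mulr_gt0 (tpos _ t1) (Qpos _ t1).
have Ppos t : a <= t <= 1 -> 0 < P.[t ^+ p].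
  by move=> t1; case/andP: (bnd _ t1) => + _; apply: lt_le_trans; rewrite mulr_gt0 ?tq.
split=> [t t1|].
  have P0 := Ppos _ t1; have /andP[b1 b2] := bnd _ t1; split.
    rewrite /hfun hE /rat_inv /= hornerZ; apply: mulf_neq0; last by rewrite gt_eqF.
    by apply: mulf_neq0 => //; rewrite invr_eq0 gt_eqF.
  rewrite ev ?gt_eqF //; apply/andP; split; last by rewrite ler_pdivrMr // mul1r.
  rewrite -[leRHS]mulrA ler_wpM2l ?(ltW E1) // ler_pdivlMr //.
  by rewrite mulrC ler_pdivrMr ?addr_gt0 // mulrC.
have aa : a <= a <= 1 by rewrite lexx ltW.
rewrite ev ?gt_eqF ?Ppos // (eq_left eqs); field.
by rewrite !gt_eqF ?addr_gt0 ?Qpos.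
Qed.

(** Semicontinuity of the best error: a fixed approximant remains good slightly beyond
its interval. *)
Lemma best_err_usc e : E a < e -> exists2 d : R, 0 < d &
  forall b, 0 < b -> a - d < b <= a -> E b <= e.
Proof.
move=> Ee.
have [r0 best0] := @best_approx_exists R m l p a (ltnW p2) a01.
have [[s1 s2 _ mon] q0 W] := best_approxP (ltnW p2) a01 best0.
pose f t := e * (t * `|r0.2.[t ^+ p]|) - `|r0.1.[t ^+ p] - t * r0.2.[t ^+ p]|.
have cX q : continuous (fun t : R => q.[t ^+ p]).
  rewrite (_ : (fun _ => _) = horner (q \Po 'X^p)); first exact: continuous_horner.
  by apply/funext => t; rewrite horner_comp_exp.
have ci : continuous (fun t : R => t) by move=> t; exact: cvg_id.
have fc : continuous f.
  apply: continuousBr.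
    apply: continuousMr; first exact: cst_continuous.
    by apply: continuousMr => //; exact/continuous_normr.
  apply: continuous_normr; apply: continuousBr => //.
  exact: continuousMr.
have aa : a <= a <= 1 by rewrite lexx ltW.
have fa : 0 < f a.
  rewrite subr_gt0; apply: (le_lt_trans (W _ aa)); rewrite ltr_pM2r //.
  by rewrite mulr_gt0 // normr_gt0 q0.
have /nbhs_ballP[d /= d0 dP] : \forall t \near a, 0 < f t.
  exact: (fc a _ (lt_nbhsr fa)).
exists d => // b b0 /andP[db ba].
have b01 : 0 < b < 1 by rewrite b0 (le_lt_trans ba).
apply: (@best_err_le _ m l p b (ltnW p2) b01 e r0.1 r0.2) => //; first exact: monic_neq0.
move=> t /andP[bt t1]; have [ta|at_] := ltP t a.
  have tball : ball a d t by rewrite /ball /= gtr0_norm ?subr_gt0 //; lra.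
  have ft : 0 < f t := dP t tball.
  by rewrite -subr_ge0 ltW.
apply: (@le_trans _ _ (E a * (t * `|r0.2.[t ^+ p]|))); first by apply: W; rewrite at_.
by rewrite ler_wpM2r ?(ltW Ee) // mulr_ge0 // (le_trans (ltW b0)).
Qed.

End Fixed.
End Iteration.

(** * The sequences alpha and epsilon *)

Section Sequences.
Context {R : realType}.
Variables (m l p : nat) (alpha : R) (al eps : nat -> R).
Hypotheses (p2 : (1 < p)%N) (alpha01 : 0 < alpha < 1) (ml0 : (m, l) != (0%N, 0%N)).
Hypotheses (al0 : al 0%N = alpha)
  (alS : forall k, al k.+1 = al k * rat_eval (hfun l m p (al k)) (al k ^+ p))
  (eps0 : eps 0%N = (1 - alpha) / (1 + alpha))
  (epsS : forall k, eps k.+1 = best_err m l (proot p) (zitv p ((1 - eps k) / (1 + eps k)))).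

(** The map [a |-> (1 - a) / (1 + a)] is an involution. *)
Lemma cayley_inv (a : R) : 0 < a -> (1 - (1 - a) / (1 + a)) / (1 + (1 - a) / (1 + a)) = a.
Proof.
move=> a0; field; have h : 1 + a != 0 by rewrite gt_eqF // addr_gt0.
by rewrite h (_ : 1 + a + (1 - a) = 2) ?pnatr_eq0 //; ring.
Qed.

Lemma al_eps k : 0 < al k < 1 /\ eps k = (1 - al k) / (1 + al k).
Proof.
elim: k => [|k [alk ek]]; first by rewrite al0 eps0.
have /andP[a0 a1] := alk.
have eE : eps k.+1 = best_err m l (proot p) (zitv p (al k)).
  by rewrite epsS ek cayley_inv.
have E0 := best_err_gt0 m l p2 alk.
have E1 := best_err_lt1 m l (ltnW p2) alk.
have aE : al k.+1 = (1 - eps k.+1) / (1 + eps k.+1).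
  by rewrite alS eE (hfunP m l p2 alk).2.
rewrite -eE in E0 E1; rewrite aE cayley_inv //; split=> //.
by rewrite divr_gt0 ?subr_gt0 ?addr_gt0 //= ltr_pdivrMr ?addr_gt0 // mul1r; lra.
Qed.

Lemma eps_best_err k : eps k.+1 = best_err m l (proot p) (zitv p (al k)).
Proof.
by have [/andP[a0 _] ek] := al_eps k; rewrite epsS ek cayley_inv.
Qed.

Lemma alE k : al k = (1 - eps k) / (1 + eps k).
Proof. by have [/andP[a0 _] ek] := al_eps k; rewrite ek cayley_inv. Qed.

Lemma eps01 k : 0 < eps k < 1.
Proof.
have [/andP[a0 a1] ->] := al_eps k.
by rewrite divr_gt0 ?subr_gt0 ?addr_gt0 //= ltr_pdivrMr ?addr_gt0 // mul1r; lra.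
Qed.

Lemma eps_dec k : eps k.+1 < eps k.
Proof.
rewrite eps_best_err; have [a01 ->] := al_eps k.
exact: best_err_lt_const.
Qed.

(** The sequence decreases to some [L >= 0].  If [L > 0], the best error on the interval
of parameter [(1 - L) / (1 + L)] is less than [L]; by semicontinuity so is some
[eps k.+1], a contradiction. *)
Lemma eps_cvg0 : eps @ \oo --> (0 : R).
Proof.
have dec : nonincreasing_seq eps.
  by apply/nonincreasing_seqP => k; exact/ltW/eps_dec.
have lb : has_lbound (range eps).
  by exists 0 => _ [k _ <-]; case/andP: (eps01 k) => /ltW.
have cv := nonincreasing_is_cvgn dec lb.
suff -> : 0 = limn eps by [].
set L := limn eps; apply/eqP; rewrite eq_le; apply/andP; split.
  by apply: limr_ge => //; apply: nearW => k; case/andP: (eps01 k) => /ltW.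
rewrite leNgt; apply/negP => L0.
have Le k : L <= eps k by exact: nonincreasing_cvgn_ge.
have L1 : L < 1 by apply: le_lt_trans (Le 0%N) _; case/andP: (eps01 0).
pose a := (1 - L) / (1 + L).
have L10 : 0 < 1 + L by rewrite addr_gt0.
have a01 : 0 < a < 1.
  by rewrite divr_gt0 ?subr_gt0 //= ltr_pdivrMr // mul1r; lra.
have EL : best_err m l (proot p) (zitv p a) < L.
  have := best_err_lt_const p2 a01 ml0; rewrite (_ : (1 - a) / (1 + a) = L) //.
  exact: cayley_inv.
set E := best_err _ _ _ _ in EL.
have Ee : E < (E + L) / 2 by rewrite ltr_pdivlMr //; lra.
have eL : (E + L) / 2 < L by rewrite ltr_pdivrMr //; lra.
have [d d0 H] := best_err_usc p2 a01 Ee.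
have d20 : 0 < d / 2 by rewrite divr_gt0.
have [k ek] : exists k, eps k < L + d / 2.
  have /cvgrPdist_lt/(_ _ d20)[N _ HN] := cv.
  exists N; have := HN N (leqnn N); rewrite -/L /= ltr_distlC => /andP[_]; exact.
have [/andP[b0 b1] _] := al_eps k.
have bE := alE k.
have ek1 : 0 < 1 + eps k by rewrite addr_gt0 //; case/andP: (eps01 k).
have ba : a - al k = 2 * (eps k - L) / ((1 + L) * (1 + eps k)).
  by rewrite bE /a; field; rewrite !gt_eqF.
have den : 1 <= (1 + L) * (1 + eps k).
  have := Le k; nra.
have := H (al k) b0; rewrite -eps_best_err.
have bnd : a - d < al k <= a.
  have e0 := Le k.
  have den0 : 0 < (1 + L) * (1 + eps k) by rewrite mulr_gt0.
  have q0 : 0 <= a - al k by rewrite ba divr_ge0 ?(ltW den0) // mulr_ge0 // subr_ge0.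
  have q1 : a - al k < d.
    rewrite ba ltr_pdivrMr //; apply: (@lt_le_trans _ _ d); first by lra.
    by rewrite ler_peMr // ltW.
  by apply/andP; split; lra.
by move=> /(_ bnd) h; have := Le k.+1; rewrite leNgt (le_lt_trans h eL).
Qed.

Local Notation q := (m + l + 1)%N.

Lemma eps_rate (eta : R) : 0 < eta -> \forall k \near \oo,
  `|eps k.+1 - rate_const m l p * eps k ^+ q| <= eta * `|eps k ^+ q|.
Proof.
move=> /(@best_err_asymptotic R m l p p2)[d /andP[d0 _] H].
have := eps_cvg0 => /cvgrPdist_lt/(_ d d0)[N _ HN]; exists N => // k /HN /=.
have /andP[e0 e1] := eps01 k; rewrite sub0r normrN gtr0_norm // => ed.
rewrite eps_best_err alE (ger0_norm (exprn_ge0 _ (ltW e0))).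
by apply: H; rewrite e0.
Qed.

Lemma eps_littleo :
  (fun k => eps k.+1 - rate_const m l p * eps k ^+ q) =o_\oo (fun k => eps k ^+ q).
Proof. by apply/eqoP => eta eta0; exact: eps_rate. Qed.

Lemma eps_bigO : (fun k => eps k.+1) =O_\oo (fun k => eps k ^+ q).
Proof.
apply/eqO_exP; exists (`|rate_const m l p| + 1); first exact: ltr_wpDl.
have := eps_rate ltr01; apply: filterS => k /= H.
rewrite mulrDl mul1r -normrM.
rewrite -[eps k.+1](subrK (rate_const m l p * eps k ^+ q)) addrC.
apply: (le_trans (ler_normD _ _)); rewrite lerD2l.
by move: H; rewrite mul1r.
Qed.

End Sequences.

(** * Functional calculus in a unitary basis *)

Local Open Scope complex_scope.

Section DiagonalConjugates.
Context {F : fieldType} {n : nat}.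
Variable (U : 'M[F]_n.+1).
Hypothesis Uu : U \in unitmx.
Implicit Types (d e : 'I_n.+1 -> F).

(** The matrix with eigenvalues [d] in the basis formed by the rows of [U]. *)
Definition diagconj d : 'M[F]_n.+1 := invmx U *m diag_mx (\row_i d i) *m U.

Lemma eq_diagconj d e : d =1 e -> diagconj d = diagconj e.
Proof. by move=> de; congr (_ *m diag_mx _ *m _); apply/rowP => i; rewrite !mxE de. Qed.

Lemma diagconjM d e : diagconj d * diagconj e = diagconj (fun i => d i * e i).
Proof.
rewrite /diagconj -[LHS]/(_ *m _) !mulmxA mulmxK // -(mulmxA _ (diag_mx _) (diag_mx _)) mulmx_diag.
by congr (_ *m diag_mx _ *m _); apply/rowP => i; rewrite !mxE.
Qed.

Lemma diagconjD d e : diagconj d + diagconj e = diagconj (fun i => d i + e i).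
Proof.
rewrite /diagconj -mulmxDl -mulmxDr -linearD; congr (_ *m diag_mx _ *m _).
by apply/rowP => i; rewrite !mxE.
Qed.

Lemma diagconj_const (c : F) : diagconj (fun=> c) = c%:M.
Proof.
rewrite /diagconj (_ : \row__ _ = const_mx c); last by apply/rowP => i; rewrite !mxE.
by rewrite diag_const_mx -mulmxA mul_scalar_mx -scalemxAr mulVmx // scalemx1.
Qed.

End DiagonalConjugates.

Lemma two_sided_inverse (T : unitRingType) (x y : T) : x * y = 1 -> y * x = 1 ->
  x \is a GRing.unit /\ x^-1 = y.
Proof.
move=> xy yx; have u : x \is a GRing.unit by apply/unitrP; exists y.
by split=> //; apply: (mulrI u); rewrite mulrV // xy.
Qed.

Section SpectralCalculus.
Context {R : realType} {n : nat}.
Variable (P : 'M[R[i]]_n.+1).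
Hypothesis Pu : P \is unitarymx.
Implicit Types (f g : 'I_n.+1 -> R).

(** The Hermitian matrix with real eigenvalues [f] in the basis formed by the rows of
the unitary matrix [P]. *)
Definition spec f : 'M[R[i]]_n.+1 := diagconj P (fun i => (f i)%:C).

Let Pi : P \in unitmx. Proof. exact: unitarymx_unit. Qed.

Lemma spec_ext f g : f =1 g -> spec f = spec g.
Proof. by move=> fg; apply: eq_diagconj => i; rewrite fg. Qed.

Lemma specM f g : spec f * spec g = spec (fun i => f i * g i).
Proof. rewrite /spec (diagconjM Pi); apply: eq_diagconj => i; exact/esym/rmorphM. Qed.

Lemma specD f g : spec f + spec g = spec (fun i => f i + g i).
Proof. rewrite /spec diagconjD; apply: eq_diagconj => i; exact/esym/rmorphD. Qed.

Lemma specC (c : R) : spec (fun=> c) = (c%:C)%:M.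
Proof. exact: diagconj_const. Qed.

Lemma spec1 : spec (fun=> 1) = 1.
Proof. by rewrite specC. Qed.

Lemma specZ (c : R) f : c%:C *: spec f = spec (fun i => c * f i).
Proof. by rewrite -specM specC -[RHS]/(_ *m _) mul_scalar_mx. Qed.

Lemma specN f : - spec f = spec (fun i => - f i).
Proof.
rewrite -scaleN1r -[-1]/(- 1%:C) -rmorphN specZ.
by apply: spec_ext => i; rewrite mulN1r.
Qed.

Lemma specX f k : spec f ^+ k = spec (fun i => f i ^+ k).
Proof.
elim: k => [|k IH]; first by rewrite expr0 -spec1; exact: spec_ext.
by rewrite exprS IH specM; apply: spec_ext => i; rewrite exprS.
Qed.

Lemma spec_unit f : (forall i, f i != 0) ->
  spec f \is a GRing.unit /\ (spec f)^-1 = spec (fun i => (f i)^-1).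
Proof.
move=> f0; apply: two_sided_inverse; rewrite specM -spec1; apply: spec_ext => i.
  by rewrite divff.
by rewrite mulVf.
Qed.

Lemma spec_poly (q : {poly R}) f : poly_eval_mx q (spec f) = spec (fun i => q.[f i]).
Proof.
rewrite /poly_eval_mx; elim/poly_ind: q => [|q c IH].
  rewrite rmorph0 rmorph0 -[RHS](_ : spec (fun=> 0) = _).
    by rewrite specC; apply/matrixP => i j; rewrite !mxE mul0rn.
  by apply: spec_ext => i; rewrite horner0.
rewrite rmorphD rmorphM /= map_polyX map_polyC rmorphD rmorphM /= IH horner_mx_X horner_mx_C.
rewrite specM -specC specD; apply: spec_ext => i.
by rewrite hornerMXaddC.
Qed.

Lemma spec_rat (r : @ratfun R) f : (forall i, r.2.[f i] != 0) ->
  rat_eval_mx r (spec f) = spec (fun i => rat_eval r (f i)).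
Proof.
by move=> q0; rewrite /rat_eval_mx !spec_poly (spec_unit q0).2 specM.
Qed.

End SpectralCalculus.

Section OperatorNorm.
Context {R : realType} {n : nat}.
Local Open Scope sesquilinear_scope.

Lemma normcE (z : R[i]) : `|z| = (Normc.normc z)%:C.
Proof. by rewrite normc_def; case: z. Qed.

Lemma l2norm_sqr (x : 'cV[R[i]]_n.+1) : ((l2norm x) ^+ 2)%:C = (x^t* *m x) 0 0.
Proof.
rewrite /l2norm sqr_sqrtr; last by apply: sumr_ge0 => i _; exact: sqr_ge0.
rewrite mxE rmorph_sum; apply: eq_bigr => i _.
by rewrite !mxE rmorphXn /= -normcE normCKC.
Qed.

Lemma l2norm_ge0 (x : 'cV[R[i]]_n.+1) : 0 <= l2norm x.
Proof. exact: sqrtr_ge0. Qed.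

Lemma l2norm_unitary (U : 'M[R[i]]_n.+1) x : U \is unitarymx -> l2norm (U *m x) = l2norm x.
Proof.
move=> Uu; apply/eqP; rewrite -(@eqrXn2 _ 2) ?l2norm_ge0 //.
rewrite -(inj_eq (@complex.complexI R)) !l2norm_sqr trmx_mul map_mxM mulmxA.
rewrite -(mulmxA (x^t* )) (_ : U^t* *m U = 1%:M) ?mulmx1 //.
by apply: mulmx1C; exact/unitarymxP.
Qed.

Lemma l2norm_diag (d : 'I_n.+1 -> R) b x : (forall i, `|d i| <= b) ->
  l2norm (diag_mx (\row_i (d i)%:C) *m x) <= b * l2norm x.
Proof.
move=> db; have b0 : 0 <= b by apply: le_trans (db ord0).
rewrite -(@ler_pXn2r _ 2) // ?nnegrE ?l2norm_ge0 ?mulr_ge0 ?l2norm_ge0 // exprMn /l2norm.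
rewrite !sqr_sqrtr; try by apply: sumr_ge0 => i _; exact: sqr_ge0.
rewrite mulr_sumr; apply: ler_sum => i _.
rewrite mul_diag_mx !mxE Normc.normcM exprMn ler_wpM2r ?sqr_ge0 //.
have -> : Normc.normc (d i)%:C = `|d i| by rewrite /= expr0n /= addr0 sqrtr_sqr.
by rewrite ler_pXn2r // nnegrE.
Qed.

Lemma opnorm2_spec_le (P : 'M[R[i]]_n.+1) (f : 'I_n.+1 -> R) b : P \is unitarymx ->
  (forall i, `|f i| <= b) -> opnorm2 (spec P f) <= b.
Proof.
move=> Pu fb; have b0 : 0 <= b by apply: le_trans (fb ord0).
rewrite /opnorm2; set S := [set _ | _ in _].
have [S0|S0] := pselect (S !=set0); last by rewrite sup_out // => -[].
apply: ge_sup => //.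
move=> _ [x /= x1 <-]; rewrite /spec /diagconj -!mulmxA l2norm_unitary; last first.
  by rewrite (invmx_unitary Pu) trmxC_unitary; exact: Pu.
by rewrite (le_trans (l2norm_diag _ fb)) // l2norm_unitary // x1 mulr1.
Qed.

Lemma opnorm2_ge0 (M : 'M[R[i]]_n.+1) : 0 <= opnorm2 M.
Proof.
rewrite /opnorm2; set S := [set _ | _ in _].
have [[[y Sy] ub]|/sup_out->//] := pselect (has_sup S).
apply: (@le_trans _ _ y); last exact: ub_le_sup.
by case: Sy => x _ <-; exact: l2norm_ge0.
Qed.
End OperatorNorm.

(** * Uniqueness of the principal root *)

Section Conjugation.
Variables (F : fieldType) (k : nat) (U : 'M[F]_k).
Hypothesis Uu : U \in unitmx.
Implicit Types (X D : 'M[F]_k) (v : 'rV[F]_k).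

Lemma conj_invK X : invmx U *m (U *m X *m invmx U) *m U = X.
Proof. by rewrite !mulmxA mulVmx // mul1mx mulmxKV. Qed.

Lemma conj_comm X D : X *m (invmx U *m D *m U) = (invmx U *m D *m U) *m X ->
  (U *m X *m invmx U) *m D = D *m (U *m X *m invmx U).
Proof.
move=> /(congr1 (fun N => U *m N *m invmx U)).
by rewrite !mulmxA mulmxK // mulmxV // mul1mx.
Qed.

Lemma comm_conj X D : X *m D = D *m X ->
  (invmx U *m X *m U) *m (invmx U *m D *m U) = (invmx U *m D *m U) *m (invmx U *m X *m U).
Proof. by move=> XD; rewrite !mulmxA !mulmxK // -!(mulmxA (invmx U)) XD. Qed.

Lemma conj_row X D v (w : F) : v *m X = w *: (v *m (invmx U *m D *m U)) ->
  (v *m invmx U) *m (U *m X *m invmx U) = w *: ((v *m invmx U) *m D).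
Proof.
by move=> vX; rewrite !mulmxA mulmxKV // vX -scalemxAl !mulmxA mulmxK.
Qed.

Lemma row_conj X v (w : F) : v *m X = w *: v ->
  (v *m U) *m (invmx U *m X *m U) = w *: (v *m U).
Proof. by move=> vX; rewrite !mulmxA mulmxK // vX -scalemxAl. Qed.

Lemma row_unit_neq0 v : v != 0 -> v *m U != 0 /\ v *m invmx U != 0.
Proof.
move=> v0; split; apply: contra v0 => /eqP e.
  by rewrite -[v](mulmxK Uu) e mul0mx.
by rewrite -[v](mulmxKV Uu) e mul0mx.
Qed.

End Conjugation.

Section PrincipalRoot.
Context {R : realType} {n : nat}.
Variable (P : 'M[R[i]]_n.+1).
Hypothesis Pu : P \is unitarymx.
Implicit Types (x f : 'I_n.+1 -> R).

Let Pi : P \in unitmx. Proof. exact: unitarymx_unit. Qed.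

Lemma eigenvalue_spec f a : eigenvalue (spec P f) a -> exists i, a = (f i)%:C.
Proof.
move=> /eigenvalueP[v va v0].
have [w wE] : exists w, w = v *m invmx P by exists (v *m invmx P).
have w0 : w != 0 by rewrite wE; exact: (row_unit_neq0 Pi v0).2.
have wD : w *m diag_mx (\row_i (f i)%:C) = a *: w.
  by rewrite wE scalemxAl -va /spec /diagconj !mulmxA mulmxK.
have /rV0Pn[i wi] := w0; exists i.
have /matrixP/(_ 0 i) := wD; rewrite mul_mx_diag !mxE => e.
by apply: (mulIf wi); rewrite -e mulrC.
Qed.

Lemma de_moivre (rho theta : R) k :
  ((rho * cos theta) +i* (rho * sin theta) : R[i]) ^+ k =
  (rho ^+ k * cos (k%:R * theta)) +i* (rho ^+ k * sin (k%:R * theta)).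
Proof.
elim: k => [|k IH]; first by rewrite !expr0 mul0r cos0 sin0 mulr1 mulr0.
rewrite exprS IH -natr1 mulrDl mul1r cosD sinD exprS.
by apply/eqP; rewrite eq_complex /=; apply/andP; split; apply/eqP; ring.
Qed.

(** The only [p]-th root of [b ^ p] in the open sector of half-angle [pi / p] is [b]. *)
Lemma sector_root p (rho theta b : R) : (0 < p)%N -> 0 < rho -> 0 < b ->
  `|theta| < pi / p%:R ->
  ((rho * cos theta) +i* (rho * sin theta) : R[i]) ^+ p = (b ^+ p)%:C ->
  (rho * cos theta) +i* (rho * sin theta) = b%:C.
Proof.
move=> p0 rho0 b0 th; rewrite de_moivre => -[ec es].
have p0' : 0 < p%:R :> R by rewrite ltr0n.
have rp : 0 < rho ^+ p by rewrite exprn_gt0.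
have s0 : sin (p%:R * theta) = 0.
  by apply/eqP; move/eqP: es; rewrite mulf_eq0 (gt_eqF rp).
have thp : `|p%:R * theta| < pi.
  by rewrite normrM gtr0_norm // mulrC -ltr_pdivlMr.
have t0 : p%:R * theta = 0.
  apply/eqP; apply: contraT => tn0; move: thp; rewrite ltr_norml => /andP[t1 t2].
  have [pos|neg|e] := ltrgtP (p%:R * theta) 0; last by rewrite e eqxx in tn0.
    have : 0 < sin (- (p%:R * theta)) by apply: sin_gt0_pi; rewrite oppr_gt0 pos /= ltrNl.
    by rewrite sinN s0 oppr0 ltxx.
  have : 0 < sin (p%:R * theta) by apply: sin_gt0_pi; rewrite neg.
  by rewrite s0 ltxx.
have th0 : theta = 0 by apply/eqP; move/eqP: t0; rewrite mulf_eq0 (gt_eqF p0').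
have rb : rho = b.
  move: ec; rewrite t0 cos0 mulr1 => /eqP.
  by rewrite eqrXn2 ?(ltW rho0) ?(ltW b0) // => /eqP.
by rewrite th0 cos0 sin0 mulr1 mulr0 rb.
Qed.

Lemma spec_principal_root p x : (0 < p)%N -> (forall i, 0 < x i) ->
  is_principal_root p (spec P (fun i => x i ^+ p)) (spec P x).
Proof.
move=> p0 x0; split; first by rewrite specX.
move=> a /eigenvalue_spec[i ->]; exists (x i), 0; split=> //.
  by rewrite normr0 divr_gt0 ?pi_gt0 // ltr0n.
by rewrite cos0 sin0 mulr1 mulr0.
Qed.

(** A matrix of finite order whose only eigenvalue is 1 is the identity, since the
factor [1 + X + ... + X^(p-1)] of [X^p - 1] does not vanish at 1. *)
Lemma finite_order_one p (M : 'M[R[i]]_n.+1) : (0 < p)%N -> M ^+ p = 1 ->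
  (forall w, eigenvalue M w -> w = 1) -> M = 1.
Proof.
move=> p0 Mp ev; pose Phi : {poly R[i]} := \sum_(i < p) 'X^i.
have HX : 'X^p - 1 = ('X - 1) * Phi by rewrite subrX1; congr (_ * _); apply: eq_bigr.
have [rs rsE] := closed_field_poly_normal Phi.
have Phi1 : Phi.[1] != 0.
  rewrite horner_sum (eq_bigr (fun=> 1)); last by move=> i _; rewrite hornerXn expr1n.
  by rewrite sumr_const card_ord pnatr_eq0 -lt0n.
have lc0 : lead_coef Phi != 0.
  by rewrite lead_coef_eq0; apply: contraNneq Phi1 => ->; rewrite horner0.
have PhiU : horner_mx M Phi \is a GRing.unit.
  rewrite rsE -mul_polyC rmorphM rmorph_prod unitrMl.
    by do 2 apply: rmorph_unit; rewrite unitfE.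
  apply: unitr_prod_in => z zr _.
  rewrite rmorphB /= horner_mx_X horner_mx_C.
  have rz : root Phi z.
    rewrite rsE rootZ // root_prod_XsubC //.
  rewrite -[_ \is a GRing.unit]/(_ \in unitmx) -row_free_unit -kermx_eq0.
  apply: contraTT rz => ker0; have -> : z = 1 by apply: ev.
  exact: Phi1.
have : horner_mx M ('X^p - 1) = 0.
  by rewrite rmorphB rmorphXn /= horner_mx_X Mp rmorph1 subrr.
rewrite HX rmorphM => /(congr1 (fun N => N * (horner_mx M Phi)^-1)).
rewrite mulrK // mul0r rmorphB /= horner_mx_X rmorph1 => /eqP.
by rewrite subr_eq0 => /eqP.
Qed.

(** If [X] is a principal root of [B ^ p], where [B = spec P x], then [X] commutes with
[B] and [M = X B^-1] satisfies [M ^ p = 1]; the only eigenvalue of [M] is 1, because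
that of [X] on an eigenvector common to [X] and [B] lies in the sector. *)
Lemma principal_root_unique p x X : (0 < p)%N -> (forall i, 0 < x i) ->
  is_principal_root p (spec P (fun i => x i ^+ p)) X -> X = spec P x.
Proof.
move=> p0 x0 [Xp sec].
have xn0 i : x i != 0 by rewrite gt_eqF.
have [Bu BV] := spec_unit Pu xn0.
set B := spec P x in Bu BV *.
have [X' X'E] : exists N, N = P *m X *m invmx P by exists (P *m X *m invmx P).
have XE : X = invmx P *m X' *m P by rewrite X'E conj_invK.
(* X commutes with its p-th power, so it is block diagonal in the basis P. *)
have X'0 i j : x i != x j -> X' i j = 0.
  move=> xij.
  have comm : X' *m diag_mx (\row_i (x i ^+ p)%:C) = diag_mx (\row_i (x i ^+ p)%:C) *m X'.
    have : X * spec P (fun i => x i ^+ p) = spec P (fun i => x i ^+ p) * X.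
      by rewrite -Xp -exprS exprSr.
    by rewrite X'E; exact: conj_comm.
  have /matrixP/(_ i j) := comm; rewrite mul_mx_diag mul_diag_mx !mxE => e.
  apply/eqP; apply: contraT => nz.
  have : (x j ^+ p)%:C = (x i ^+ p)%:C :> R[i] by apply: (mulIf nz); rewrite -e mulrC.
  move=> /complex.complexI/eqP; rewrite eqrXn2 ?(ltW (x0 _)) // => /eqP xji.
  by rewrite xji eqxx in xij.
pose D := diag_mx (\row_i (x i)%:C : 'rV[R[i]]_n.+1).
have DX' : X' *m D = D *m X'.
  apply/matrixP => i j; rewrite mul_mx_diag mul_diag_mx !mxE.
  have [->|xij] := eqVneq (x i) (x j); first by rewrite mulrC.
  by rewrite (X'0 _ _ xij) mulr0 mul0r.
have Bcomm : X * B = B * X.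
  by rewrite XE; exact: comm_conj.
pose M := X * B^-1.
suff M1 : M = 1.
  exact: etrans (esym (mulrVK Bu X)) (etrans (congr1 (fun N => N * B) M1) (mul1r B)).
have cXB : GRing.comm X B^-1 by apply: commrV.
have Mp : M ^+ p = 1.
  have xpn i : x i ^+ p != 0 by rewrite expf_neq0.
  rewrite /M exprMn_comm // exprVn specX // Xp; apply: mulrV.
  exact: (spec_unit Pu xpn).1.
apply: (finite_order_one p0 Mp) => w /eigenvalueP[v vM v0].
have wp : w ^+ p = 1.
  have vk k : v *m (M ^+ k) = w ^+ k *: v.
    elim: k => [|k IH]; first by rewrite !expr0 mulmx1 scale1r.
    by rewrite exprSr -[_ * M]/(_ *m M) mulmxA IH -scalemxAl vM scalerA -exprSr.
  have := vk p; rewrite Mp mulmx1 => /eqP; rewrite -subr_eq0 -[X in X - _]scale1r -scalerBl.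
  by rewrite scaler_eq0 (negbTE v0) orbF subr_eq0 => /eqP.
have [u uE] : exists u, u = v *m invmx P by exists (v *m invmx P).
have u0 : u != 0 by rewrite uE; exact: (row_unit_neq0 Pi v0).2.
have uX' : u *m X' = w *: (u *m D).
  have vX : v *m X = w *: (v *m B).
    rewrite -[X](mulrVK Bu) -/M -[M * B]/(M *m B) mulmxA vM.
    by rewrite scalemxAl.
  by rewrite uE X'E; exact: conj_row.
have uD : u *m D = \row_j (u 0 j * (x j)%:C).
  by apply/rowP => j; rewrite mul_mx_diag !mxE.
rewrite uD in uX'.
have /rV0Pn[i ui] := u0.
(* A left eigenvector of M with eigenvalue w, projected to one eigenspace of B, is an
   eigenvector of X with eigenvalue w x_i. *)
pose u' : 'rV[R[i]]_n.+1 := \row_j (if x j == x i then u 0 j else 0).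
have u'X' : u' *m X' = (w * (x i)%:C) *: u'.
  apply/rowP => j; rewrite !mxE.
  have [xj|xj] := eqVneq (x j) (x i); last first.
    rewrite mulr0 big1 // => k _; rewrite mxE; case: eqP => [xk|_]; last by rewrite mul0r.
    by rewrite X'0 ?mulr0 // xk eq_sym.
  have /rowP/(_ j) := uX'; rewrite !mxE xj => e.
  rewrite -mulrA [_ * u 0 j]mulrC -e; apply: eq_bigr => k _; rewrite mxE.
  case: eqP => [//|/eqP xk].
  by rewrite X'0 ?mulr0 ?mul0r // xj.
have evX : eigenvalue X (w * (x i)%:C).
  apply/eigenvalueP; exists (u' *m P); first by rewrite XE; exact: row_conj.
  have u'0 : u' != 0 by apply/rV0Pn; exists i; rewrite mxE eqxx.
  exact: (row_unit_neq0 Pi u'0).1.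
have [rho [theta [rho0 th e]]] := sec _ evX.
have xi0 : (x i)%:C != 0 :> R[i] by rewrite (inj_eq (@complex.complexI R)).
apply: (mulIf xi0); rewrite mul1r e; apply: sector_root p0 rho0 (x0 i) th _.
by rewrite -e exprMn wp mul1r rmorphXn.
Qed.

Lemma mxroot_spec p x : (0 < p)%N -> (forall i, 0 < x i) ->
  mxroot p (spec P (fun i => x i ^+ p)) = spec P x.
Proof.
move=> p0 x0; apply: xget_subset1; first exact: spec_principal_root.
by move=> X Y /principal_root_unique -> // /principal_root_unique ->.
Qed.

End PrincipalRoot.

Section Diagonalization.
Context {R : realType} {n : nat}.
Local Open Scope sesquilinear_scope.

Lemma hermitian_spec (A : 'M[R[i]]_n.+1) (a b : R) : A \is hermsymmx ->
  (forall z : R[i], eigenvalue A z -> a%:C <= z <= b%:C) ->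
  exists P : 'M[R[i]]_n.+1, exists f : 'I_n.+1 -> R,
   [/\ P \is unitarymx, A = spec P f & forall i, a <= f i <= b].
Proof.
move=> /hermitian_normalmx/orthomx_spectralP AE ev.
set P := spectralmx A in AE; set d := spectral_diag A in AE.
have Pu : P \is unitarymx by exact: spectral_unitarymx.
have Pi : P \in unitmx by exact: unitarymx_unit.
have evd i : eigenvalue A (d 0 i).
  apply/eigenvalueP; exists (delta_mx 0 i *m P).
    rewrite AE; apply: row_conj => //.
    apply/rowP => j; rewrite mul_mx_diag !mxE eqxx /=.
    by case: eqP => [->|_]; rewrite ?mul1r ?mulr1 // mul0r mulr0.
  apply: (row_unit_neq0 Pi _).1; apply/rV0Pn; exists i.
  by rewrite mxE !eqxx oner_eq0.
have dE i : d 0 i = (complex.Re (d 0 i))%:C /\ a <= complex.Re (d 0 i) <= b.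
  have /andP[h1 h2] := ev _ (evd i).
  move: h1 h2; rewrite !lecE /= => /andP[/eqP im ->] /andP[_ ->].
  by split=> //; case: (d 0 i) im => u v /= ->.
exists P, (fun i => complex.Re (d 0 i)); split; first exact: Pu; last first.
  by move=> i; case: (dE i).
have dd : d = \row_i (complex.Re (d 0 i))%:C.
  by apply/rowP => i; rewrite mxE; case: (dE i).
rewrite /spec /diagconj -dd; exact: AE.
Qed.
End Diagonalization.

(** * The coupled iteration *)

Section ScalarBounds.
Context {R : realType}.
Implicit Types e u : R.

Lemma sum_powers_ge2 e q : 0 <= e <= 1 -> 2 <= (1 + e) ^+ q + (1 - e) ^+ q.
Proof.
move=> /andP[e0 e1]; elim: q => [|q IH]; first by rewrite !expr0.
rewrite !exprS (_ : _ + _ = (1 + e) ^+ q + (1 - e) ^+ q + e * ((1 + e) ^+ q - (1 - e) ^+ q));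
  last by ring.
rewrite (le_trans IH) // lerDl mulr_ge0 // subr_ge0 lerXn2r ?nnegrE; lra.
Qed.

Lemma scaled_dev1 e u : 0 < e < 1 -> (1 - e) / (1 + e) <= u <= 1 ->
  `|u / (1 - e) - 1| <= e / (1 - e).
Proof.
move=> /andP[e0 e1] /andP[]; rewrite ler_pdivrMr ?addr_gt0 // => u1 u2.
have me : 0 < 1 - e by rewrite subr_gt0.
rewrite (_ : u / (1 - e) - 1 = (u - (1 - e)) / (1 - e)); last by field; exact: lt0r_neq0.
rewrite normrM normfV (gtr0_norm me) ler_pM2r ?invr_gt0 // ler_norml.
apply/andP; split; last by lra.
have : e * (1 - u) >= 0 by rewrite mulr_ge0 ?subr_ge0 // ltW.
nra.
Qed.

Lemma scaled_devX e u q : 0 < e < 1 -> (1 - e) / (1 + e) <= u <= 1 ->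
  `|(u / (1 - e)) ^+ q - 1| <= ((1 + e) ^+ q - 1) / (1 - e) ^+ q.
Proof.
move=> /andP[e0 e1] /andP[u1 u2].
have me : 0 < 1 - e by rewrite subr_gt0.
have pe : 0 < 1 + e by rewrite addr_gt0.
have u0 : 0 < u by apply: lt_le_trans u1; rewrite divr_gt0.
have meq : 0 < (1 - e) ^+ q by rewrite exprn_gt0.
have peq : 0 < (1 + e) ^+ q by rewrite exprn_gt0.
have pe1 : 1 <= (1 + e) ^+ q by rewrite exprn_ege1 // lerDl ltW.
have me1 : (1 - e) ^+ q <= (1 + e) ^+ q by rewrite lerXn2r ?nnegrE; lra.
rewrite ler_norml; apply/andP; split.
  have lo : ((1 + e) ^+ q)^-1 <= (u / (1 - e)) ^+ q.
    rewrite -exprVn lerXn2r ?nnegrE ?invr_ge0 ?divr_ge0 ?(ltW pe) ?(ltW me) ?(ltW u0) //.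
    by rewrite ler_pdivlMr // mulrC.
  have e1' : ((1 + e) ^+ q)^-1 = 1 - ((1 + e) ^+ q - 1) / (1 + e) ^+ q.
    by field; rewrite gt_eqF.
  have e2 : ((1 + e) ^+ q - 1) / (1 + e) ^+ q <= ((1 + e) ^+ q - 1) / (1 - e) ^+ q.
    by rewrite ler_wpM2l ?subr_ge0 // lef_pV2.
  rewrite {}e1' in lo; move: lo e2.
  move: (_ / (1 + e) ^+ q) (_ / (1 - e) ^+ q) ((u / _) ^+ q) => d1 d2 d3; lra.
rewrite expr_div_n lerBlDr.
have e01 : 0 <= e <= 1 by rewrite !ltW.
have two := sum_powers_ge2 q e01.
rewrite (_ : _ / _ + 1 = ((1 + e) ^+ q - 1 + (1 - e) ^+ q) / (1 - e) ^+ q); last first.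
  by field; rewrite gt_eqF.
rewrite ler_pM2r ?invr_gt0 //.
have : u ^+ q <= 1 by rewrite exprn_ile1 // ltW.
lra.
Qed.

Lemma power_bound_cvg0 (eps : nat -> R) q : eps @ \oo --> (0 : R) ->
  (((1 + eps k) ^+ q - 1) / (1 - eps k) ^+ q) @[k --> \oo] --> (0 : R).
Proof.
move=> e0.
pose g : {poly R} := (1 + 'X) ^+ q - 1; pose h : {poly R} := (1 - 'X) ^+ q.
have gE (t : R) : g.[t] = (1 + t) ^+ q - 1.
  by rewrite hornerD hornerN horner_exp hornerD hornerX -(polyC1 R) !hornerC.
have hE (t : R) : h.[t] = (1 - t) ^+ q.
  by rewrite horner_exp hornerD hornerN hornerX -(polyC1 R) hornerC.
have cg (w : {poly R}) : w.[eps k] @[k --> \oo] --> w.[0].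
  by apply: (@cvg_comp _ _ _ _ _ _ (nbhs (0 : R)) _ e0); exact: continuous_horner.
rewrite (_ : (0 : R) = g.[0] / h.[0]); last by rewrite gE addr0 expr1n subrr mul0r.
rewrite (_ : (fun _ => _) = fun k => g.[eps k] / h.[eps k]); last first.
  by apply/funext => k; rewrite gE hE.
apply: cvgM; first exact: cg.
by apply: cvgV; [rewrite hE subr0 expr1n oner_neq0 | exact: cg].
Qed.

End ScalarBounds.

(* Only the rules of the calculus are used from here on. *)
Opaque spec.

Section MatrixIteration.
Context {R : realType} {n : nat}.
Variables (m l p : nat) (alpha : R) (al : nat -> R).
Variables (P : 'M[R[i]]_n.+1) (x : 'I_n.+1 -> R) (Y Z : nat -> 'M[R[i]]_n.+1).
Hypotheses (p2 : (1 < p)%N) (Pu : P \is unitarymx).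
Hypotheses (al01 : forall k, 0 < al k < 1) (x1 : forall i, al 0%N <= x i <= 1)
  (alS : forall k, al k.+1 = al k * rat_eval (hfun l m p (al k)) (al k ^+ p)).
Hypotheses (Y0 : Y 0%N = spec P (fun i => x i ^+ p)) (Z0 : Z 0%N = 1)
  (YS : forall k, Y k.+1 = Y k * rat_eval_mx (hfun l m p (al k)) (Z k * Y k) ^+ p.-1)
  (ZS : forall k, Z k.+1 = rat_eval_mx (hfun l m p (al k)) (Z k * Y k) * Z k).

(** In the eigenbasis of [A = X ^ p] the iteration is scalar: the eigenvalues
[u = x z] of [X Z_k] follow [u |-> u h(u ^ p)], the same recursion as [alpha], and
stay in [[alpha_k, 1]]. *)
Lemma iterates_spec k : exists z : 'I_n.+1 -> R,
  [/\ Z k = spec P z, Y k = spec P (fun i => x i ^+ p * z i ^+ p.-1),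
      Z k * Y k = spec P (fun i => (x i * z i) ^+ p) & forall i, al k <= x i * z i <= 1].
Proof.
have ZY z k' : Z k' = spec P z -> Y k' = spec P (fun i => x i ^+ p * z i ^+ p.-1) ->
    Z k' * Y k' = spec P (fun i => (x i * z i) ^+ p).
  move=> -> ->; rewrite (specM Pu); apply: spec_ext => i.
  by rewrite mulrCA -exprS prednK ?exprMn // ltnW.
elim: k => [|k [z [Zk Yk ZYk uk]]].
  have Z0' : Z 0%N = spec P (fun=> 1) by rewrite (spec1 Pu).
  have Y0' : Y 0%N = spec P (fun i => x i ^+ p * 1 ^+ p.-1).
    by rewrite Y0; apply: spec_ext => i; rewrite expr1n mulr1.
  exists (fun=> 1); split; [exact: Z0' | exact: Y0' | exact: ZY Z0' Y0' |].
  by move=> i; rewrite mulr1; exact: x1.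
have [H Ha] := hfunP m l p2 (al01 k).
pose h i := rat_eval (hfun l m p (al k)) ((x i * z i) ^+ p).
have rE : rat_eval_mx (hfun l m p (al k)) (Z k * Y k) = spec P h.
  by rewrite ZYk; apply: (spec_rat Pu) => i; case: (H _ (uk i)).
have Z1 : Z k.+1 = spec P (fun i => h i * z i) by rewrite ZS rE Zk; exact: (specM Pu).
have Y1 : Y k.+1 = spec P (fun i => x i ^+ p * (h i * z i) ^+ p.-1).
  rewrite YS rE Yk (specX Pu) (specM Pu); apply: spec_ext => i.
  rewrite /= [(h i * z i) ^+ _]exprMn; ring.
exists (fun i => h i * z i); split; [exact: Z1 | exact: Y1 | exact: ZY Z1 Y1 |].
move=> i; rewrite alS Ha (_ : x i * (h i * z i) = x i * z i * h i); last by ring.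
exact: (H _ (uk i)).2.
Qed.

End MatrixIteration.

Theorem corollary3p4 (R : realType) (alpha : R) (m l p n : nat)
    (A : 'M[R[i]]_n.+1)
    (Y Z : nat -> 'M[R[i]]_n.+1) (al eps : nat -> R) :
  0 < alpha < 1 ->
  (2 <= p)%N ->
  (m, l) != (0%N, 0%N) ->
  posdefmx A ->
  (forall a : R[i], eigenvalue A a -> (alpha ^+ p)%:C <= a <= 1) ->
  Y 0%N = A ->
  Z 0%N = 1 ->
  al 0%N = alpha ->
  (forall k, Y k.+1 =
     Y k * rat_eval_mx (hfun l m p (al k)) (Z k * Y k) ^+ p.-1) ->
  (forall k, Z k.+1 = rat_eval_mx (hfun l m p (al k)) (Z k * Y k) * Z k) ->
  (forall k, al k.+1 = al k * rat_eval (hfun l m p (al k)) (al k ^+ p)) ->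
  eps 0%N = (1 - alpha) / (1 + alpha) ->
  (forall k, eps k.+1 =
     best_err m l (proot p) `[((1 - eps k) / (1 + eps k)) ^+ p, 1]) ->
  let Yt k := ((1 + al k) ^+ p.-1 / (2 * al k) ^+ p.-1)%:C *: Y k in
  let Zt k := ((1 + al k) / (2 * al k))%:C *: Z k in
  let Ar := mxroot p A in
  let Ari := (mxroot p A)^-1 in
  [/\ (* every iterate is well defined *)
      forall k, [/\ 0 < al k < 1,
        (hfun l m p (al k)).2.[al k ^+ p] != 0 &
        poly_eval_mx (hfun l m p (al k)).2 (Z k * Y k) \is a GRing.unit],
      (* convergence *)
      opnorm2 (Yt k - Ar) @[k --> \oo] --> (0 : R) /\
      opnorm2 (Zt k - Ari) @[k --> \oo] --> (0 : R),
      (* error bounds *)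
      forall k,
        opnorm2 (Yt k * Ari - 1)
          <= ((1 + eps k) ^+ p.-1 - 1) / (1 - eps k) ^+ p.-1 /\
        opnorm2 (Zt k * Ar - 1) <= eps k / (1 - eps k),
      (* order m + l + 1 *)
      eps @ \oo --> (0 : R) /\
      (fun k => eps k.+1) =O_\oo (fun k => eps k ^+ (m + l + 1)) &
      (* asymptotics of the recursion *)
      (fun k => eps k.+1 - rate_const m l p * eps k ^+ (m + l + 1))
        =o_\oo (fun k => eps k ^+ (m + l + 1))].
Proof.
move=> alpha01 p2 ml0 [Ah _] evA Y0 Z0 al0 YS ZS alS eps0 epsS Yt Zt Ar Ari.
have p0 : (0 < p)%N by exact: ltnW.
have /andP[alpha0 alpha1] := alpha01.
have epsS' k : eps k.+1 = best_err m l (proot p) (zitv p ((1 - eps k) / (1 + eps k))).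
  exact: epsS.
have al01 k : 0 < al k < 1 by case: (al_eps p2 alpha01 al0 alS eps0 epsS' k).
have alE k : al k = (1 - eps k) / (1 + eps k) := alE p2 alpha01 al0 alS eps0 epsS' k.
have e01 k : 0 < eps k < 1 := eps01 p2 alpha01 al0 alS eps0 epsS' k.
have ecv : eps @ \oo --> (0 : R) := eps_cvg0 p2 alpha01 ml0 al0 alS eps0 epsS'.
have [P [f [Pu AE fb]]] : exists P : 'M[R[i]]_n.+1, exists f : 'I_n.+1 -> R,
   [/\ P \is unitarymx, A = spec P f & forall i, alpha ^+ p <= f i <= 1].
  exact: hermitian_spec Ah evA.
pose x i := proot p (f i).
have xp i : x i ^+ p = f i.
  by apply: exp_proot => //; case/andP: (fb i) => + _; apply: le_trans; rewrite exprn_ge0 // ltW.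
have x1 i : alpha <= x i <= 1.
  have xi0 : 0 <= x i by exact: powR_ge0.
  rewrite -(ler_pXn2r p0) ?nnegrE ?(ltW alpha0) //.
  by rewrite -[X in _ && X](ler_pXn2r p0) ?nnegrE ?ler01 // expr1n xp.
have x0 i : 0 < x i by case/andP: (x1 i) => + _; exact: lt_le_trans.
have xn0 i : x i != 0 by rewrite gt_eqF.
have Ax : A = spec P (fun i => x i ^+ p) by rewrite AE; apply: spec_ext => i; rewrite xp.
have ArE : Ar = spec P x.
  exact: etrans (congr1 (mxroot p) Ax) (mxroot_spec Pu p0 x0).
have AriE : Ari = spec P (fun i => (x i)^-1).
  exact: etrans (congr1 GRing.inv ArE) (spec_unit Pu xn0).2.
have x1' i : al 0%N <= x i <= 1 by rewrite al0.
have Y0' : Y 0%N = spec P (fun i => x i ^+ p) by rewrite Y0.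
have it k := iterates_spec p2 Pu al01 x1' alS Y0' Z0 YS ZS k.
have me k : 0 < 1 - eps k by case/andP: (e01 k) => _; rewrite subr_gt0.
have pe k : 0 < 1 + eps k by case/andP: (e01 k) => e0 _; rewrite addr_gt0.
(* The factors scaling the iterates are powers of 1 / (1 - eps k). *)
have cE k : (1 + al k) / (2 * al k) = (1 - eps k)^-1.
  by rewrite alE; field; rewrite !gt_eqF.
have ZtE k : exists2 u : 'I_n.+1 -> R, forall i, al k <= u i <= 1 &
    Zt k = spec P (fun i => (u i / (1 - eps k)) / x i) /\
    Yt k = spec P (fun i => x i * (u i / (1 - eps k)) ^+ p.-1).
  have [z [Zk Yk _ uk]] := it k; exists (fun i => x i * z i); first exact: uk.
  split.
    rewrite /Zt Zk cE; apply: etrans (specZ Pu _ _) _; apply: spec_ext => i.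
    by field; rewrite xn0 gt_eqF.
  rewrite /Yt -expr_div_n cE Yk; apply: etrans (specZ Pu _ _) _; apply: spec_ext => i.
  rewrite -(prednK p0) exprS /= !exprMn; ring.
have yb k : opnorm2 (Yt k * Ari - 1) <= ((1 + eps k) ^+ p.-1 - 1) / (1 - eps k) ^+ p.-1.
  have [u uk [_ ->]] := ZtE k.
  rewrite AriE (specM Pu) -(spec1 Pu) (specN Pu) specD; apply: opnorm2_spec_le => // i.
  rewrite mulrAC divff // mul1r; apply: scaled_devX => //.
  by rewrite -alE.
have zb k : opnorm2 (Zt k * Ar - 1) <= eps k / (1 - eps k).
  have [u uk [-> _]] := ZtE k.
  rewrite ArE (specM Pu) -(spec1 Pu) (specN Pu) specD; apply: opnorm2_spec_le => // i.
  by rewrite divfK //; apply: scaled_dev1 => //; rewrite -alE.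
split.
- move=> k; have [z [Zk Yk ZYk uk]] := it k.
  have [H _] := hfunP m l p2 (al01 k); split=> //.
    apply: (H _ _).1; rewrite lexx ltW //; by case/andP: (al01 k).
  rewrite ZYk (spec_poly Pu); apply: (spec_unit Pu _).1 => i.
  exact: (H _ (uk i)).1.
- split.
    apply: (@squeeze_cvgr _ _ _ _ (fun=> 0)
      (fun k => ((1 + eps k) ^+ p.-1 - 1) / (1 - eps k) ^+ p.-1)).
    + apply: nearW => k; rewrite opnorm2_ge0 /=.
      have [u uk [_ ->]] := ZtE k; rewrite ArE (specN Pu) specD; apply: opnorm2_spec_le => // i.
      rewrite -[X in _ - X]mulr1 -mulrBr normrM (gtr0_norm (x0 i)).
      have D : `|(u i / (1 - eps k)) ^+ p.-1 - 1| <=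
          ((1 + eps k) ^+ p.-1 - 1) / (1 - eps k) ^+ p.-1.
        by apply: scaled_devX => //; rewrite -alE.
      by apply: le_trans D; rewrite ler_piMl //; case/andP: (x1 i).
    + exact: cvg_cst.
    + exact: power_bound_cvg0.
  apply: (@squeeze_cvgr _ _ _ _ (fun=> 0)
    (fun k => ((1 + eps k) ^+ 1 - 1) / (1 - eps k) ^+ 1 * alpha^-1)).
  + apply: nearW => k; rewrite opnorm2_ge0 /=.
    have [u uk [-> _]] := ZtE k; rewrite AriE (specN Pu) specD; apply: opnorm2_spec_le => // i.
    rewrite -[X in _ - X]mul1r -mulrBl normrM (gtr0_norm (_ : 0 < (x i)^-1)) ?invr_gt0 //.
    apply: ler_pM; rewrite ?invr_ge0 ?(ltW (x0 _)) //.
      by rewrite -[u i / _]expr1; apply: scaled_devX => //; rewrite -alE.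
    by rewrite lef_pV2 ?posrE ?x0 //; case/andP: (x1 i).
  + exact: cvg_cst.
  + rewrite -[X in _ --> X](mul0r alpha^-1); apply: cvgM; last exact: cvg_cst.
    exact: power_bound_cvg0.
- by [].
- split=> //; exact: (eps_bigO p2 alpha01 ml0 al0 alS eps0 epsS').
- exact: (eps_littleo p2 alpha01 ml0 al0 alS eps0 epsS').
Qed.
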